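(* Let $d\ge1$ and $\alpha>0$. There exists a deterministic probability measure $\mu$ on $\mathcal{G}$, whose support is all of $\mathcal{G}$ (i.e. $\mu(\{\gamma\})>0$ for every $\gamma\in\mathcal{G}$), such that the family of random measures $\mu_R$ converges in probability to $\mu$ as $R\to\infty$; that is, for every $\varepsilon>0$, $\lim_{R\to\infty}\mathbb{P}\{d(\mu_R,\mu)>\varepsilon\}=0$.
   Context: $\mathcal{G}$ is the (countable) set of homotopy equivalence classes of finite connected $\mathbb{R}^d$-geometric complexes, i.e. connected simplicial complexes that arise as Čech complexes (nerves) of finite families of Euclidean balls of a common radius in $\mathbb{R}^d$ (equivalently, by the Nerve Lemma, homotopy types of connected finite unions of such balls). Let $P=\{p_1,p_2,\dots\}$ be a standard (unit intensity, homogeneous) Poisson point process on $\mathbb{R}^d$, and let $\mathcal{P}=\bigcup_{p\in P}B(p,\alpha)$, where $B(x,r)$ is the Euclidean ball. Let $\mathcal{P}_R$ be the union of all connected components of $\mathcal{P}$ that are completely contained in the interior of $B(0,R)$, and let $\check C(\mathcal{P}_R)$ be the corresponding Čech complex (nerve of the balls forming $\mathcal{P}_R$), which is homotopy equivalent to $\mathcal{P}_R$. The random probability measure $\mu_R$ on $\mathcal{G}$ is $$\mu_R=\frac{1}{b_0(\check C(\mathcal{P}_R))}\sum_s\delta_{[s]},$$ where the sum is over all connected components $s$ of $\mathcal{P}_R$, $[s]$ is the homotopy type of $s$, and $b_0$ is the number of connected components; if $\mathcal{P}_R$ is empty, $\mu_R$ is set equal to an arbitrary fixed probability measure on $\mathcal{G}$.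 The total variation distance is $d(\mu_1,\mu_2)=\sup_{A\subset\mathcal{G}}|\mu_1(A)-\mu_2(A)|$. *)

(* Defs.v *)
From HB Require Import structures.
From mathcomp Require Import all_boot all_order all_algebra finmap.
From mathcomp Require Import all_classical all_reals all_analysis.
Import Order.TTheory GRing.Theory Num.Theory.
Import numFieldNormedType.Exports.

Set Implicit Arguments.
Unset Strict Implicit.
Unset Printing Implicit Defensive.

Local Open Scope classical_set_scope.
Local Open Scope ring_scope.

Section topology.
Context {R : realType}.

Definition components {T : topologicalType} (A : set T) : set (set T) :=
  [set connected_component A x | x in A].

(* Subspaces are sets in an ambient space; maps are total on the ambient space
   but only their restrictions to the subspaces matter. *)
Definition homotopic_in {T U : topologicalType} (A : set T) (B : set U)
    (f g : T -> U) : Prop :=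
  exists H : R * T -> U,
    [/\ {within `[0, 1]%classic `*` A, continuous H},
        forall s x, s \in `[0, 1] -> A x -> B (H (s, x)),
        forall x, A x -> H (0, x) = f x &
        forall x, A x -> H (1, x) = g x].

Definition homotopy_equiv {T U : topologicalType} (A : set T) (B : set U) :
    Prop :=
  exists (f : T -> U) (g : U -> T),
    [/\ {within A, continuous f} /\ {within B, continuous g},
        f @` A `<=` B,
        g @` B `<=` A,
        homotopic_in A A (g \o f) idfun &
        homotopic_in B B (f \o g) idfun].

(* Geometric realization of an abstract simplicial complex [K] (given by its
   nonempty simplices), in barycentric coordinates.  The topology is that of
   pointwise convergence, which is the usual one for finite complexes; no
   others are used. *)
Definition realization {V : choiceType} (K : set {fset V}) :
    set {ptws V -> R} :=
  [set t | exists2 S, K S &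
    [/\ forall v, v \in S -> 0 < t v,
        forall v, v \notin S -> t v = 0 &
        \sum_(v <- S) t v = 1]].

End topology.

Section geometric_complexes.
Context {R : realType} {d : nat}.
Implicit Types (x y : 'rV[R]_d) (r : R).

Definition edist x y : R := Num.sqrt (\sum_(i < d) (x 0 i - y 0 i) ^+ 2).

Definition eball x r : set 'rV[R]_d := [set y | edist x y <= r].

Definition cech {V : choiceType} (D : set V) (c : V -> 'rV[R]_d) r :
    set {fset V} :=
  [set S | [/\ S != fset0, [set` S] `<=` D &
               (\bigcap_(v in [set` S]) eball (c v) r) !=set0]].

End geometric_complexes.

Section homotopy_classes.
Context (R : realType) (d : nat).

(* The [.+1] excludes the empty complex, for which [connected] holds. *)
Record gcomplex := GComplex {
  gc_size : nat;
  gc_center : 'I_gc_size.+1 -> 'rV[R]_d;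
  gc_radius : R;
  gc_radius_gt0 : 0 < gc_radius;
  gc_connected :
    connected (@realization R _ (cech setT gc_center gc_radius)) }.

Definition gc_space (K : gcomplex) :=
  @realization R _ (cech setT (@gc_center K) (gc_radius K)).
Arguments gc_space K : clear implicits.

(* The homotopy type of a space, recorded as the set of all finite connected
   geometric complexes of that type. *)
Definition hclass {T : topologicalType} (A : set T) : set gcomplex :=
  [set K | @homotopy_equiv R _ _ A (gc_space K)].

Record gclass := GClass {
  gclass_set :> set gcomplex;
  gclassP : exists K, gclass_set = hclass (gc_space K) }.

Lemma gcomplex1_connected : connected
  (@realization R _ (cech setT (fun _ : 'I_1 => 0 : 'rV[R]_d) 1)).
Proof.
set A := realization _; have sA t : A t -> t = (fun=> 1).
  move=> [S [S0 _ _] [_ _]]; have -> : S = [fset ord0]%fset.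
    case/fset0Pn: S0 => v vS; apply/fsetP => i; rewrite inE.
    by rewrite [i]ord1 eqxx -vS [v]ord1.
  by rewrite big_seq_fset1 => t1; apply/funext => i; rewrite [i]ord1.
move=> B [b Bb] [C _ BE] _; rewrite BE; apply/seteqP; split=> [t []//|t At].
split=> //; move: (Bb); rewrite BE => -[Ab Cb].
by rewrite (sA _ At) -(sA _ Ab).
Qed.

Definition gcomplex1 : gcomplex := GComplex ltr01 gcomplex1_connected.

Definition gclass1 : gclass := GClass (ex_intro _ gcomplex1 erefl).

HB.instance Definition _ := gen_eqMixin gclass.
HB.instance Definition _ := gen_choiceMixin gclass.
HB.instance Definition _ := isPointed.Build gclass gclass1.
HB.instance Definition _ := @isMeasurable.Build default_measure_display
  gclass discrete_measurable discrete_measurable0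
  discrete_measurableC discrete_measurableU.

(* The default value is irrelevant for finite connected unions of balls of a
   common radius: by the Nerve Lemma they have the type of a [gcomplex]. *)
Definition htype {T : topologicalType} (A : set T) : gclass :=
  xget point [set g : gclass | gclass_set g = hclass A].

End homotopy_classes.

Arguments gc_space {R d} K.

Section poisson_process.
Context {R : realType}.

(* Lebesgue measure on R^n (for Borel sets), as an iterated integral. *)
Fixpoint lebesgue_rV (n : nat) : set 'rV[R]_n -> \bar R :=
  match n return set 'rV[R]_n -> \bar R with
  | 0 => fun A => (\1_A (0 : 'rV[R]_0))%:E
  | n'.+1 => fun A => (\int[lebesgue_measure]_x
      lebesgue_rV [set v : 'rV[R]_n' | A (row_mx (x%:M : 'rV[R]_1) v)])%E
  end.

Context {d : nat}.

Definition bounded_borel (A : set 'rV[R]_d) : Prop :=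
  <<s [set U : set 'rV[R]_d | open U] >> A /\ exists r, A `<=` eball 0 r.

Definition npoints (X A : set 'rV[R]_d) : nat := #|` fset_set (X `&` A) |.

Definition independent_nat_RVs {dO : measure_display}
    {Omega : measurableType dO} (P : probability Omega R) (n : nat)
    (N : 'I_n -> Omega -> nat) : Prop :=
  forall B : 'I_n -> set nat,
    (P (\bigcap_(i in [set: 'I_n]) (N i @^-1` B i)) =
     \prod_(i < n) P (N i @^-1` B i))%E.

(* The probability mass function is spelled out because the library's
   [poisson_pmf] is constantly 1 at rate 0. *)
Record poisson_process {dO : measure_display} {Omega : measurableType dO}
    (P : probability Omega R) (X : Omega -> set 'rV[R]_d) : Prop := {
  poisson_locally_finite : forall w r, finite_set (X w `&` eball 0 r);
  poisson_measurable : forall A, bounded_borel A ->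
    measurable_fun setT (fun w => npoints (X w) A);
  poisson_law : forall A, bounded_borel A -> forall k : nat,
    P [set w | npoints (X w) A = k] =
    (let vol := fine (lebesgue_rV A) in
     vol ^+ k / k`!%:R * expR (- vol))%:E;
  poisson_independent : forall (n : nat) (A : 'I_n -> set 'rV[R]_d),
    (forall i, bounded_borel (A i)) -> trivIset setT A ->
    independent_nat_RVs P (fun i w => npoints (X w) (A i)) }.

End poisson_process.

Section random_complex.
Context {R : realType} {d : nat}.
Implicit Types (X : set 'rV[R]_d) (alpha r : R).

Definition ball_union X alpha : set 'rV[R]_d := \bigcup_(p in X) eball p alpha.

Definition ball_union_in X alpha r : set 'rV[R]_d :=
  \bigcup_(s in [set s | components (ball_union X alpha) s /\
                         s `<=` (eball 0 r)^°]) s.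

Definition cech_in X alpha r : set {fset 'rV[R]_d} :=
  cech [set p | X p /\ eball p alpha `<=` ball_union_in X alpha r] id alpha.

Definition b0 {V : choiceType} (K : set {fset V}) : nat :=
  #|` fset_set (components (@realization R _ K)) |.

Definition mu_in (nu : probability (gclass R d) R) X alpha r
    (A : set (gclass R d)) : \bar R :=
  if pselect (ball_union_in X alpha r = set0) then nu A
  else (((b0 (cech_in X alpha r))%:R^-1)%:E *
        \sum_(s \in components (ball_union_in X alpha r))
          (\d_(htype R d s) A : \bar R))%E.

Definition dTV {T : Type} (mu1 mu2 : set T -> \bar R) : \bar R :=
  ereal_sup [set `|mu1 A - mu2 A|%E | A in [set: set T]].

End random_complex.

(* Main.v *)
Require Import Defs.
From mathcomp Require Import all_boot all_order all_algebra finmap.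
From mathcomp Require Import all_classical all_reals all_analysis.
From mathcomp Require Import measurable_realfun.
From mathcomp Require Import ring lra zify.
Import Order.TTheory GRing.Theory Num.Theory.
Import numFieldNormedType.Exports.
(* edist is the Euclidean distance. *)
Import Defs.


(** Points of the configuration X are linked when their balls of radius alpha
    meet; a cluster is a class of points for the relation generated by these
    links.  The components of the union of the balls are the unions of the balls
    of the clusters, so the random measure gives to a set A of types the number
    of the clusters of type in A that lie in the inner region, divided by the
    number of all clusters in that region (mu_inE).  The theorem reduces to this:
    for the types indexed by k, the number of clusters of type k in the inner
    region, divided by the number of lattice points in a ball of about the same
    radius, tends to a constant D k, in mean and in l1 over all types at once,
    and D k is positive for every type.  The measure mu is the normalisation of D
    (discrete_probability), the ratio of two close counts being close to the
    ratio of the limits (empirical_close).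

    Geometry.  By the nerve theorem for balls (nerve_eballs) the types of the
    clusters of a finite configuration can be read off its nerve (ncl_pattern).
    By compactness the nerve does not change when the points are moved slightly
    and the radius is slightly enlarged (cech_stable).  So the number of clusters
    of each type is eventually determined by the occupied cells of finer and
    finer subdivisions of a box (approximable_ncl), and the Poisson law of the
    numbers of points in boxes yields the measurability of all events at hand,
    their invariance under translation and their independence in disjoint boxes
    (approximable_measurable, approximable_law, approximable_indep).

    Law of large numbers.  Space is cut into blocks of side L.  The counts of the
    clusters inside the cores of the blocks, at distance h >= 2 alpha from their
    boundaries, are identically distributed and pairwise independent, and they
    miss at most one cluster per point outside of the cores (ncl_blocks,
    badcl_types).  In mean these points are few when L is large, because few
    lattice points of a large ball are close to its boundary (shell_small,
    blocks_density).  A second moment bound, applied to the indicators of the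
    events that a count exceeds l, gives a law of large numbers in mean that is
    uniform over the types (mean_dev_family).  So for every e > 0 the frequencies
    are eventually within e of a constant sequence (freq_close); these sequences
    form a Cauchy family, whose limit is D (freq_limit).

    Positivity.  A type is realised by finitely many points.  By stability it is
    still realised by any configuration with exactly one point in small disjoint
    boxes around scaled copies of these points and no other point in the block,
    an event of positive probability (block_mean_positive); blocks containing
    such a cluster have positive density (limit_positive). *)

Set Implicit Arguments.
Unset Strict Implicit.
Unset Printing Implicit Defensive.

Local Open Scope classical_set_scope.
Local Open Scope ring_scope.

(** * Homotopy equivalence of subspaces is an equivalence relation *)

Lemma within_comp (T U V : topologicalType) (A : set T) (B : set U)
    (f : T -> U) (g : U -> V) :
  {within A, continuous f} -> (forall x, A x -> B (f x)) ->
  {within B, continuous g} -> {within A, continuous (g \o f)}.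
Proof.
move=> /subspace_continuousP cf AB /subspace_continuousP cg.
apply/subspace_continuousP => x Ax W /= Wgf.
have /= := cg _ (AB _ Ax) _ Wgf; rewrite /nbhs /= /within /= => BW.
have := cf _ Ax _ BW; rewrite /nbhs /= /within /= => AW.
near=> y => Ay; have /= := near AW y _; apply => //; exact: AB.
Unshelve. all: by end_near. Qed.

Lemma continuous_at_within (T U : topologicalType) (A : set T) (f : T -> U) :
  (forall x, A x -> {for x, continuous f}) -> {within A, continuous f}.
Proof.
move=> cf; apply/subspace_continuousP => x Ax.
by apply: cvg_within_filter; exact: cf.
Qed.

Lemma within_glue (T U : topologicalType) (A P Q : set T) (f : T -> U) :
  closed P -> closed Q -> A `<=` P `|` Q ->
  {within A `&` P, continuous f} -> {within A `&` Q, continuous f} ->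
  {within A, continuous f}.
Proof.
move=> cP cQ APQ /subspace_continuousP fP /subspace_continuousP fQ.
apply/subspace_continuousP => x Ax W Wfx.
have near_part (C : set T) : closed C ->
    (forall x, (A `&` C) x -> f @ within (A `&` C) (nbhs x) --> f x) ->
    \forall y \near x, (A `&` C) y -> W (f y).
  move=> cC fC; have [Cx|nCx] := pselect (C x).
    by have := fC x (conj Ax Cx) _ Wfx; rewrite /nbhs /= /within.
  have : nbhs x (~` C) by apply: open_nbhs_nbhs; split => //; exact: closed_openC.
  by apply: filterS => y nCy [].
rewrite /nbhs /= /within /=.
near=> y => Ay; have [Py|Qy] := APQ _ Ay.
  by have := near (near_part _ cP fP) y; apply.
by have := near (near_part _ cQ fQ) y; apply.
Unshelve. all: by end_near. Qed.

Lemma continuous_at_pair (T U V : topologicalType) (f : T -> U) (g : T -> V) (x : T) :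
  {for x, continuous f} -> {for x, continuous g} ->
  {for x, continuous (fun y => (f y, g y))}.
Proof. by move=> cf cg; exact: (cvg_pair cf cg). Qed.

Lemma within_pair (T U V : topologicalType) (A : set T) (f : T -> U) (g : T -> V) :
  {within A, continuous f} -> {within A, continuous g} ->
  {within A, continuous (fun y => (f y, g y))}.
Proof.
move=> /subspace_continuousP cf /subspace_continuousP cg.
apply/subspace_continuousP => x Ax.
exact: (cvg_pair (cf _ Ax) (cg _ Ax)).
Qed.

Lemma continuous_at_comp (T U V : topologicalType) (f : T -> U) (g : U -> V) (x : T) :
  {for x, continuous f} -> {for f x, continuous g} ->
  {for x, continuous (fun y => g (f y))}.
Proof. by move=> cf cg; exact: (continuous_comp cf cg). Qed.

Section homotopy.
Context {R : realType}.

Lemma homotopic_in_trans (T U : topologicalType) (A : set T) (B : set U)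
    (f g h : T -> U) :
  homotopic_in (R := R) A B f g -> homotopic_in (R := R) A B g h ->
  homotopic_in (R := R) A B f h.
Proof.
move=> [H [cH HB H0 H1]] [K [cK KB K0 K1]].
pose D := (fun p : R * T => (2 * p.1, p.2)).
pose E := (fun p : R * T => (2 * p.1 - 1, p.2)).
have cD : continuous D.
  move=> p; rewrite /D /E; apply: (continuous_at_pair (g := snd)); last exact: cvg_snd.
  by apply: cvgM; [exact: cvg_cst|exact: cvg_fst].
have cE : continuous E.
  move=> p; rewrite /D /E; apply: (continuous_at_pair (g := snd)); last exact: cvg_snd.
  apply: cvgB; last exact: cvg_cst.
  by apply: cvgM; [exact: cvg_cst|exact: cvg_fst].
pose HK p := if p.1 <= 2^-1 then H (D p) else K (E p).
have HKr p : A p.2 -> 2^-1 <= p.1 -> HK p = K (E p).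
  case: p => s x /= Ax; rewrite /HK le_eqVlt /= => /predU1P[<-|p1].
    by rewrite lexx /D /E /= divff ?pnatr_eq0// subrr H1 ?K0.
  by rewrite leNgt p1.
exists HK; split.
- apply: (@within_glue (R * T)%type U _ [set p | p.1 <= 2^-1] [set p | 2^-1 <= p.1]).
  + by apply: (@preimage_closed (R * T)%type R fst [set x : R | x <= 2^-1]) => [p _|];
      [exact: cvg_fst|exact: closed_le].
  + by apply: (@preimage_closed (R * T)%type R fst [set x : R | 2^-1 <= x]) => [p _|];
      [exact: cvg_fst|exact: closed_ge].
  + by move=> p _ /=; apply/orP; exact: le_total.
  + apply: (@subspace_eq_continuous _ _ _ (H \o D)).
      by move=> p; rewrite inE => -[_ /= p1]; rewrite /from_subspace /HK p1.
    apply: (within_comp _ _ cH); first exact: continuous_subspaceT.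
    move=> [s x] /= [[/=]]; rewrite in_itv /= => /andP[s0 s1] Ax s2.
    by rewrite /D; split => //=; rewrite in_itv /=; lra.
  + apply: (@subspace_eq_continuous _ _ _ (K \o E)).
      by move=> p; rewrite inE => -[[_ /= Ap] p1]; rewrite /from_subspace HKr.
    apply: (within_comp _ _ cK); first exact: continuous_subspaceT.
    move=> [s x] /= [[/=]]; rewrite in_itv /= => /andP[s0 s1] Ax s2.
    by rewrite /E; split => //=; rewrite in_itv /=; lra.
- move=> s x; rewrite in_itv /= => /andP[s0 s1] Ax; rewrite /HK /=.
  by case: leP => s2; [apply: HB|apply: KB] => //; rewrite in_itv /=; lra.
- by move=> x Ax; rewrite /HK /D /= invr_ge0 ler0n mulr0 H0.
- by move=> x Ax; rewrite HKr ?invf_le1//= /E /= ?mulr1 ?ler1n// -K1//; congr (K (_, _)); lra.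
Qed.

Lemma homotopic_in_comp (S T U V : topologicalType) (A : set S) (B : set T)
    (C : set U) (D : set V) (h : S -> T) (f g : T -> U) (k : U -> V) :
  {within A, continuous h} -> (forall x, A x -> B (h x)) ->
  {within C, continuous k} -> (forall x, C x -> D (k x)) ->
  homotopic_in (R := R) B C f g ->
  homotopic_in (R := R) A D (k \o f \o h) (k \o g \o h).
Proof.
move=> ch AB ck CD [H [cH HC H0 H1]].
exists (fun p => k (H (p.1, h p.2))); split.
- apply: (within_comp _ _ ck); last first.
    by move=> [s x] /= [/= s01 Ax]; apply: HC => //; exact: AB.
  apply: (@within_comp _ _ _ _ _ (fun p => (p.1, h p.2)) H _ _ cH); last first.
    by move=> [s x] /= [/= s01 Ax]; split => //=; exact: AB.
  apply: (@within_pair _ _ _ _ fst (h \o snd)).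
    by apply: continuous_subspaceT => p; exact: cvg_fst.
  apply: (@within_comp _ _ _ _ A snd) => //; last by move=> ? [].
  by apply: continuous_subspaceT => p; exact: cvg_snd.
- by move=> s x s01 Ax /=; apply/CD/HC => //; exact: AB.
- by move=> x Ax /=; rewrite H0//; exact: AB.
- by move=> x Ax /=; rewrite H1//; exact: AB.
Qed.

Lemma homotopy_equiv_sym (T U : topologicalType) (A : set T) (B : set U) :
  homotopy_equiv (R := R) A B -> homotopy_equiv (R := R) B A.
Proof. by move=> [f [g [[cf cg] fB gA ? ?]]]; exists g, f; split. Qed.

Lemma homotopy_equiv_trans (T U V : topologicalType) (A : set T) (B : set U)
    (C : set V) :
  homotopy_equiv (R := R) A B -> homotopy_equiv (R := R) B C ->
  homotopy_equiv (R := R) A C.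
Proof.
have im (X Y : Type) (P : set X) (Q : set Y) (k : X -> Y) :
    k @` P `<=` Q -> forall x, P x -> Q (k x).
  by move=> PQ x Px; apply: PQ; exists x.
move=> [f [g [[cf cg] /im fB /im gA gf fg]]] [f' [g' [[cf' cg'] /im fC' /im gB' gf' fg']]].
exists (f' \o f), (g \o g'); split.
- by split; [exact: (within_comp cf fB cf')|exact: (within_comp cg' gB' cg)].
- by move=> _ [x Ax <-]; exact/fC'/fB.
- by move=> _ [x Ax <-]; exact/gA/gB'.
- exact: (homotopic_in_trans (homotopic_in_comp cf fB cg gA gf') gf).
- exact: (homotopic_in_trans (homotopic_in_comp cg' gB' cf' fC' fg) fg').
Qed.

Lemma homotopy_equiv_hclass (T U : topologicalType) (d : nat) (A : set T) (B : set U) :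
  homotopy_equiv (R := R) A B -> @hclass R d _ A = @hclass R d _ B.
Proof.
move=> AB; apply/seteqP; split => K; rewrite /hclass /= => h.
  exact: homotopy_equiv_trans (homotopy_equiv_sym AB) h.
exact: homotopy_equiv_trans AB h.
Qed.

Lemma homotopy_equiv_htype (T U : topologicalType) (d : nat) (A : set T) (B : set U) :
  homotopy_equiv (R := R) A B -> @htype R d _ A = @htype R d _ B.
Proof. by move=> /(homotopy_equiv_hclass d) AB; rewrite /htype AB. Qed.

Lemma gclass_inj (d : nat) (g h : gclass R d) :
  gclass_set g = gclass_set h -> g = h.
Proof.
by case: g h => [g gP] [h hP] /= gh; subst h; congr GClass; exact: Prop_irrelevance.
Qed.

Lemma htype_gc_space (T : topologicalType) (d : nat) (A : set T)
    (K : gcomplex R d) (g : gclass R d) :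
  gclass_set g = hclass (gc_space K) -> homotopy_equiv (R := R) A (gc_space K) ->
  htype R d A = g.
Proof.
move=> gK /(homotopy_equiv_hclass d) AK; rewrite /htype AK -gK.
apply: gclass_inj.
exact: (@xgetPex _ point [set h : gclass R d | gclass_set h = gclass_set g] (ex_intro _ g erefl)).
Qed.

End homotopy.

(** * Euclidean distance and Euclidean balls *)

Lemma cauchy_schwarz_sum (R : realDomainType) (n : nat) (a b : 'I_n -> R) :
  (\sum_i a i * b i) ^+ 2 <= (\sum_i a i ^+ 2) * (\sum_i b i ^+ 2).
Proof.
rewrite -subr_ge0 -(pmulrn_lge0 _ (ltn0Sn 1)).
suff -> : ((\sum_i a i ^+ 2) * (\sum_i b i ^+ 2) - (\sum_i a i * b i) ^+ 2) *+ 2 =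
    \sum_i \sum_j (a i * b j - a j * b i) ^+ 2.
  by apply: sumr_ge0 => i _; apply: sumr_ge0 => j _; exact: sqr_ge0.
have e : (\sum_i a i ^+ 2) * (\sum_i b i ^+ 2) = \sum_i \sum_j (a i ^+ 2 * b j ^+ 2).
  by rewrite mulr_suml; apply: eq_bigr => i _; rewrite mulr_sumr.
have f : (\sum_i a i ^+ 2) * (\sum_i b i ^+ 2) = \sum_i \sum_j (a j ^+ 2 * b i ^+ 2).
  by rewrite e exchange_big.
have g : (\sum_i a i * b i) ^+ 2 = \sum_i \sum_j (a i * b i * (a j * b j)).
  by rewrite expr2 mulr_suml; apply: eq_bigr => i _; rewrite mulr_sumr.
rewrite mulr2n {1}e {1}f g addrACA -!big_split -opprD -big_split/= -sumrN -big_split/=.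
apply: eq_bigr => i _; rewrite -!big_split -sumrN -big_split/=.
by apply: eq_bigr => j _ /=; ring.
Qed.

Lemma continuous_at_sum (K : numFieldType) (V : normedModType K)
    (T : topologicalType) (I : eqType) (s : seq I) (F : I -> T -> V) (x : T) :
  (forall i, i \in s -> {for x, continuous (F i)}) ->
  {for x, continuous (fun y => \sum_(i <- s) F i y)}.
Proof.
elim: s => [|i s IH] cF.
  rewrite (_ : (fun y => _) = cst 0); first exact: cvg_cst.
  by apply/funext => y; rewrite big_nil.
rewrite (_ : (fun y => _) = (fun y => F i y + \sum_(j <- s) F j y)).
  apply: cvgD; first by apply: cF; rewrite mem_head.
  by apply: IH => j js; apply: cF; rewrite inE js orbT.
by apply/funext => y; rewrite big_cons.
Qed.

Lemma star_connected (R : realType) (T : topologicalType) (A : set T) (c : T) :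
  A c ->
  (forall x, A x -> exists g : R -> T, [/\ g 0 = c, g 1 = x, continuous g &
     forall s, s \in `[0, 1] -> A (g s)]) ->
  connected A.
Proof.
move=> Ac Ag.
pose P := [set g : R -> T | [/\ g 0 = c, continuous g & forall s, s \in `[0, 1] -> A (g s)]].
have -> : A = \bigcup_(g in P) (g @` `[0, 1]%classic).
  apply/seteqP; split => [x /Ag[g [g0 g1 cg gA]]|x [g [g0 cg gA] [s s01 <-]]].
    exists g => //; exists 1 => //=.
    by rewrite in_itv /= ler01 lexx.
  by apply: gA.
apply: bigcup_connected.
  by exists c => g [g0 _ _]; exists 0 => //=; rewrite in_itv /= ler01 lexx.
move=> g [_ cg _]; apply: connected_continuous_connected.
  exact: segment_connected.
exact: continuous_subspaceT.
Qed.

Section euclid.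
Context {R : realType} {d : nat}.
Implicit Types (x y z : 'rV[R]_d) (r : R).

Lemma edist_ge0 x y : 0 <= edist x y.
Proof. exact: sqrtr_ge0. Qed.

Lemma edistxx x : edist x x = 0.
Proof. by rewrite /edist big1 ?sqrtr0// => i _; rewrite subrr expr0n. Qed.

Lemma edistC x y : edist x y = edist y x.
Proof.
by rewrite /edist; congr Num.sqrt; apply: eq_bigr => i _; rewrite -sqrrN opprB.
Qed.

Let ssq_ge0 x y : 0 <= \sum_(i < d) (x 0 i - y 0 i) ^+ 2.
Proof. by apply: sumr_ge0 => i _; exact: sqr_ge0. Qed.

Lemma edistD x y z : edist x z <= edist x y + edist y z.
Proof.
rewrite -(@ler_pXn2r _ 2)// ?nnegrE ?addr_ge0 ?edist_ge0//.
rewrite sqrrD /edist !sqr_sqrtr//.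
have -> : \sum_(i < d) (x 0 i - z 0 i) ^+ 2 = \sum_(i < d) (x 0 i - y 0 i) ^+ 2 +
    (\sum_(i < d) (x 0 i - y 0 i) * (y 0 i - z 0 i)) *+ 2 +
    \sum_(i < d) (y 0 i - z 0 i) ^+ 2.
  by rewrite -sumrMnl -!big_split/=; apply: eq_bigr => i _; ring.
rewrite lerD2r lerD2l lerMn2r/=.
rewrite -sqrtrM// (le_trans (ler_norm _))// -sqrtr_sqr ler_wsqrtr//.
exact: cauchy_schwarz_sum.
Qed.

Lemma edist_shift x y z : edist (x + z) (y + z) = edist x y.
Proof.
by rewrite /edist; congr Num.sqrt; apply: eq_bigr => i _; rewrite !mxE; congr (_ ^+ 2); ring.
Qed.

Lemma edistZ (k : R) x y : edist (k *: x) (k *: y) = `|k| * edist x y.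
Proof.
rewrite /edist -sqrtr_sqr -sqrtrM ?sqr_ge0//; congr Num.sqrt.
by rewrite mulr_sumr; apply: eq_bigr => i _; rewrite !mxE -mulrBr exprMn.
Qed.

Lemma coord_le_edist x y i : `|x 0 i - y 0 i| <= edist x y.
Proof.
rewrite -sqrtr_sqr ler_wsqrtr// (bigD1 i)//= lerDl.
by apply: sumr_ge0 => j _; exact: sqr_ge0.
Qed.

Lemma edist_le_coord x y r : (forall i, `|x 0 i - y 0 i| <= r) ->
  edist x y <= d%:R * r.
Proof.
move=> h; have [d0|d0] := posnP d.
  rewrite /edist big1 ?sqrtr0 ?d0 ?mul0r// => i _.
  by exfalso; have := ltn_ord i; rewrite [X in (_ < X)%N]d0.
have r0 : 0 <= r by rewrite (le_trans _ (h (Ordinal d0))).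
rewrite -(@ler_pXn2r _ 2)// ?nnegrE ?mulr_ge0 ?edist_ge0// sqr_sqrtr//.
apply: (@le_trans _ _ (\sum_(i < d) r ^+ 2)).
  by apply: ler_sum => i _; rewrite -real_normK ?num_real// lerXn2r ?nnegrE.
rewrite sumr_const card_ord exprMn -[leLHS]mulr_natl ler_wpM2r ?sqr_ge0//.
by rewrite -natrX ler_nat leq_pmulr.
Qed.

Lemma edist_conv (I : Type) (s : seq I) (w : I -> R) (p : I -> 'rV[R]_d) x :
  (forall i, 0 <= w i) ->
  edist (\sum_(i <- s) w i *: p i) ((\sum_(i <- s) w i) *: x)
    <= \sum_(i <- s) w i * edist (p i) x.
Proof.
move=> w0; elim: s => [|i s IH]; first by rewrite !big_nil scale0r edistxx.
rewrite !big_cons scalerDl.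
apply: (le_trans (edistD _ (w i *: x + \sum_(j <- s) w j *: p j) _)).
rewrite edist_shift edistZ ger0_norm// lerD2l.
by rewrite addrC [w i *: x + _]addrC edist_shift.
Qed.

Lemma edist_bary (I : eqType) (s : seq I) (w : I -> R) (p : I -> 'rV[R]_d) x r :
  (forall i, 0 <= w i) -> 0 < \sum_(i <- s) w i ->
  (forall i, i \in s -> 0 < w i -> edist (p i) x <= r) ->
  edist ((\sum_(i <- s) w i)^-1 *: \sum_(i <- s) w i *: p i) x <= r.
Proof.
move=> w0 W pr; set W0 := \sum_(i <- s) w i in W *.
have Wn0 : W0 != 0 by rewrite gt_eqF.
rewrite -[x in edist _ x](scalerK Wn0) edistZ ger0_norm ?invr_ge0 ?(ltW W)//.
rewrite ler_pdivrMl// (le_trans (edist_conv _ _ _ w0))//.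
rewrite /W0 mulr_suml big_seq [leRHS]big_seq ler_sum// => i si.
have [wi|wi] := ltP 0 (w i); first by rewrite ler_pM2l// pr.
by have -> : w i = 0 by [apply/eqP; rewrite eq_le wi w0]; rewrite !mul0r.
Qed.

Lemma edist_segment x y z (s : R) r : 0 <= s <= 1 ->
  edist x z <= r -> edist y z <= r -> edist ((1 - s) *: x + s *: y) z <= r.
Proof.
move=> /andP[s0 s1] xr yr.
have e : z = (1 - s) *: z + s *: z by rewrite -scalerDl subrK scale1r.
rewrite {1}e; apply: (le_trans (edistD _ ((1 - s) *: z + s *: y) _)).
rewrite edist_shift edistZ [_ + s *: y]addrC [_ + s *: z]addrC edist_shift edistZ.
rewrite !ger0_norm ?subr_ge0//.
rewrite (_ : r = (1 - s) * r + s * r); last by rewrite -mulrDl subrK mul1r.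
by rewrite lerD// ler_wpM2l// subr_ge0.
Qed.

Lemma continuous_edist : continuous (fun p : 'rV[R]_d * 'rV[R]_d => edist p.1 p.2).
Proof.
move=> p; rewrite /edist; apply: (@continuous_at_comp _ _ _ (fun p : 'rV[R]_d * 'rV[R]_d => \sum_(i < d) (p.1 0 i - p.2 0 i) ^+ 2) Num.sqrt); last exact: sqrt_continuous.
apply: continuous_at_sum => i _.
have h (q : 'rV[R]_d * 'rV[R]_d -> 'rV[R]_d) : continuous q ->
    {for p, continuous (fun z : 'rV[R]_d * 'rV[R]_d => q z 0 i)}.
  move=> cq; apply: (@continuous_at_comp _ _ _ q (fun M : 'rV[R]_d => M 0 i)).
    exact: cq.
  exact: coord_continuous.
have c1 := h fst (fun=> cvg_fst); have c2 := h snd (fun=> cvg_snd).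
by apply: cvgM; apply: cvgB; [exact: c1|exact: c2|exact: c1|exact: c2].
Qed.

Lemma continuous_edistl x : continuous (edist^~ x).
Proof.
move=> y; apply: (@continuous_at_comp _ _ _ (fun z => (z, x)) (fun p => edist p.1 p.2)).
  apply: (@continuous_at_pair _ _ _ id (cst x)); first exact: cvg_id.
  exact: (@cvg_cst _ x _ (nbhs y)).
exact: continuous_edist.
Qed.

Lemma closed_eball x r : closed (eball x r).
Proof.
have -> : eball x r = (edist^~ x) @^-1` [set t | t <= r].
  by apply/seteqP; split => y; rewrite /eball /= edistC.
apply: preimage_closed (@closed_le _ r) => y _; exact: continuous_edistl.
Qed.

Lemma compact_eball x r : compact (eball x r).
Proof.
apply: bounded_closed_compact; last exact: closed_eball.
exists (r + \sum_i `|x 0 i|); split; first by rewrite num_real.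
move=> M rM y xy; rewrite /= [ `|y|]mx_normrE; apply: bigmax_le => [|[i j] _ /=].
  apply: le_trans (ltW rM); rewrite addr_ge0 ?sumr_ge0//.
  by apply: le_trans (edist_ge0 x y) xy.
apply: le_trans (ltW rM); rewrite [i]ord1.
rewrite -(subrK (x 0 j) (y 0 j)) (le_trans (ler_normD _ _))// lerD//.
  by rewrite distrC (le_trans (coord_le_edist _ _ _)).
by rewrite (bigD1 j)//= lerDl sumr_ge0.
Qed.

Lemma connected_eball x r : connected (eball x r).
Proof.
have [r0|r0] := ltP r 0.
  rewrite (_ : eball x r = set0); first exact: connected0.
  apply/seteqP; split => y //; rewrite /eball /=.
  by move=> /(le_trans (edist_ge0 x y)); rewrite leNgt r0.
apply: (@star_connected _ _ (eball x r) x); first by rewrite /eball /= edistxx.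
move=> y xy; exists (fun s => (1 - s) *: x + s *: y); split.
- by rewrite subr0 scale1r scale0r addr0.
- by rewrite subrr scale1r scale0r add0r.
- move=> s; apply: cvgD; apply: cvgZr_tmp; last exact: cvg_id.
  by apply: cvgB; [exact: cvg_cst|exact: cvg_id].
- move=> s; rewrite in_itv /= => s01; rewrite /eball /= edistC.
  by apply: edist_segment; rewrite // ?edistxx// edistC.
Qed.

End euclid.

(** * The nerve of finitely many Euclidean balls of a common radius *)

Lemma ptws_cvg (V T : Type) (U : topologicalType) (F : set_system T)
    (FF : Filter F) (g : T -> {ptws V -> U}) (f : {ptws V -> U}) :
  (forall v, g x v @[x --> F] --> f v) -> g x @[x --> F] --> f.
Proof.
move=> gf; apply/cvg_sup => v A /= [B [[C oC <-] Cf BA]].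
by apply: filterS BA _; apply: gf; apply: open_nbhs_nbhs.
Qed.

Lemma continuous_coord (V : eqType) (U : topologicalType) (v : V) :
  continuous (fun f : {ptws V -> U} => f v).
Proof. exact: (@proj_continuous V (fun=> U) v). Qed.

Lemma exists_common_gap (R : realType) (T : eqType) (s : seq T) (Q : T -> R -> Prop) :
  (forall x, x \in s -> exists2 e, 0 < e & forall e', e' <= e -> Q x e') ->
  exists2 e, 0 < e & forall x e', x \in s -> e' <= e -> Q x e'.
Proof.
elim: s => [_|x s IH sQ]; first by exists 1.
have [e e0 He] := sQ x (mem_head _ _).
have [|f f0 Hf] := IH; first by move=> y ys; apply: sQ; rewrite inE ys orbT.
exists (Num.min e f); first by rewrite lt_min e0.
move=> y e'; rewrite inE le_min => /predU1P[->|ys] /andP[ee' fe']; first exact: He.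
exact: Hf.
Qed.

Lemma exists_argmax (R : realDomainType) (T : eqType) (s : seq T) (f : T -> R) (x : T) :
  x \in s -> exists2 y, y \in s & forall z, z \in s -> f z <= f y.
Proof.
elim: s x => [//|a [|b s] IH] x _.
  by exists a; rewrite ?mem_head// => z; rewrite inE => /eqP ->.
have [y ys ymax] := IH b (mem_head _ _).
have [ay|ya] := leP (f a) (f y).
  by exists y => [|z]; rewrite inE ?ys ?orbT// => /predU1P[->|/ymax].
by exists a; rewrite ?mem_head// => z; rewrite inE => /predU1P[->//|/ymax zy];
  exact: le_trans zy (ltW ya).
Qed.

Definition posp {R : realType} (t : R) : R := Num.max 0 t.

Section posp.
Context {R : realType}.

Lemma posp_ge0 (t : R) : 0 <= posp t.
Proof. by rewrite /posp le_max lexx. Qed.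

Lemma posp_gt0 (t : R) : (0 < posp t) = (0 < t).
Proof. by rewrite /posp lt_max ltxx. Qed.

Lemma posp_id (t : R) : 0 <= t -> posp t = t.
Proof. by rewrite /posp; case: ltgtP. Qed.

Lemma continuous_posp : continuous (@posp R).
Proof.
move=> t; apply: (@continuous_at_comp _ _ _ (fun z : R => (0 : R, z)) (fun p => Num.max p.1 p.2)).
  by apply: (@continuous_at_pair _ _ _ (cst (0 : R)) id); [exact: cvg_cst|exact: cvg_id].
exact: max_continuous.
Qed.

End posp.

Section continuity_at_a_point.
Context {R : realType} {T : topologicalType}.
Implicit Types (f g : T -> R) (x : T).

Lemma continuous_at_cst (U : topologicalType) (u : U) x :
  {for x, continuous (fun _ : T => u)}.
Proof. exact: (@cvg_cst _ u _ (nbhs x)). Qed.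

Lemma continuous_atB f g x : {for x, continuous f} -> {for x, continuous g} ->
  {for x, continuous (fun y => f y - g y)}.
Proof. by move=> cf cg; exact: (cvgB cf cg). Qed.

Lemma continuous_atM f g x : {for x, continuous f} -> {for x, continuous g} ->
  {for x, continuous (fun y => f y * g y)}.
Proof. by move=> cf cg; exact: (cvgM cf cg). Qed.

Lemma continuous_atV f x : f x != 0 -> {for x, continuous f} ->
  {for x, continuous (fun y => (f y)^-1)}.
Proof. by move=> fx cf; exact: (cvgV fx cf). Qed.

Lemma continuous_atZ (W : normedModType R) f (g : T -> W) x :
  {for x, continuous f} -> {for x, continuous g} ->
  {for x, continuous (fun y => f y *: g y)}.
Proof. by move=> cf cg; exact: (cvgZ cf cg). Qed.

Lemma continuous_at_posp f x : {for x, continuous f} ->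
  {for x, continuous (fun y => posp (f y))}.
Proof. by move=> cf; exact: (continuous_at_comp cf (@continuous_posp _ _)). Qed.

Lemma continuous_at_ptws (V : Type) (U : topologicalType)
    (g : T -> {ptws V -> U}) (x : T) :
  (forall v, {for x, continuous (fun y => g y v)}) -> {for x, continuous g}.
Proof. by move=> h; apply: ptws_cvg => v; exact: h. Qed.

End continuity_at_a_point.

Lemma continuous_edistr (R : realType) (d : nat) (x : 'rV[R]_d) : continuous (edist x).
Proof.
rewrite (_ : edist x = edist^~ x); first exact: continuous_edistl.
by apply/funext => y; rewrite edistC.
Qed.

Lemma continuous_at_prod (R : realType) (T : topologicalType) (I : eqType)
    (s : seq I) (F : I -> T -> R) (x : T) :
  (forall i, i \in s -> {for x, continuous (F i)}) ->
  {for x, continuous (fun y => \prod_(i <- s) F i y)}.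
Proof.
elim: s => [|i s IH] cF.
  rewrite (_ : (fun y => _) = cst 1); first exact: cvg_cst.
  by apply/funext => y; rewrite big_nil.
rewrite (_ : (fun y => _) = (fun y => F i y * \prod_(j <- s) F j y)).
  apply: cvgM; first by apply: cF; rewrite mem_head.
  by apply: IH => j js; apply: cF; rewrite inE js orbT.
by apply/funext => y; rewrite big_cons.
Qed.

Section nerve.
Context {R : realType} {d : nat} {V : choiceType}.
Implicit Types (S : {fset V}) (x : 'rV[R]_d) (t : {ptws V -> R}).

(** When the balls of radius r have no common point, the total excess of the
    distances over r has a positive minimum on a compact ball, so slightly larger
    balls have no common point either. *)
Lemma eball_gap (c : V -> 'rV[R]_d) (r : R) S : exists2 e, 0 < e &
  forall e', e' <= e ->
    \bigcap_(v in [set` S]) eball (c v) (r + e') !=set0 ->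
    \bigcap_(v in [set` S]) eball (c v) r !=set0.
Proof.
have [->|/fset0Pn[v0 v0S]] := eqVneq S fset0; first by exists 1 => // e' _ _; exists 0.
have [ne|em] := pselect (\bigcap_(v in [set` S]) eball (c v) r !=set0).
  by exists 1.
pose A := eball (c v0) (r + 1).
have [A0|A0] := eqVneq A set0.
  exists 1 => // e' e1 [x /(_ v0 v0S) /= xv0].
  suff : A x by rewrite A0.
  by rewrite /A /eball /= in xv0 *; apply: le_trans xv0 _; rewrite lerD2l.
pose h x := \sum_(v <- S) posp (edist (c v) x - r).
have ch : continuous h.
  move=> x; apply: continuous_at_sum => v _.
  apply/continuous_at_posp/continuous_atB; last exact: continuous_at_cst.
  exact: continuous_edistr.
have /set0P A0' := A0.
have [x0 x0A hmin] := compact_EVT_min A0' (@compact_eball _ _ _ _)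
  (continuous_subspaceT ch).
have h0 : 0 < h x0.
  rewrite lt_neqAle sumr_ge0 ?andbT; last by move=> *; exact: posp_ge0.
  rewrite eq_sym; apply/negP => /eqP hx0; apply: em; exists x0 => v /= vS.
  rewrite /eball /= leNgt; apply/negP => rv.
  move/eqP: hx0; rewrite /h big_seq psumr_eq0; last by move=> *; exact: posp_ge0.
  move=> /allP/(_ v vS); rewrite vS /= => /eqP pv.
  by have := posp_gt0 (edist (c v) x0 - r); rewrite pv ltxx subr_gt0 rv.
exists (Num.min 1 (h x0 / (#|` S|.+1)%:R)).
  by rewrite lt_min ltr01 divr_gt0.
move=> e'; rewrite le_min => /andP[e1 eh] [x xe]; exfalso.
have xA : A x.
  have := xe v0 v0S; rewrite /A /eball /= => /le_trans; apply.
  by rewrite lerD2l.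
have := hmin x (mem_set xA); apply/negP; rewrite -ltNge.
have e'0 : 0 < e'.
  rewrite ltNge; apply/negP => e'0; apply: em; exists x => v vS.
  by have := xe v vS; rewrite /eball /= => /le_trans; apply; rewrite gerDl.
apply: (@le_lt_trans _ _ (\sum_(v <- S) e')).
  rewrite /h big_seq [leRHS]big_seq; apply: ler_sum => v vS.
  rewrite /posp ge_max (ltW e'0) lerBlDl; exact: xe.
rewrite big_const_seq count_predT iter_addr_0 -[e' *+ _]mulr_natl.
move: eh; rewrite ler_pdivlMr// => /(lt_le_trans _); apply.
by rewrite mulrC ltr_pM2l// ltr_nat.
Qed.

(** Finitely many sets of vertices share a margin. *)
Lemma cech_gap (D : {fset V}) (c : V -> 'rV[R]_d) (r : R) : exists2 e, 0 < e &
  forall e', 0 <= e' <= e -> cech [set` D] c (r + e') = cech [set` D] c r.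
Proof.
have [|e e0 He] := @exists_common_gap R _ (fpowerset D) (fun S e' =>
    \bigcap_(v in [set` S]) eball (c v) (r + e') !=set0 ->
    \bigcap_(v in [set` S]) eball (c v) r !=set0).
  by move=> S _; exact: eball_gap.
exists e => // e' /andP[e'0 e'e]; apply/seteqP; split => S [S0 SD SS]; split => //.
  by apply: (He S e') => //; rewrite fpowersetE; apply/fsubsetP.
have [x xS] := SS; exists x => v vS.
by have := xS v vS; rewrite /eball /= => /le_trans; apply; rewrite lerDl.
Qed.

(** Each perturbed ball contains the ball of radius r around the old centre and
    is contained in the ball of radius r + e around it. *)
Lemma cech_stable (D : {fset V}) (c : V -> 'rV[R]_d) (r : R) : exists2 e, 0 < e &
  forall (c' : V -> 'rV[R]_d) (r' : R),
    (forall v, v \in D -> r + edist (c v) (c' v) <= r' /\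
      r' + edist (c v) (c' v) <= r + e) ->
    cech [set` D] c' r' = cech [set` D] c r.
Proof.
have [e e0 He] := cech_gap D c r.
exists e => // c' r' cc'; apply/seteqP; split => S [S0 SD [x xS]].
  rewrite -(He e) ?(ltW e0) ?lexx//; split => //; exists x => v vS.
  have := xS v vS; rewrite /eball /= => xv.
  apply: (le_trans (edistD _ (c' v) _)).
  have [_] := cc' v (SD v vS); apply: le_trans.
  by rewrite addrC lerD2r.
split => //; exists x => v vS.
have := xS v vS; rewrite /eball /= => xv.
apply: (le_trans (edistD _ (c v) _)).
have [+ _] := cc' v (SD v vS); apply: le_trans.
by rewrite addrC [edist (c' v) _]edistC lerD2r.
Qed.

(** The weights may vanish on a part of S: the point then lies in a face of S. *)
Lemma realizationI (K : set {fset V}) S (t : {ptws V -> R}) :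
  (forall S S', K S -> (S' `<=` S)%fset -> S' != fset0 -> K S') ->
  K S -> (forall v, 0 <= t v) -> (forall v, v \notin S -> t v = 0) ->
  \sum_(v <- S) t v = 1 -> realization K t.
Proof.
move=> Kdown KS t0 tS sum1.
pose S' := [fset v in S | 0 < t v]%fset.
have S'S : (S' `<=` S)%fset by apply/fsubsetP => v; rewrite !inE => /andP[].
have off v : v \notin S' -> t v = 0.
  rewrite !inE negb_and => /orP[/tS//|]; rewrite -leNgt => tv.
  by apply/eqP; rewrite eq_le tv t0.
have sum' : \sum_(v <- S') t v = 1.
  rewrite -sum1; apply: (big_fset_incl _ S'S) => v _ /off -> //.
exists S'.
  apply: Kdown KS S'S _; apply/negP => /eqP S0; move: sum'.
  by rewrite S0 big_seq_fset0 => /esym/eqP; rewrite oner_eq0.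
by split => // v; rewrite !inE => /andP[].
Qed.

Lemma cech_down (D : set V) (c : V -> 'rV[R]_d) r S S' :
  cech D c r S -> (S' `<=` S)%fset -> S' != fset0 -> cech D c r S'.
Proof.
move=> [S0 SD [x xS]] /fsubsetP S'S S'0; split => //.
  by move=> v /= /S'S; exact: SD.
by exists x => v /= /S'S; exact: xS.
Qed.

Lemma realization_supp (K : set {fset V}) (t : {ptws V -> R}) : realization K t ->
  exists2 S, K S & [/\ forall v, 0 <= t v, forall v, v \notin S -> t v = 0,
    forall v, v \in S -> 0 < t v & \sum_(v <- S) t v = 1].
Proof.
move=> [S KS [t1 t0 s]]; exists S => //; split => // v.
by case: (boolP (v \in S)) => [/t1/ltW//|/t0 ->].
Qed.

(** The segment between two points of a common closed simplex stays inside it. *)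
Lemma straight_homotopic (T : topologicalType) (A : set T) (K : set {fset V})
    (f g : T -> {ptws V -> R}) :
  (forall S S', K S -> (S' `<=` S)%fset -> S' != fset0 -> K S') ->
  {within A, continuous f} -> {within A, continuous g} ->
  (forall x : T, A x -> exists2 S, K S & [/\ forall v, 0 <= f x v, forall v, 0 <= g x v,
     forall v, v \notin S -> f x v = 0 /\ g x v = 0 &
     \sum_(v <- S) f x v = 1 /\ \sum_(v <- S) g x v = 1]) ->
  homotopic_in (R := R) A (realization K) f g.
Proof.
move=> Kdown cf cg fg.
exists (fun p => (fun v => (1 - p.1) * f p.2 v + p.1 * g p.2 v) : {ptws V -> R}); split.
- apply/subspace_continuousP => -[s x] [/= s01 Ax].
  have c1 : p.1 @[p --> within (`[0, 1]%classic `*` A) (nbhs (s, x))] --> s.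
    by apply: cvg_within_filter; exact: cvg_fst.
  have c2 (k : T -> {ptws V -> R}) v : {within A, continuous k} ->
      k p.2 v @[p --> within (`[0, 1]%classic `*` A) (nbhs (s, x))] --> k x v.
    move=> ck.
    have ck2 : {within `[0, 1]%classic `*` A, continuous (k \o @snd R T)}.
      apply: (@within_comp _ _ _ _ A snd) => //; last by move=> ? [].
      by apply: continuous_subspaceT => p; exact: cvg_snd.
    move/subspace_continuousP/(_ (s, x) (conj s01 Ax)) : ck2 => /= ck2.
    exact: (@cvg_comp _ _ _ (fun p => k p.2) (fun h : {ptws V -> R} => h v) _ _ _ ck2 (@continuous_coord _ _ v (k x))).
  apply: ptws_cvg => v /=; apply: cvgD; apply: cvgM; [|exact: c2|exact: c1|exact: c2].
  by apply: cvgB; [exact: cvg_cst|exact: c1].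
- move=> s x; rewrite in_itv /= => /andP[s0 s1] Ax.
  have [S KS [f0 g0 off [fs gs]]] := fg x Ax.
  apply: (realizationI Kdown KS) => [v|v /off[-> ->]|].
  + by rewrite addr_ge0// mulr_ge0// subr_ge0.
  + by rewrite !mulr0 addr0.
  + by rewrite big_split/= -!mulr_sumr fs gs !mulr1 subrK.
- by move=> x Ax; apply/funext => v /=; rewrite subr0 mul1r mul0r addr0.
- by move=> x Ax; apply/funext => v /=; rewrite subrr mul0r mul1r add0r.
Qed.

Section nerve_maps.
Variables (D : {fset V}) (c : V -> 'rV[R]_d) (r e : R).
Hypothesis e0 : 0 < e.
Hypothesis gap : cech [set` D] c (r + e) = cech [set` D] c r.

Let K := cech [set` D] c r.
Let U := \bigcup_(v in [set` D]) eball (c v) r.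
Let Kdown S S' : K S -> (S' `<=` S)%fset -> S' != fset0 -> K S'.
Proof. exact: cech_down. Qed.

(* The map f to the nerve is a partition of unity for the balls of radius r + e;
   enlarging the balls keeps the weights continuous on all of space, and creates
   no new simplex by the assumption on e. *)
Let phi v x := if v \in D then posp (r + e - edist (c v) x) else 0.
Let f x : {ptws V -> R} := fun v => phi v x / \sum_(w <- D) phi w x.

Let phi_ge0 v x : 0 <= phi v x.
Proof. by rewrite /phi; case: ifP => // _; exact: posp_ge0. Qed.

Let phi_gt0 v x : v \in D -> edist (c v) x <= r -> 0 < phi v x.
Proof. by move=> vD vx; rewrite /phi vD posp_gt0 subr_gt0 (le_lt_trans vx)// ltrDl. Qed.

Let Phi_gt0 x : U x -> 0 < \sum_(w <- D) phi w x.
Proof.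
move=> [v /= vD xv]; rewrite (big_fsetD1 v)//= ltr_pwDl ?phi_gt0// sumr_ge0//.
Qed.

Let f_ge0 x v : U x -> 0 <= f x v.
Proof. by move=> /Phi_gt0 P; rewrite /f divr_ge0// ltW. Qed.

Let f_spec x : U x -> exists2 S, K S & [/\ forall v, v \in S = (0 < phi v x),
  forall v, v \notin S -> f x v = 0 & \sum_(v <- S) f x v = 1].
Proof.
move=> Ux; pose S := [fset v in D | 0 < phi v x]%fset.
have SD : (S `<=` D)%fset by apply/fsubsetP => v; rewrite !inE => /andP[].
have SE v : v \in S = (0 < phi v x).
  by rewrite !inE /=; case: (boolP (v \in D)) => //= vD; rewrite /phi (negbTE vD) ltxx.
have off v : v \notin S -> f x v = 0.
  rewrite SE -leNgt => p0; have -> : f x v = 0 / \sum_(w <- D) phi w x.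
    by rewrite /f; congr (_ / _); apply/eqP; rewrite eq_le p0 phi_ge0.
  by rewrite mul0r.
exists S.
  rewrite /K -gap; split.
  - have [v /= vD xv] := Ux; apply/fset0Pn; exists v; rewrite SE; exact: phi_gt0.
  - by move=> v /= /(fsubsetP SD).
  - exists x => v /= vS; move: (vS) (fsubsetP SD _ vS); rewrite SE /phi => + vD.
    by rewrite vD posp_gt0 subr_gt0 /eball /= => /ltW.
split => //.
rewrite (big_fset_incl _ SD) => [|v _ /off//].
by rewrite -mulr_suml divff// gt_eqF// Phi_gt0.
Qed.

Let f_cont x : U x -> {for x, continuous f}.
Proof.
have cphi v : {for x, continuous (phi v)}.
  rewrite /phi; case: (v \in D); last exact: continuous_at_cst.
  apply/continuous_at_posp/continuous_atB; first exact: continuous_at_cst.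
  exact: continuous_edistr.
move=> Ux; apply: continuous_at_ptws => v; apply: continuous_atM; first exact: cphi.
apply: continuous_atV; first by rewrite gt_eqF// Phi_gt0.
by apply: (@continuous_at_sum _ _ _ _ _ phi) => w _; exact: cphi.
Qed.

(* Any threshold below 1 / #|D| works: some coordinate of each point exceeds it. *)
Let theta : R := (2 * #|` D|)%:R^-1.

Let exceed (h : V -> R) (v : V) : v \in D -> \sum_(w <- D) h w = 1 ->
  (forall w, w \in D -> h w <= h v) -> theta < h v.
Proof.
move=> vD h1 hv.
have D0 : (0 < #|` D|)%N by rewrite cardfs_gt0; apply/fset0Pn; exists v.
have : 1 <= #|` D|%:R * h v.
  rewrite -[leLHS]h1 (@le_trans _ _ (\sum_(w <- D) h v))//.
    by rewrite big_seq [leRHS]big_seq ler_sum.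
  by rewrite big_const_seq count_predT iter_addr_0 mulr_natl.
rewrite -ler_pdivrMl ?ltr0n// mulr1; apply: lt_le_trans.
by rewrite /theta ltf_pV2 ?posrE ?ltr0n ?muln_gt0 ?D0// ltr_nat ltn_Pmull.
Qed.

Let sum_supp S (h : V -> R) : (S `<=` D)%fset -> (forall v, v \notin S -> h v = 0) ->
  \sum_(v <- D) h v = \sum_(v <- S) h v.
Proof. by move=> SD off; rewrite -(big_fset_incl _ SD) => // v _ /off. Qed.

(* The map b cuts off the coordinates that are at most theta; it is homotopic to
   the identity and compares f \o g with it. *)
Let bb (t : {ptws V -> R}) v : R := posp (t v - theta).
Let b (t : {ptws V -> R}) : {ptws V -> R} := fun v => bb t v / \sum_(w <- D) bb t w.

Let K_big t : realization K t -> exists2 v, v \in D & theta < t v.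
Proof.
move=> /realization_supp[S KS [t0 off pos sum1]].
have [/fset0Pn[v vS] SD _] := KS.
have SD' : (S `<=` D)%fset by apply/fsubsetP.
have [w wD wmax] := exists_argmax t (SD _ vS); exists w => //.
by apply: exceed wD _ wmax; rewrite (sum_supp SD' off).
Qed.

Let B_gt0 t : realization K t -> 0 < \sum_(w <- D) bb t w.
Proof.
move=> /K_big[v vD tv].
rewrite (big_fsetD1 v)//= ltr_pwDl ?sumr_ge0 ?posp_gt0 ?subr_gt0//.
by move=> *; exact: posp_ge0.
Qed.

Let theta_ge0 : 0 <= theta.
Proof. by rewrite /theta invr_ge0. Qed.

Let b_off t v : t v <= theta -> b t v = 0.
Proof.
move=> tv; rewrite /b; have -> : bb t v = 0; last by rewrite mul0r.
by apply/eqP; rewrite eq_le posp_ge0 andbT leNgt posp_gt0 subr_gt0 -leNgt.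
Qed.

Let b_ge0 t v : realization K t -> 0 <= b t v.
Proof. by move=> /B_gt0 Bt; rewrite divr_ge0 ?posp_ge0// ltW. Qed.

Let b_sum t : realization K t -> \sum_(v <- D) b t v = 1.
Proof. by move=> /B_gt0 Bt; rewrite -mulr_suml divff// gt_eqF. Qed.

Let b_cont t : realization K t -> {for t, continuous b}.
Proof.
have cbb v : {for t, continuous (fun t => bb t v)}.
  apply/continuous_at_posp/continuous_atB; last exact: continuous_at_cst.
  exact: continuous_coord.
move=> Kt; apply: continuous_at_ptws => v; apply: continuous_atM; first exact: cbb.
apply: continuous_atV; first by rewrite gt_eqF// B_gt0.
by apply: (@continuous_at_sum _ _ _ _ _ (fun w t => bb t w)) => w _; exact: cbb.
Qed.

(* Up to normalisation, the weight of the simplex S at t: it is positive exactly when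
   S is contained in the support of t and contains every vertex of weight at
   least theta.  The map g averages, with these weights, points p S that are chosen
   in the common intersections of the balls of the simplices. *)
Let lam (t : {ptws V -> R}) S : R :=
  (\prod_(v <- S) posp (t v)) * \prod_(w <- (D `\` S)%fset) posp (theta - t w).
Let p S : 'rV[R]_d := xget 0 (\bigcap_(v in [set` S]) eball (c v) r).
Let g (t : {ptws V -> R}) : 'rV[R]_d :=
  (\sum_(S <- fpowerset D) lam t S)^-1 *: \sum_(S <- fpowerset D) lam t S *: p S.

Let lam_ge0 t S : 0 <= lam t S.
Proof. by rewrite mulr_ge0// prodr_ge0// => *; exact: posp_ge0. Qed.

Let lam_gt0 t S : 0 < lam t S -> (forall v, v \in S -> 0 < t v) /\
  forall w, w \in D -> w \notin S -> t w < theta.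
Proof.
rewrite /lam => /gt_eqF/negbT; rewrite mulf_eq0 negb_or => /andP[P1 P2]; split.
  move=> v vS; rewrite -posp_gt0 lt_neqAle posp_ge0 andbT eq_sym.
  by apply: contra P1 => tv; rewrite prodf_seq_eq0; apply/hasP; exists v.
move=> w wD wS; rewrite -subr_gt0 -posp_gt0 lt_neqAle posp_ge0 andbT eq_sym.
apply: contra P2 => tv; rewrite prodf_seq_eq0; apply/hasP; exists w => //.
by rewrite inE wS.
Qed.

Let W_gt0 t : realization K t -> 0 < \sum_(S <- fpowerset D) lam t S.
Proof.
move=> Kt; have [v0 v0D tv0] := K_big Kt.
have theta0 : 0 < theta.
  rewrite /theta invr_gt0 ltr0n muln_gt0 /= cardfs_gt0; apply/fset0Pn; by exists v0.
have [S KS [t0 off pos sum1]] := realization_supp Kt.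
have [_ SD _] := KS.
have SP : S \in fpowerset D by rewrite fpowersetE; apply/fsubsetP.
rewrite (big_fsetD1 S)//= ltr_pwDl ?sumr_ge0// mulr_gt0// big_seq prodr_gt0// => v vS.
  by rewrite posp_gt0 pos.
by rewrite posp_gt0 off ?subr0//; move: vS; rewrite inE => /andP[].
Qed.

Let g_in t v : realization K t -> v \in D -> theta < t v -> edist (c v) (g t) <= r.
Proof.
move=> Kt vD tv; rewrite edistC; apply: edist_bary; [exact: lam_ge0|exact: W_gt0|].
move=> S SP /lam_gt0[Spos Sbig].
have vS : v \in S by apply: contraT => /(Sbig v vD)/(lt_trans tv); rewrite ltxx.
have [S0 KS0 [t0 off pos sum1]] := realization_supp Kt.
have KS : K S.
  apply: (Kdown KS0); last by apply/fset0Pn; exists v.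
  by apply/fsubsetP => w /Spos; apply: contraTT => /off ->; rewrite ltxx.
have [_ _ [y yS]] := KS.
have := @xgetPex _ 0 _ (ex_intro _ y yS) v vS; by rewrite /eball /= edistC.
Qed.

Let g_U t : realization K t -> U (g t).
Proof. by move=> Kt; have [v vD tv] := K_big Kt; exists v => //; exact: g_in. Qed.

Let g_cont t : realization K t -> {for t, continuous g}.
Proof.
have clam S : {for t, continuous (fun t => lam t S)}.
  have ct v : {for t, continuous (fun t : {ptws V -> R} => t v)}.
    exact: continuous_coord.
  apply: continuous_atM.
    apply: (@continuous_at_prod _ _ _ _ (fun v (t : {ptws V -> R}) => posp (t v))) => v _.
    exact: continuous_at_posp.
  apply: (@continuous_at_prod _ _ _ _ (fun v (t : {ptws V -> R}) => posp (theta - t v))) => v _.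
  by apply/continuous_at_posp/continuous_atB; first exact: continuous_at_cst.
move=> Kt; apply: continuous_atZ.
  apply: continuous_atV; first by rewrite gt_eqF// W_gt0.
  by apply: (@continuous_at_sum _ _ _ _ _ (fun S t => lam t S)) => S _; exact: clam.
apply: (@continuous_at_sum _ _ _ _ _ (fun S t => lam t S *: p S)) => S _.
by apply: continuous_atZ; [exact: clam|exact: continuous_at_cst].
Qed.

(** If v maximises phi v x, the centre of v is nearest to x, and the coordinate v
    of f x is above theta; so x and g (f x) lie in the same ball, which is convex.
    On the nerve, t is joined to b t and b t to f (g t) by straight segments: if
    the coordinate v of b t is not 0 then g t lies in the ball of v, hence v is
    also in the support of f (g t). *)
Lemma nerve_of_gap : homotopy_equiv (R := R) U (realization (R := R) K).
Proof.
have wf : {within U, continuous f} by apply: continuous_at_within; exact: f_cont.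
have wg : {within realization K, continuous g}.
  by apply: continuous_at_within; exact: g_cont.
have wb : {within realization K, continuous b}.
  by apply: continuous_at_within; exact: b_cont.
have KD S : K S -> (S `<=` D)%fset by move=> [_ SD _]; apply/fsubsetP.
have fK x : U x -> realization K (f x).
  move=> Ux; have [S KS [_ off sum1]] := f_spec Ux.
  by apply: (realizationI Kdown KS) => // v; exact: f_ge0.
exists f, g; split => //.
- by move=> _ [x Ux <-]; exact: fK.
- by move=> _ [t Kt <-]; exact: g_U.
- exists (fun q => (1 - q.1) *: g (f q.2) + q.1 *: q.2); split.
  + apply: continuous_at_within => -[s x] [/= _ Ux].
    have c1 : {for (s, x), continuous fst} by exact: cvg_fst.
    have c2 : {for (s, x), continuous snd} by exact: cvg_snd.
    apply: cvgD; apply: cvgZ => //.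
      by apply: cvgB; [exact: cvg_cst|exact: c1].
    apply: (continuous_at_comp (g := fun y => g (f y)) c2).
    apply: (continuous_at_comp (f_cont Ux)); apply: g_cont; exact: fK.
  + move=> s x; rewrite in_itv /= => s01 Ux.
    have [w /= wD xw] := Ux.
    have [v vD vmax] := exists_argmax (phi^~ x) wD.
    have xv : edist (c v) x <= r.
      move: (vmax w wD); rewrite /phi vD wD.
      rewrite [X in X <= _]posp_id ?subr_ge0; last by rewrite (le_trans xw)// lerDl ltW.
      have e' : e <= r + e - edist (c w) x by rewrite lerBrDr addrC lerD2r.
      move=> /(le_trans e') ep; have := lt_le_trans e0 ep; rewrite posp_gt0 => /ltW/posp_id pe.
      by move: ep; rewrite pe lerBrDr addrC lerD2r.
    have fv : theta < f x v.
      have [S KS [SE off sum1]] := f_spec Ux.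
      apply: exceed vD _ _; first by rewrite (sum_supp (KD _ KS) off).
      by move=> z zD; rewrite /f ler_pM2r ?invr_gt0 ?Phi_gt0// vmax.
    exists v => //; rewrite /eball /= edistC; apply: edist_segment => //.
      by rewrite edistC g_in//; exact: fK.
    by rewrite edistC.
  + by move=> x _ /=; rewrite subr0 scale1r scale0r addr0.
  + by move=> x _ /=; rewrite subrr scale1r scale0r add0r.
- apply: (@homotopic_in_trans _ _ _ _ _ _ b).
  + apply: straight_homotopic => //.
      by apply: within_comp wf => // t Kt; exact: g_U.
    move=> t Kt; have Ug := g_U Kt; have [S KS [SE off sum1]] := f_spec Ug.
    have boff v : v \notin S -> b t v = 0.
      move=> vS; apply: b_off; rewrite leNgt; apply: contra vS => tv.
      have vD : v \in D.
        have [S0 KS0 [_ off0 _ _]] := realization_supp Kt.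
        apply: (fsubsetP (KD _ KS0)); apply: contraLR tv => /off0 ->.
        by rewrite -leNgt.
      by rewrite SE phi_gt0// g_in.
    exists S => //; split => [v|v|v vS|].
    * exact: f_ge0.
    * exact: b_ge0.
    * by split; [exact: off|exact: boff].
    * by rewrite -(sum_supp (KD _ KS) boff) b_sum.
  + apply: straight_homotopic => //.
      by apply: continuous_subspaceT => ?; exact: cvg_id.
    move=> t Kt; have [S KS [t0 off pos sum1]] := realization_supp Kt.
    have boff v : v \notin S -> b t v = 0.
      by move=> vS; apply: b_off; rewrite off.
    exists S => //; split => [v|v|v vS|]//.
    * exact: b_ge0.
    * by split; [exact: boff|exact: off].
    * by rewrite -(sum_supp (KD _ KS) boff) b_sum.
Qed.

End nerve_maps.

(** The small margin of cech_gap leaves room for a partition of unity. *)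
Theorem nerve_eballs (D : {fset V}) (c : V -> 'rV[R]_d) (r : R) :
  homotopy_equiv (R := R) (\bigcup_(v in [set` D]) eball (c v) r)
    (realization (R := R) (cech [set` D] c r)).
Proof.
have [e e0 He] := cech_gap D c r.
by apply: (nerve_of_gap e0); apply: He; rewrite lexx ltW.
Qed.

End nerve.

(** * Counting the elements of finite sets *)

Definition ncard {T : choiceType} (A : set T) : nat := #|` fset_set A|.

Section ncard.
Context {T : choiceType}.
Implicit Types A B : set T.

Lemma ncard0 : ncard (@set0 T) = 0%N.
Proof. by rewrite /ncard fset_set0 cardfs0. Qed.

Lemma ncard_eq0 A : finite_set A -> ncard A = 0%N -> A = set0.
Proof. by move=> fA /eqP; rewrite cardfs_eq0 => /eqP; exact: fset_set_set0. Qed.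

Lemma ncard_le A B : A `<=` B -> finite_set B -> (ncard A <= ncard B)%N.
Proof.
move=> AB fB; apply: fsubset_leq_card; rewrite -fset_set_sub//.
exact: sub_finite_set fB.
Qed.

Lemma ncardU A B : finite_set A -> finite_set B -> A `&` B = set0 ->
  ncard (A `|` B) = (ncard A + ncard B)%N.
Proof.
move=> fA fB AB; rewrite /ncard fset_setU// cardfsU -fset_setI// AB.
by rewrite fset_set0 cardfs0 subn0.
Qed.

Lemma ncardU_le A B : finite_set A -> finite_set B ->
  (ncard (A `|` B) <= ncard A + ncard B)%N.
Proof. by move=> fA fB; rewrite /ncard fset_setU// cardfsU leq_subr. Qed.

Lemma ncard_image_le (U : choiceType) (f : T -> U) A : finite_set A ->
  (ncard (f @` A) <= ncard A)%N.
Proof. by move=> fA; rewrite /ncard fset_set_image// leq_imfset_card. Qed.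

Lemma ncard_image (U : choiceType) (f : T -> U) A : finite_set A ->
  {in A &, injective f} -> ncard (f @` A) = ncard A.
Proof.
move=> fA fI; rewrite /ncard fset_set_image// card_in_imfset// => x y.
by rewrite /= !in_fset_set//; exact: fI.
Qed.

Lemma ncard_bigcup (I : eqType) (s : seq I) (F : I -> set T) : uniq s ->
  (forall i, i \in s -> finite_set (F i)) ->
  (forall i j, i \in s -> j \in s -> F i `&` F j !=set0 -> i = j) ->
  ncard (\bigcup_(i in [set` s]) F i) = (\sum_(i <- s) ncard (F i))%N.
Proof.
elim: s => [|i s IH] /=.
  by rewrite set_nil bigcup_set0 ncard0 big_nil.
move=> /andP[is_ us] fF dF; have -> : [set` i :: s] = i |` [set` s].
  by apply/seteqP; split => j /=; rewrite inE => /predU1P.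
rewrite bigcup_setU1 big_cons ncardU.
- congr addn; apply: IH => //.
    by move=> j js; apply: fF; rewrite inE js orbT.
  by move=> j k js ks; apply: dF; rewrite inE ?js ?ks orbT.
- by apply: fF; rewrite mem_head.
- by apply: bigcup_finite => // j js; apply: fF; rewrite inE (_ : j \in s) ?orbT.
- apply/seteqP; split => // x [Fx [j /= js Fjx]].
  have ij : i = j.
    by apply: dF; rewrite ?mem_head ?inE ?js ?orbT//; exists x.
  by rewrite ij js in is_.
Qed.

End ncard.

(** * Connected components of a union of connected sets *)

Section clusters.
Context {V T : choiceType}.
Implicit Types (A : V -> set T) (D S : set V).

(** The class of v for the equivalence relation on D that is generated by
   the meeting of members of the family A. *)
Definition cluster_of A D v : set V :=
  [set w | forall S : set V, S v ->
    (forall a b, S a -> D b -> A a `&` A b !=set0 -> S b) -> S w].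

Definition clusters A D : set (set V) := cluster_of A D @` D.

Lemma cluster_refl A D v : cluster_of A D v v.
Proof. by move=> S. Qed.

Lemma cluster_sub A D v : D v -> cluster_of A D v `<=` D.
Proof. by move=> Dv w; apply. Qed.

Lemma cluster_step A D v a b : cluster_of A D v a -> D b -> A a `&` A b !=set0 ->
  cluster_of A D v b.
Proof. by move=> va Db ab S Sv Sstep; apply: (Sstep a) => //; exact: va. Qed.

Lemma cluster_trans A D u v w : cluster_of A D u v -> cluster_of A D v w ->
  cluster_of A D u w.
Proof. by move=> uv; apply => // a b ua Db; exact: cluster_step. Qed.

Lemma cluster_sym A D v w : D v -> cluster_of A D v w -> cluster_of A D w v.
Proof.
move=> Dv vw; suff [] : D w /\ cluster_of A D w v by [].
apply: (vw (fun w => D w /\ cluster_of A D w v)); first by split => //; exact: cluster_refl.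
move=> a b [Da av] Db ab; split => //.
apply: (@cluster_trans A D b a v _ av).
apply: (@cluster_step A D b b a _ Da); first exact: cluster_refl.
by rewrite setIC.
Qed.

Lemma cluster_eq A D v w : D v -> cluster_of A D v w ->
  cluster_of A D w = cluster_of A D v.
Proof.
move=> Dv vw; apply/seteqP; split => u; first exact: cluster_trans.
by apply: cluster_trans; exact: cluster_sym.
Qed.

Lemma clusters_sub A D C : clusters A D C -> C `<=` D.
Proof. by move=> [v Dv <-]; exact: cluster_sub. Qed.

Lemma clustersE A D C v : clusters A D C -> C v -> C = cluster_of A D v.
Proof. by move=> [u Du <-] uv; rewrite (cluster_eq Du uv). Qed.

Lemma clusters_neq0 A D C : clusters A D C -> C !=set0.
Proof. by move=> [v Dv <-]; exists v; exact: cluster_refl. Qed.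

Lemma clusters_disj A D C C' v : clusters A D C -> clusters A D C' ->
  C v -> C' v -> C = C'.
Proof. by move=> /clustersE h /clustersE h' /h -> /h' ->. Qed.

Lemma clusters_step A D C a b : clusters A D C -> C a -> D b ->
  A a `&` A b !=set0 -> C b.
Proof. by move=> [v Dv <-]; exact: cluster_step. Qed.

Lemma cluster_subset A D D' v : D' `<=` D ->
  cluster_of A D' v `<=` cluster_of A D v.
Proof.
by move=> D'D w; apply; [exact: cluster_refl|move=> a b va /D'D Db; exact: cluster_step].
Qed.

Lemma cluster_restrict A D D' v : D' `<=` D -> cluster_of A D v `<=` D' ->
  cluster_of A D' v = cluster_of A D v.
Proof.
move=> D'D vD'; apply/seteqP; split; first exact: cluster_subset.
move=> w vw.
suff [] : cluster_of A D v w /\ cluster_of A D' v w by [].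
apply: (vw (fun w => _ /\ _)); first by split; exact: cluster_refl.
move=> a b [va va'] Db ab.
have vb : cluster_of A D v b by exact: cluster_step ab.
by split => //; apply: cluster_step va' _ ab; exact: vD'.
Qed.

End clusters.

Lemma clusters_ext {V T T' : choiceType} (A : V -> set T) (A' : V -> set T') (D : set V) :
  (forall a b, D a -> D b -> A a `&` A b !=set0 <-> A' a `&` A' b !=set0) ->
  clusters A D = clusters A' D.
Proof.
move=> AA'; suff h v : D v -> cluster_of A D v = cluster_of A' D v.
  by apply/seteqP; split => _ [v Dv <-]; exists v => //; rewrite h.
move=> Dv; apply/seteqP; split => w vw.
  suff [] : D w /\ cluster_of A' D v w by [].
  apply: (vw (fun w => _ /\ _)); first by split => //; exact: cluster_refl.
  move=> a b [Da va] Db ab; split => //.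
  by apply: (cluster_step va Db); exact: (AA' a b Da Db).1.
suff [] : D w /\ cluster_of A D v w by [].
apply: (vw (fun w => _ /\ _)); first by split => //; exact: cluster_refl.
move=> a b [Da va] Db ab; split => //.
by apply: (cluster_step va Db); exact: (AA' a b Da Db).2.
Qed.

Lemma clusters_image {V V' T T' : choiceType} (A : V -> set T) (A' : V' -> set T')
    (D : set V) (f : V -> V') :
  {in D &, injective f} ->
  (forall a b, D a -> D b -> A a `&` A b !=set0 <-> A' (f a) `&` A' (f b) !=set0) ->
  clusters A' (f @` D) = (fun C => f @` C) @` clusters A D.
Proof.
move=> fI AA'; suff h v : D v -> cluster_of A' (f @` D) (f v) = f @` cluster_of A D v.
  apply/seteqP; split => [_ [_ [v Dv <-] <-]|_ [_ [v Dv <-] <-]].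
    by exists (cluster_of A D v); rewrite -?h//; exists v.
  by exists (f v); rewrite ?h//; exists v.
move=> Dv; apply/seteqP; split => [w vw|_ [w vw <-]].
  apply: vw; first by exists v => //; exact: cluster_refl.
  move=> _ _ [a va <-] [b Db <-] ab; exists b => //.
  have Da := cluster_sub Dv va.
  by apply: (cluster_step va Db); exact: (AA' a b Da Db).2.
suff [] : D w /\ cluster_of A' (f @` D) (f v) (f w) by [].
apply: (vw (fun w => _ /\ _)); first by split => //; exact: cluster_refl.
move=> a b [Da va] Db ab; split => //; apply: (cluster_step va); first by exists b.
exact: (AA' a b Da Db).1.
Qed.

Section components.
Context {V : choiceType} {T : topologicalType}.
Variables (A : V -> set T) (D : set V).
Hypothesis A0 : forall v, D v -> A v !=set0.
Hypothesis Aconn : forall v, D v -> connected (A v).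

Let U := \bigcup_(v in D) A v.

(** This takes the place of local finiteness: it makes the union over a cluster,
    and the union over the other indices, closed in U. *)
Hypothesis Asep : forall S : set V, S `<=` D ->
  (forall a b, S a -> D b -> A a `&` A b !=set0 -> S b) ->
  exists2 F, closed F & U `&` F = \bigcup_(v in S) A v.

(** The union over a cluster is connected, being a chain of connected sets that
    meet, and it is open and closed in U. *)
Lemma component_cluster v x : D v -> A v x ->
  connected_component U x = \bigcup_(w in cluster_of A D v) A w.
Proof.
move=> Dv vx; have AU w : D w -> A w `<=` U by move=> Dw y; exists w.
pose S := cluster_of A D v.
have SD : S `<=` D by exact: cluster_sub.
apply/seteqP; split; last first.
  move=> y [w vw wy].
  suff [_ +] : D w /\ A w `<=` connected_component U x by apply.
  apply: (vw (fun w => D w /\ A w `<=` connected_component U x)).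
    by split => //; apply: connected_component_max => //; [exact: AU|exact: Aconn].
  move=> a b [Da ax] Db [z [az bz]]; split => // t bt.
  apply: connected_component_trans (ax _ az) _.
  by apply: (connected_component_max bz) bt; [exact: AU|exact: Aconn].
have [F cF UF] := Asep SD (fun a b => @cluster_step _ _ A D v a b).
pose S' := D `\` S.
have S'D : S' `<=` D by move=> ? [].
have S'step a b : S' a -> D b -> A a `&` A b !=set0 -> S' b.
  move=> [Da nSa] Db ab; split => // Sb; apply: nSa.
  by apply: cluster_step Sb Da _; rewrite setIC.
have [F' cF' UF'] := Asep S'D S'step.
have CU : connected_component U x `<=` U by exact: connected_component_sub.
have disj y : U y -> F y -> F' y -> False.
  move=> Uy Fy F'y.
  have [a Sa ay] : (\bigcup_(v in S) A v) y by rewrite -UF.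
  have [b [Db nSb] by_] : (\bigcup_(v in S') A v) y by rewrite -UF'.
  by apply: nSb; apply: cluster_step Sa Db _; exists y.
have cover y : U y -> F y \/ F' y.
  move=> Uy; have [w Dw wy] := Uy; have [Sw|nSw] := pselect (S w).
    by left; have [] : (U `&` F) y by rewrite UF; exists w.
  by right; have [] : (U `&` F') y by rewrite UF'; exists w.
have := @component_connected _ U x (connected_component U x `&` F).
move=> h; suff <- : connected_component U x `&` F = connected_component U x.
  by move=> y [Cy Fy]; rewrite -UF; split => //; exact: CU.
apply: h.
- exists x; split; first by apply: connected_component_refl; exact: AU vx.
  by have [] : (U `&` F) x by rewrite UF; exists v => //; exact: cluster_refl.
- exists (~` F'); first exact: closed_openC.
  apply/seteqP; split => y [Cy]; first by move=> Fy; split => // F'y; exact: (disj y (CU _ Cy)).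
  by have [//|F'y /(_ F'y)] := cover y (CU _ Cy).
- by exists F.
Qed.

Lemma components_clusters :
  components U = (fun C => \bigcup_(v in C) A v) @` clusters A D.
Proof.
apply/seteqP; split => [_ [x [v Dv vx] <-]|_ [_ [v Dv <-] <-]].
  by exists (cluster_of A D v); [exists v|rewrite (component_cluster Dv vx)].
have [x vx] := A0 Dv; exists x; first by exists v.
exact: component_cluster.
Qed.

Lemma cluster_union_inj : {in clusters A D &, injective (fun C => \bigcup_(v in C) A v)}.
Proof.
move=> C C' /set_mem CC /set_mem CC' e.
have [v Cv] := clusters_neq0 CC; have Dv := clusters_sub CC Cv.
have [x vx] := A0 Dv.
have [w C'w wx] : (\bigcup_(v in C') A v) x by rewrite -e; exists v.
apply: (clusters_disj CC CC' Cv).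
by apply: (clusters_step CC' C'w Dv); exists x.
Qed.

End components.

(** * Clusters of points in Euclidean space *)

Section point_clusters.
Context {R : realType} {d : nat}.
Implicit Types (X G : set 'rV[R]_d) (rho : R).

Definition locfin X := forall r, finite_set (X `&` eball 0 r).

Lemma locfin_sub X Y : Y `<=` X -> locfin X -> locfin Y.
Proof. by move=> YX lX r; apply: sub_finite_set (lX r); exact: setSI. Qed.

Lemma finite_locfin X : finite_set X -> locfin X.
Proof. by move=> fX r; apply: sub_finite_set fX; exact: subIsetl. Qed.

Lemma locfin_bounded X G r : locfin X -> G `<=` eball 0 r -> finite_set (X `&` G).
Proof. by move=> lX Gr; apply: sub_finite_set (lX r); exact: setIS. Qed.

Lemma closed_ball_union X rho : locfin X -> closed (ball_union X rho).
Proof.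
move=> lX y yX.
pose M := edist 0 y + 1 + rho.
pose Y := X `&` eball 0 M.
have cY : closed (ball_union Y rho).
  by apply: closed_bigcup => [|p _]; [exact: lX|exact: closed_eball].
suff : closure (ball_union Y rho) y.
  by move=> /cY [p [Xp _] py]; exists p.
move=> W Wy.
have ny : nbhs y [set z | edist z y < 1].
  have := @continuous_edistl R d y y; rewrite /continuous_at edistxx => /(_ [set t | t < 1]).
  by apply; exact: lt_nbhsl.
have [z [[p Xp pz] [Wz zy]]] := yX _ (filterI Wy ny).
exists z; split => //; exists p => //; split => //.
rewrite /M /eball /= (le_trans (edistD _ y _))// -addrA lerD2l.
rewrite (le_trans (edistD _ z _))// lerD//; first by rewrite edistC ltW.
by rewrite edistC.
Qed.

Definition pclusters X rho : set (set 'rV[R]_d) := clusters (fun p => eball p rho) X.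

Lemma eball_neq0 (p : 'rV[R]_d) rho : 0 <= rho -> eball p rho !=set0.
Proof. by move=> r0; exists p; rewrite /eball /= edistxx. Qed.

Lemma components_ball_union X rho : 0 <= rho -> locfin X ->
  components (ball_union X rho) = (fun C => ball_union C rho) @` pclusters X rho.
Proof.
move=> r0 lX; apply: components_clusters => [p _|p _|S SX _].
- exact: eball_neq0.
- exact: connected_eball.
- exists (ball_union S rho); first exact/closed_ball_union/locfin_sub/lX.
  by apply/setIidr => y [p Sp py]; exists p => //; exact: SX.
Qed.

Lemma ball_union_inj X rho : 0 <= rho ->
  {in pclusters X rho &, injective (fun C => ball_union C rho)}.
Proof. by move=> r0; apply: cluster_union_inj => p _; exact: eball_neq0. Qed.

(** Counting these clusters is counting components: ball_union C rho is a
    component of the union of the balls, selected by the position of its centres. *)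
Definition goodcl X rho G (A : set (gclass R d)) : set (set 'rV[R]_d) :=
  [set C | [/\ pclusters X rho C, C `<=` G & A (htype R d (ball_union C rho))]].

Definition ncl X rho G A : nat := ncard (goodcl X rho G A).

Lemma goodcl_finite X rho G A : finite_set (X `&` G) -> finite_set (goodcl X rho G A).
Proof.
move=> fXG; apply: sub_finite_set (finite_image (cluster_of (fun p => eball p rho) X) fXG).
move=> _ [[p Xp <-] CG _]; exists p => //; split => //; apply: CG; exact: cluster_refl.
Qed.

Lemma goodclS X rho G A B : A `<=` B -> goodcl X rho G A `<=` goodcl X rho G B.
Proof. by move=> AB C [? ? /AB]. Qed.

(** A cluster inside G can grow only through points whose balls meet a ball
    centred in G. *)
Lemma goodcl_restrict X W rho G A :
  X `&` G `<=` W -> (forall p q, (X `&` G) p -> X q -> eball p rho `&` eball q rho !=set0 -> W q) ->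
  goodcl (X `&` W) rho G A = goodcl X rho G A.
Proof.
move=> GW near; have XWX : X `&` W `<=` X by exact: subIsetl.
apply/seteqP; split => [_ [[p [Xp Wp] <-] CG ?]|_ [[p Xp <-] CG ?]].
  have e : cluster_of (fun p => eball p rho) (X `&` W) p = cluster_of (fun p => eball p rho) X p.
    apply/seteqP; split; first exact: cluster_subset.
    move=> q pq; apply: pq; first exact: cluster_refl.
    move=> a b pa Xb ab; apply: (cluster_step pa _ ab); split => //.
    apply: near (ab) => //; split; last exact: CG.
    exact: (cluster_sub Xp (cluster_subset XWX pa)).
  by split => //; exists p => //; rewrite e.
have Gp : G p by apply: CG; exact: cluster_refl.
split => //; exists p; first by split => //; exact: GW.
apply: cluster_restrict => // q pq; have Xq := cluster_sub Xp pq.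
by split => //; apply: GW; split => //; exact: CG.
Qed.

End point_clusters.

(** * The random measure in terms of clusters of points *)

Lemma ncardIE (T : choiceType) (A B : set T) : finite_set A ->
  ncard (A `&` B) = (\sum_(x <- fset_set A) (x \in B))%N.
Proof.
move=> fA; have fAB : finite_set (A `&` B) by apply: sub_finite_set fA; exact: subIsetl.
rewrite /ncard card_fset_sum1.
have -> : fset_set (A `&` B) = [fset x in fset_set A | x \in B]%fset.
  by apply/fsetP => x; rewrite !inE /= !in_fset_set// in_setI.
by rewrite -big_fset_condE big_mkcond/=; apply: eq_bigr => x _; case: (x \in B).
Qed.

Section realization_components.
Context {R : realType} {d : nat}.
Local Notation V := 'rV[R]_d.
Variables (D : set V) (r : R).
Hypothesis fD : finite_set D.
Hypothesis r0 : 0 <= r.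

Let K := cech D id r.
(* The components of the realization are found as those of the union of the balls,
   with the open stars of the vertices in place of the balls. *)
Let star (v : V) : set {ptws V -> R} := [set t | realization (R := R) K t /\ 0 < t v].

Let Kdown S S' : K S -> (S' `<=` S)%fset -> S' != fset0 -> K S'.
Proof. exact: cech_down. Qed.

Let Kpair v w : D v -> D w -> eball v r `&` eball w r !=set0 -> K [fset v; w]%fset.
Proof.
move=> Dv Dw [x [xv xw]]; split.
- by apply/fset0Pn; exists v; rewrite !inE eqxx.
- by move=> u /=; rewrite !inE => /orP[] /eqP ->.
- by exists x => u /=; rewrite !inE => /orP[] /eqP ->.
Qed.

Let star_meet v w : D v -> D w ->
  star v `&` star w !=set0 <-> eball v r `&` eball w r !=set0.
Proof.
move=> Dv Dw; split=> [[t [[Kt tv] [_ tw]]]|vw].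
  have [S [S0 SD [x xS]] [t0 off pos _]] := realization_supp Kt.
  have vS : v \in S by apply: contraLR tv => /off ->; rewrite ltxx.
  have wS : w \in S by apply: contraLR tw => /off ->; rewrite ltxx.
  by exists x; split; [exact: xS|exact: xS].
have KS := Kpair Dv Dw vw.
pose t : {ptws V -> R} := fun u => ((u == v)%:R + (u == w)%:R) / 2.
have Kt : realization (R := R) K t.
  apply: (realizationI Kdown KS) => [u|u|].
  - by rewrite /t divr_ge0 ?addr_ge0.
  - by rewrite !inE negb_or /t => /andP[/negbTE -> /negbTE ->]; rewrite addr0 mul0r.
  - rewrite /t -mulr_suml big_split/=.
    have sum1 x : x \in [fset v; w]%fset -> \sum_(u <- [fset v; w]%fset) (u == x)%:R = 1 :> R.
      move=> xS; rewrite (big_fsetD1 x)//= eqxx big_seq big1 ?addr0// => u.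
      by rewrite !inE => /andP[/negbTE ->].
    by rewrite !sum1 ?inE ?eqxx ?orbT// divff.
exists t; split; split => //; rewrite /t ?eqxx divr_gt0//.
  by rewrite ltr_pwDl.
by rewrite ltr_wpDl.
Qed.

Let starU : \bigcup_(v in D) star v = realization (R := R) K.
Proof.
apply/seteqP; split => [t [v _ []]//|t Kt].
have [S [S0 SD _] [_ _ pos _]] := realization_supp Kt.
have [v vS] := fset0Pn _ S0; exists v; first exact: SD.
by split => //; exact: pos.
Qed.

Let delta v : {ptws V -> R} := fun u => (u == v)%:R.

Let star_delta v : D v -> star v (delta v).
Proof.
move=> Dv; split; last by rewrite /delta eqxx.
have KS : K [fset v]%fset.
  split; first by apply/fset0Pn; exists v; rewrite inE.
    by move=> u /=; rewrite inE => /eqP ->.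
  by exists v => u /=; rewrite inE => /eqP ->; rewrite /eball /= edistxx.
apply: (realizationI Kdown KS) => [u|u|].
- by rewrite /delta.
- by rewrite inE /delta => /negbTE ->.
- by rewrite big_seq_fset1 /delta eqxx.
Qed.

Let star_conn v : D v -> connected (star v).
Proof.
move=> Dv; apply: (@star_connected R _ _ (delta v)); first exact: star_delta.
move=> t [Kt tv]; exists (fun s => (fun u => (1 - s) * delta v u + s * t u) : {ptws V -> R}).
split.
- by apply/funext => u; rewrite subr0 mul1r mul0r addr0.
- by apply/funext => u; rewrite subrr mul0r mul1r add0r.
- move=> s; apply: continuous_at_ptws => u; apply: cvgD.
    apply: (@continuous_atM R R (fun s => 1 - s) (fun=> delta v u)); last exact: continuous_at_cst.
    by apply: continuous_atB; [exact: continuous_at_cst|exact: cvg_id].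
  apply: (@continuous_atM R R id (fun=> t u)); last exact: continuous_at_cst.
  exact: cvg_id.
- move=> s; rewrite in_itv /= => /andP[s0 s1].
  have [S KS [t0 off pos sum1]] := realization_supp Kt.
  have vS : v \in S by apply: contraLR tv => /off ->; rewrite ltxx.
  split.
    apply: (realizationI Kdown KS) => [u|u uS|].
    + by rewrite addr_ge0// mulr_ge0// ?subr_ge0// /delta.
    + rewrite off// /delta; have -> : (u == v) = false; last by rewrite !mulr0 addr0.
      by apply: contraNF uS => /eqP ->.
    + rewrite big_split/= -!mulr_sumr sum1 (big_fsetD1 v)//= /delta eqxx big_seq big1.
        by rewrite addr0 !mulr1 subrK.
      by move=> u; rewrite !inE => /andP[/negbTE ->].
  rewrite /delta eqxx mulr1; have [->|sn0] := eqVneq s 0.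
    by rewrite mul0r subr0 addr0.
  by rewrite ltr_wpDl ?subr_ge0// mulr_gt0// lt_neqAle eq_sym sn0.
Qed.

Let star_sep (S : set V) : S `<=` D ->
  (forall a b, S a -> D b -> star a `&` star b !=set0 -> S b) ->
  exists2 F, closed F & (\bigcup_(v in D) star v) `&` F = \bigcup_(v in S) star v.
Proof.
move=> SD Sstep; pose s (t : {ptws V -> R}) := \sum_(v <- fset_set S) t v.
have fS : finite_set S by exact: sub_finite_set fD.
(* The mass s of the vertices in S is 1 on the stars of S and 0 on the others. *)
exists (s @^-1` [set z | 1 <= z]).
  apply: preimage_closed (@closed_ge _ 1) => t _.
  apply: (@continuous_at_sum _ _ _ _ _ (fun v (t : {ptws V -> R}) => t v)) => v _.
  exact: continuous_coord.
rewrite starU; apply/seteqP; split => [t [Kt st]|t [v Sv [Kt tv]]].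
  have [S0 _ [t0 _ _ _]] := realization_supp Kt.
  apply: contrapT => nt; move: st; rewrite /= leNgt => /negP; apply.
  rewrite /s big_seq big1 ?ltr01// => v; rewrite in_fset_set// => /set_mem Sv.
  apply/eqP; rewrite eq_le t0 andbT leNgt; apply/negP => tv.
  by apply: nt; exists v.
have [S0 [Sn0 S0D _] [t0 off pos sum1]] := realization_supp Kt.
split => //=; rewrite -[leLHS]sum1 /s le_eqVlt; apply/orP; left; apply/eqP.
apply: big_fset_incl.
  apply/fsubsetP => w wS0; rewrite in_fset_set//; apply/mem_set.
  apply: Sstep Sv (S0D _ wS0) _.
  by exists t; split; split => //; exact: pos.
by move=> w _ /off.
Qed.

Lemma b0_cech : b0 (R := R) K = ncard (pclusters D r).
Proof.
have sn0 v : D v -> star v !=set0 by move=> Dv; exists (delta v); exact: star_delta.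
rewrite /b0 -starU (components_clusters sn0 star_conn star_sep).
rewrite -/(ncard _) ncard_image.
- by congr ncard; apply: clusters_ext => a b Da Db; exact: star_meet.
- exact: finite_image.
- exact: cluster_union_inj.
Qed.

End realization_components.

Section mu_in_clusters.
Context {R : realType} {d : nat}.
Local Notation V := 'rV[R]_d.
Implicit Types (X : set V) (alpha r : R).

Definition inner alpha r : set V := [set p | eball p alpha `<=` (eball 0 r)^°].

Variables (X : set V) (alpha r : R).
Hypothesis lX : locfin X.
Hypothesis a0 : 0 <= alpha.

Let G := inner alpha r.

Lemma inner_bounded : G `<=` eball 0 r.
Proof.
move=> p Gp; apply: interior_subset; apply: Gp.
by rewrite /eball /= edistxx.
Qed.

Let fXG : finite_set (X `&` G).
Proof. exact: locfin_bounded inner_bounded. Qed.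

Let good := goodcl X alpha G setT.
Let D := \bigcup_(C in good) C.

Let DX : D `<=` X.
Proof. by move=> p [C [CX _ _]]; exact: clusters_sub CX p. Qed.

Let DG : D `<=` X `&` G.
Proof. by move=> p Dp; split; [exact: DX|case: Dp => C [_ CG _]; exact: CG]. Qed.

Let pclD : pclusters D alpha = good.
Proof.
have cD C p : good C -> C p -> cluster_of (fun p => eball p alpha) D p = C.
  move=> gC Cp; have [CX CG _] := gC; rewrite (clustersE CX Cp).
  apply: cluster_restrict; first exact: DX.
  by rewrite -(clustersE CX Cp) => q Cq; exists C.
apply/seteqP; split => [_ [p [C gC Cp] <-]|C gC]; first by rewrite (cD C).
have [CX CG _] := gC; have [p Cp] := clusters_neq0 CX.
by exists p; [exists C|rewrite (cD C)].
Qed.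

Let buin : ball_union_in X alpha r = ball_union D alpha.
Proof.
rewrite /ball_union_in components_ball_union//; apply/seteqP; split.
  move=> x [s [[C CX <-] CG] [p Cp px]]; exists p => //; exists C => //; split => //.
  by move=> q Cq y qy; apply: CG; exists q.
move=> x [p [C [CX CG _] Cp] px]; exists (ball_union C alpha); last by exists p.
by split; [exists C|move=> y [q Cq qy]; exact: (CG q Cq)].
Qed.

Let fD : finite_set D.
Proof. by apply: sub_finite_set fXG. Qed.

Let centers : [set p | X p /\ eball p alpha `<=` ball_union_in X alpha r] = D.
Proof.
rewrite buin; apply/seteqP; split => p.
  move=> [Xp pD]; have [|q Dq qp] := pD p; first by rewrite /eball /= edistxx.
  have [C gC Cq] := Dq; have [CX CG _] := gC; exists C => //.
  apply: (clusters_step CX Cq Xp); exists p; split => //.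
  by rewrite /eball /= edistxx.
by move=> Dp; split; [exact: DX|move=> x px; exists p].
Qed.

(** The points D of the clusters inside the inner region have these clusters as
    their own clusters; so b_0 and the sum over components count the same sets. *)
Lemma mu_inE (nu : probability (gclass R d) R) (A : set (gclass R d)) :
  mu_in nu X alpha r A = if ncl X alpha G setT == 0%N then nu A
    else ((ncl X alpha G A)%:R / (ncl X alpha G setT)%:R)%:E.
Proof.
have fgood B : finite_set (goodcl X alpha G B) by exact: goodcl_finite.
rewrite /mu_in; case: pselect => [e|ne].
  suff -> : ncl X alpha G setT = 0%N by rewrite eqxx.
  rewrite /ncl -/good (_ : good = set0) ?ncard0//.
  apply/seteqP; split => // C gC; have [CX _ _] := gC.
  have [p Cp] := clusters_neq0 CX.
  suff : ball_union_in X alpha r p by rewrite e.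
  by rewrite buin; exists p; [exists C|rewrite /eball /= edistxx].
case: eqP => [/ncard_eq0 e|_].
  exfalso; apply: ne; rewrite buin; apply/seteqP; split => // x [p [C]].
  by rewrite /good e.
rewrite /cech_in centers b0_cech// pclD -/good -/(ncl X alpha G setT).
rewrite EFinM muleC; congr (_ * _)%E.
rewrite buin components_ball_union//; last exact: finite_locfin.
rewrite pclD fsbig_image; last first.
  by move=> C C' /set_mem[CX _ _] /set_mem[CX' _ _] e; move: (e); apply: (@ball_union_inj _ _ X _ a0); exact/mem_set.
rewrite fsbig_finite; last exact: fgood.
under eq_bigr do rewrite diracE.
rewrite sumEFin -natr_sum; congr (_%:R%:E).
rewrite /ncl (_ : goodcl X alpha G A = good `&` [set C | A (htype R d (ball_union C alpha))]).
  rewrite ncardIE; last exact: fgood.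
  apply: eq_bigr => C _; congr nat_of_bool; apply/idP/idP => /set_mem h; exact/mem_set.
by apply/seteqP; split => [C [? ? ?]|C [[? ? _] ?]].
Qed.

End mu_in_clusters.

Section patterns.
Context {R : realType} {d : nat}.
Local Notation V := 'rV[R]_d.

Let cech_pair (c : V -> V) (Z : set V) r a b : Z a -> Z b ->
  cech Z c r [fset a; b]%fset <-> eball (c a) r `&` eball (c b) r !=set0.
Proof.
move=> Za Zb; split => [[_ _ [x xab]]|[x [xa xb]]].
  by exists x; split; apply: xab; rewrite /= !inE eqxx ?orbT.
split.
- by apply/fset0Pn; exists a; rewrite !inE eqxx.
- by move=> u /=; rewrite !inE => /orP[] /eqP ->.
- by exists x => u /=; rewrite !inE => /orP[] /eqP ->.
Qed.

(** Which points are linked, and by the nerve theorem the type of each cluster,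
    can be read off the nerve. *)
Lemma ncl_pattern (Z : set V) (f : V -> V) r r' (G G' : set V) (A : set (gclass R d)) :
  finite_set Z -> {in Z &, injective f} -> cech Z f r' = cech Z id r ->
  (forall p, Z p -> G p <-> G' (f p)) ->
  ncl (f @` Z) r' G' A = ncl Z r G A.
Proof.
move=> fZ fI ZZ GG'.
have adj a b : Z a -> Z b ->
    eball a r `&` eball b r !=set0 <-> eball (f a) r' `&` eball (f b) r' !=set0.
  by move=> Za Zb; rewrite -(cech_pair f r' Za Zb) ZZ; symmetry; exact: (cech_pair id).
have types C : C `<=` Z ->
    htype R d (ball_union C r) = htype R d (ball_union (f @` C) r').
  move=> CZ; have fC : finite_set C by exact: sub_finite_set fZ.
  apply: homotopy_equiv_htype.
  have := nerve_eballs (fset_set C) id r; rewrite fset_setK// => n1.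
  have := nerve_eballs (fset_set C) f r'; rewrite fset_setK// => n2.
  have restr (c : V -> V) rho : cech C c rho = cech Z c rho `&` [set S : {fset V} | [set` S] `<=` C].
    apply/seteqP; split => [S [S0 SC Sx]|S [[S0 _ Sx] SC]]; split => //.
    by split => // v /SC; exact: CZ.
  have e : ball_union (f @` C) r' = \bigcup_(v in C) eball (f v) r'.
    by rewrite /ball_union bigcup_image.
  rewrite e; apply: homotopy_equiv_trans n1 _; apply: homotopy_equiv_sym.
  by rewrite restr -ZZ -restr.
have Cf : finite_set (goodcl Z r G A).
  by apply: goodcl_finite; apply: sub_finite_set fZ; exact: subIsetl.
have CZ C : goodcl Z r G A C -> C `<=` Z by move=> [CZ _ _]; exact: clusters_sub CZ.
rewrite /ncl -(ncard_image Cf (f := fun C => f @` C)).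
  congr ncard; apply/seteqP; split => [C|_ [C [CZ' CG CA] <-]].
    rewrite /goodcl /= /pclusters (clusters_image fI adj) => -[[C' C'Z <-] CG CA].
    have C'sub := clusters_sub C'Z.
    exists C' => //; split => //; last by rewrite types.
    by move=> p C'p; apply/GG'; [exact: C'sub|apply: CG; exists p].
  have Csub := clusters_sub CZ'; split.
  - by rewrite /pclusters (clusters_image fI adj); exists C.
  - by move=> _ [p Cp <-]; apply/GG'; [exact: Csub|exact: CG].
  - by rewrite -types.
move=> C C' /set_mem/CZ CsZ /set_mem/CZ C'sZ e.
have sub B B' : B `<=` Z -> B' `<=` Z -> f @` B = f @` B' -> B `<=` B'.
  move=> BZ B'Z eB p Bp; have [q B'q qp] : (f @` B') (f p) by rewrite -eB; exists p.
  by rewrite -(fI q p) ?inE//; [exact: B'Z|exact: BZ].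
by apply/seteqP; split; apply: sub.
Qed.

End patterns.

(** * Half-open boxes: volume, Poisson counts and independence *)

Section box_volume.
Context {R : realType}.

Lemma lebesgue_rV_set0 n : lebesgue_rV (set0 : set 'rV[R]_n) = 0%E.
Proof.
elim: n => [|n IH] /=; first by rewrite indicE in_set0.
rewrite (_ : (fun x => _) = cst 0%E) ?integral0//; apply/funext => x.
by rewrite -[RHS]IH; congr lebesgue_rV.
Qed.

Lemma row_mx_ord0 n (x : R) (v : 'rV[R]_n) :
  (row_mx (x%:M : 'rV[R]_1) v : 'rV[R]_(1 + n)) 0 ord0 = x.
Proof.
rewrite (_ : ord0 = lshift n ord0 :> 'I_(1 + n)); last exact: val_inj.
by rewrite row_mxEl mxE eqxx mulr1n.
Qed.

Lemma row_mx_lift n (x : R) (v : 'rV[R]_n) (j : 'I_n) :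
  (row_mx (x%:M : 'rV[R]_1) v : 'rV[R]_(1 + n)) 0 (lift ord0 j) = v 0 j.
Proof.
rewrite (_ : lift ord0 j = rshift 1 j :> 'I_(1 + n)); last exact: val_inj.
exact: row_mxEr.
Qed.

Lemma lebesgue_rV_box n (a b : 'I_n -> R) : (forall i, a i <= b i) ->
  lebesgue_rV [set v : 'rV[R]_n | forall i, a i <= v 0 i < b i] =
  (\prod_i (b i - a i))%:E.
Proof.
elim: n a b => [|n IH] a b ab.
  by rewrite /= indicE mem_set ?big_ord0//= => -[].
rewrite /= big_ord_recl.
pose C := \prod_(i < n) (b (lift ord0 i) - a (lift ord0 i)).
have C0 : 0 <= C by apply: prodr_ge0 => i _; rewrite subr_ge0.
have e (x : R) : lebesgue_rV [set v : 'rV[R]_n | forall i : 'I_n.+1,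
    a i <= (row_mx x%:M v : 'rV[R]_(1 + n)) 0 i < b i] =
    (C%:E * (\1_(`[a ord0, b ord0[%classic) x)%:E)%E.
  rewrite indicE; have [xab|xab] := boolP (x \in `[a ord0, b ord0[%classic).
    rewrite mule1 -IH => [|i]; last exact: ab.
    congr lebesgue_rV; apply/seteqP; split => v /= h i.
      by have := h (lift ord0 i); rewrite row_mx_lift.
    have [->|[j ->]] : i = ord0 \/ exists j, i = lift ord0 j.
      by case: (unliftP ord0 i) => [j ->|->]; [right; exists j|left].
      by rewrite row_mx_ord0; move: xab; rewrite inE /= in_itv.
    by rewrite row_mx_lift; exact: h.
  rewrite mule0 -[RHS](lebesgue_rV_set0 n); congr lebesgue_rV.
  apply/seteqP; split => // v /(_ ord0) /= h.
  move/negP: xab; apply; rewrite inE /= in_itv /=.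
  by move: h; rewrite row_mx_ord0.
under eq_integral do rewrite e.
rewrite ge0_integralZl//=; last first.
  by apply/measurable_EFinP; exact: measurable_indic.
rewrite integral_indic//= setIT lebesgue_measure_itv /= lte_fin.
rewrite -/C.
case: ltP => [_|ba]; first by rewrite -EFinD -EFinM mulrC.
by rewrite mule0 (_ : b ord0 - a ord0 = 0) ?mul0r//; apply/eqP; rewrite subr_eq0 eq_le ba ab.
Qed.

End box_volume.

Section boxes.
Context {R : realType} {d : nat}.
Local Notation V := 'rV[R]_d.
Implicit Types (a x : V) (l : R).

Definition box a l : set V := [set x | forall i, a 0 i <= x 0 i < a 0 i + l].

Lemma lebesgue_box a l : 0 <= l -> lebesgue_rV (box a l) = (l ^+ d)%:E.
Proof.
move=> l0; rewrite lebesgue_rV_box => [|i]; last by rewrite lerDl.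
rewrite (eq_bigr (fun=> l)) ?prodr_const ?card_ord//.
by move=> i _; rewrite addrAC subrr add0r.
Qed.

Lemma box_bounded a l : exists r, box a l `<=` eball 0 r.
Proof.
exists (edist 0 a + d%:R * `|l|) => x xb; rewrite /eball /=.
apply: (le_trans (edistD _ a _)); rewrite lerD2l; apply: edist_le_coord => i.
have /andP[ax xa] := xb i; rewrite distrC ger0_norm ?subr_ge0//.
by rewrite lerBlDl (le_trans (ltW xa))// lerD2l ler_norm.
Qed.

Lemma bounded_borel_box a l : bounded_borel (box a l).
Proof.
split; last exact: box_bounded.
pose Op := [set U : set V | open U].
pose T := g_sigma_algebraType Op.
have mlt (t : R) i : measurable ([set x : V | x 0 i < t] : set T).
  apply: sub_sigma_algebra.
  rewrite /Op /= (_ : [set x : V | x 0 i < t] = (fun x : V => x 0 i) @^-1` [set z | z < t])//.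
  by apply: open_comp (@open_lt _ t) => x _; exact: coord_continuous.
have -> : box a l = \bigcap_(i in [set: 'I_d])
    (~` [set x : V | x 0 i < a 0 i] `&` [set x : V | x 0 i < a 0 i + l]).
  apply/seteqP; split => x /= xb i; last by move=> /=; have [//|] := xb i; move=> /negP; rewrite -leNgt => -> ->.
  by move=> _; have /andP[ax xa] := xb i; split => //=; apply/negP; rewrite -leNgt.
apply: (@fin_bigcap_measurable _ T 'I_d setT) => [|i _]; first exact: finite_finset.
 apply: measurableI; last exact: mlt.
by apply: measurableC; exact: mlt.
Qed.

(** With N.+1 slices per side the type of the indices of cells is inhabited. *)
Definition corner a l N (k : {ffun 'I_d -> 'I_N.+1}) : V :=
  \row_i (a 0 i + l / N.+1%:R * (k i)%:R).
Definition cell a l N (k : {ffun 'I_d -> 'I_N.+1}) : set V :=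
  box (corner a l k) (l / N.+1%:R).
Definition cidx l N x : {ffun 'I_d -> 'I_N.+1} :=
  [ffun i => inord (Num.trunc (x 0 i / (l / N.+1%:R)))].

Lemma slice_index (l t : R) N (k : 'I_N.+1) : 0 < l ->
  l / N.+1%:R * k%:R <= t < l / N.+1%:R * k%:R + l / N.+1%:R <->
  0 <= t < l /\ inord (Num.trunc (t / (l / N.+1%:R))) = k :> 'I_N.+1.
Proof.
move=> l0; set h := l / N.+1%:R; have h0 : 0 < h by rewrite divr_gt0.
have hN : h * N.+1%:R = l by rewrite /h divfK// pnatr_eq0.
split=> [/andP[kt tk]|[/andP[t0 tl] <-]].
  have t0 : 0 <= t by apply: le_trans kt; rewrite mulr_ge0// ltW.
  have tk' : t < h * k.+1%:R by rewrite -natr1 mulrDr mulr1.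
  split; first by rewrite t0 (lt_le_trans tk')// -hN ler_pM2l// ler_nat.
  rewrite (@truncn_def _ _ k) ?inord_val//.
  by rewrite ler_pdivlMr// mulrC kt ltr_pdivrMr// mulrC.
have y0 : 0 <= t / h by rewrite divr_ge0// ltW.
have /andP[y1 y2] := truncn_itv y0.
rewrite inordK; last by rewrite truncn_lt_nat// ltr_pdivrMr// mulrC hN.
rewrite mulrC -ler_pdivlMr// y1 /=.
by move: y2; rewrite ltr_pdivrMr// -natr1 mulrDl mul1r.
Qed.

Lemma cellP a l N (k : {ffun 'I_d -> 'I_N.+1}) x : 0 < l ->
  cell a l k x <-> box a l x /\ cidx l N (x - a) = k.
Proof.
move=> l0; have key i := slice_index (x 0 i - a 0 i) (k i) l0.
have sub (u v w z : R) : (u + v <= w < u + v + z) = (v <= w - u < v + z).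
  by rewrite lerBrDl ltrBlDl addrA.
split=> [xk|[xa xk] i].
  have h i := (key i).1.
  split=> [i|].
    have := xk i; rewrite mxE sub => /h[/andP[? ?] _].
    by rewrite -subr_ge0 -ltrBlDl; apply/andP.
  apply/ffunP => i; rewrite ffunE !mxE.
  by have := xk i; rewrite mxE sub => /h[].
rewrite mxE sub; apply/(key i).2; split.
  by have /andP[? ?] := xa i; rewrite subr_ge0 ltrBlDl; apply/andP.
by move/ffunP: xk => /(_ i); rewrite ffunE !mxE.
Qed.

Lemma cell_box a l N (k : {ffun 'I_d -> 'I_N.+1}) : 0 < l -> cell a l k `<=` box a l.
Proof. by move=> l0 x /(cellP _ _ _ l0)[]. Qed.

Lemma cell_disj a l N (k k' : {ffun 'I_d -> 'I_N.+1}) : 0 < l ->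
  cell a l k `&` cell a l k' !=set0 -> k = k'.
Proof. by move=> l0 [x [/(cellP _ _ _ l0)[_ <-] /(cellP _ _ _ l0)[_ <-]]]. Qed.

Lemma box_shift a l x : box a l x <-> box 0 l (x - a).
Proof.
by split=> h i; have := h i; rewrite !mxE add0r subr_ge0 ltrBlDl.
Qed.

Lemma cell_shift a l N (k : {ffun 'I_d -> 'I_N.+1}) x : 0 < l ->
  cell a l k x <-> cell 0 l k (x - a).
Proof. by move=> l0; rewrite !(cellP _ _ _ l0) box_shift subr0. Qed.

Lemma edist_corner l N (k : {ffun 'I_d -> 'I_N.+1}) x : cell 0 l k x ->
  edist x (corner 0 l k) <= d%:R * (l / N.+1%:R).
Proof.
move=> xk; apply: edist_le_coord => i; have /andP[h1 h2] := xk i.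
by rewrite ger0_norm ?subr_ge0// lerBlDl ltW.
Qed.

Definition occ (X : set V) a l N : {ffun {ffun 'I_d -> 'I_N.+1} -> bool} :=
  [ffun k => `[< X `&` cell a l k !=set0 >]].

Definition local_config a l (X : set V) : set V := (fun x => x - a) @` (X `&` box a l).

Lemma local_config_box a l X : local_config a l X `<=` box 0 l.
Proof. by move=> _ [x [_ /box_shift xa] <-]. Qed.

Lemma occ_local a l N X : 0 < l -> occ (local_config a l X) 0 l N = occ X a l N.
Proof.
move=> l0; apply/ffunP => k; rewrite !ffunE; apply/asboolP/asboolP.
  by move=> [_ [[x [Xx _] <-] xk]]; exists x; split => //; exact/(cell_shift a k x l0).
move=> [x [Xx xk]]; exists (x - a); split; last exact/(cell_shift a k x l0).
by exists x => //; split => //; exact: cell_box xk.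
Qed.

(** Properties that the occupied cells of sufficiently fine subdivisions decide;
    the laws of these cells are known explicitly. *)
Definition approximable l (F : set V -> Prop) : Prop :=
  exists S : forall N, {ffun {ffun 'I_d -> 'I_N.+1} -> bool} -> bool,
    forall Z, finite_set Z -> Z `<=` box 0 l ->
      exists N0, forall N, (N0 <= N)%N -> S N (occ Z 0 l N) <-> F Z.

Lemma exists_common_rank (T : choiceType) (Z : set T) (Q : T -> nat -> Prop) :
  finite_set Z -> (forall x : T, Z x -> exists N0, forall N, (N0 <= N)%N -> Q x N) ->
  exists N0, forall N (x : T), (N0 <= N)%N -> Z x -> Q x N.
Proof.
move=> fZ ZQ.
have [N0 h] : exists N0, forall N (x : T), (N0 <= N)%N -> x \in enum_fset (fset_set Z) -> Q x N.
  have : forall x : T, x \in enum_fset (fset_set Z) -> Z x.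
    by move=> x xZ; apply/set_mem; rewrite -in_fset_set.
  elim: (enum_fset _) => [|y s IH] sZ; first by exists 0%N.
  have [N1 h1] := ZQ y (sZ y (mem_head _ _)).
  have [|N2 h2] := IH; first by move=> x xs; apply: sZ; rewrite inE xs orbT.
  exists (maxn N1 N2) => N x; rewrite geq_max => /andP[n1 n2].
  by rewrite inE => /predU1P[->|xs]; [exact: h1|exact: h2].
exists N0 => N x n0 Zx; apply: h => //.
by have := in_fset_set fZ x; rewrite (mem_set Zx).
Qed.

Lemma small_cells l (e : R) : 0 < e -> exists N0, forall N, (N0 <= N)%N ->
  d%:R * (l / N.+1%:R) <= e.
Proof.
move=> e0; exists (Num.trunc (d%:R * `|l| / e)) => N N0N.
rewrite mulrA ler_pdivrMr// [e * _]mulrC -ler_pdivrMr//.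
apply: (@le_trans _ _ (d%:R * `|l| / e)).
  by rewrite ler_pM2r ?invr_gt0// ler_wpM2l// ler_norm.
by apply/ltW/(lt_le_trans (truncnS_gt _)); rewrite ler_nat ltnS.
Qed.

(** Moving each point to the corner of its cell displaces it by at most eps N.
    For large N the nerve is unchanged, by cech_stable, if the radius is enlarged
    by eps N, and a point is in the open set G exactly when its cell is inside G. *)
Lemma approximable_ncl l alpha (G : set V) (Psi : (set (gclass R d) -> nat) -> Prop) :
  0 < l -> open G -> approximable l (fun Z => Psi (ncl Z alpha G)).
Proof.
move=> l0 oG.
pose eps N : R := d%:R * (l / N.+1%:R).
have eps0 N : 0 <= eps N by rewrite mulr_ge0// divr_ge0// ltW.
pose G' N : set V := [set q | box q (l / N.+1%:R) `<=` G].
pose pts N (y : {ffun {ffun 'I_d -> 'I_N.+1} -> bool}) : set V := corner 0 l (N := N) @` [set k | y k].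
exists (fun N y => `[< Psi (ncl (pts N y) (alpha + eps N) (G' N)) >]) => Z fZ Zl.
pose f N x : V := corner 0 l (cidx l N x).
have cellf N x : Z x -> cell 0 l (cidx l N x) x.
  by move=> /Zl xl; apply/cellP => //; rewrite subr0.
have distf N x : Z x -> edist x (f N x) <= eps N.
  by move=> /(cellf N)/edist_corner.
have ptsE N : pts N (occ Z 0 l N) = f N @` Z.
  apply/seteqP; split => [_ [k + <-]|_ [x Zx <-]].
    rewrite /= ffunE => /asboolP[x [Zx xk]]; exists x => //; rewrite /f; congr corner.
    by move: xk => /(cellP _ _ _ l0)[_]; rewrite subr0.
  exists (cidx l N x) => //=; rewrite ffunE; apply/asboolP; exists x; split => //.
  exact: cellf.
have [N1 cechf] : exists N1, forall N, (N1 <= N)%N ->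
    cech Z (f N) (alpha + eps N) = cech Z id alpha.
  have [e e0 He] := cech_stable (fset_set Z) (@id V) alpha.
  have [N1 h] := small_cells l (divr_gt0 e0 (ltr0n R 2)).
  exists N1 => N /h eN; have := He (f N) (alpha + eps N); rewrite fset_setK//; apply.
  move=> v; rewrite in_fset_set// => /set_mem Zv; have := distf N v Zv.
  rewrite -/(eps N) in eN => dv; split; first by rewrite lerD2l.
  by rewrite -addrA lerD2l (le_trans (lerD (lexx _) dv))// -mulr2n -mulr_natr -ler_pdivlMr.
have [N2 injf] : exists N2, forall N, (N2 <= N)%N -> {in Z &, injective (f N)}.
  suff [N2 h] : exists N2, forall N p, (N2 <= N)%N -> (Z `*` Z) p ->
      f N p.1 = f N p.2 -> p.1 = p.2.
    by exists N2 => N N2N x y /set_mem Zx /set_mem Zy; exact: (h N (x, y)).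
  apply: (@exists_common_rank _ _ (fun p N => f N p.1 = f N p.2 -> p.1 = p.2)).
    exact: finite_setX.
  move=> [x y] [/= Zx Zy]; have [->|xy] := eqVneq x y; first by exists 0%N.
  have d0 : 0 < edist x y.
    rewrite lt_neqAle edist_ge0 andbT eq_sym; apply: contra xy => /eqP dxy.
    apply/eqP/rowP => i; apply/eqP; rewrite -subr_eq0 -normr_le0 -dxy.
    exact: coord_le_edist.
  have [N2 h] := small_cells l (divr_gt0 d0 (ltr0n R 3)).
  exists N2 => N /h eN fxy; exfalso.
  have := edistD x (f N x) y; rewrite {2}fxy [edist (f N y) y]edistC.
  have := distf N x Zx; have := distf N y Zy; rewrite -/(eps N) in eN; lra.
have [N3 inG] : exists N3, forall N x, (N3 <= N)%N -> Z x -> G x <-> G' N (f N x).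
  apply: exists_common_rank => // x Zx.
  have G'G N : G' N (f N x) -> G x by apply; exact: cellf.
  have [Gx|nGx] := pselect (G x); last by exists 0%N => N _; split => // /G'G.
  have /nbhs_ballP[e /= e0 eG] : nbhs x G by exact: open_nbhs_nbhs.
  have [N3 h] := small_cells l (divr_gt0 e0 (ltr0n R 3)).
  exists N3 => N /h eN; split => // _ y yx.
  apply: eG; rewrite mx_norm_ball /ball_ /= [ `|_|]mx_normrE.
  apply/bigmax_ltP; split => // -[i j] _ /=; rewrite [i]ord1.
  have xy : edist x y <= 2 * eps N.
    have := edistD x (f N x) y; have := distf N x Zx.
    have : edist (f N x) y <= eps N.
      apply: edist_le_coord => u; have /andP[h1 h2] := yx u.
      by rewrite distrC ger0_norm ?subr_ge0// lerBlDl ltW.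
    by lra.
  have := coord_le_edist x y j; rewrite -/(eps N) in eN; rewrite !mxE /= => xyj.
  by apply: le_lt_trans xyj _; apply: le_lt_trans xy _; lra.
exists (maxn N1 (maxn N2 N3)) => N; rewrite !geq_max => /and3P[n1 n2 n3].
rewrite ptsE (_ : ncl (f N @` Z) _ _ = ncl Z alpha G).
  by split=> [/asboolP//|?]; apply/asboolP.
apply/funext => A; apply: ncl_pattern => //; [exact: injf|exact: cechf|].
by move=> x Zx; exact: inG.
Qed.

End boxes.

(** * Laws of approximable properties of a Poisson process *)

Section finite_laws.
Context {R : realType} {dO : measure_display} {Omega : measurableType dO}.
Variable P : probability Omega R.

Lemma finite_law (Y : finType) (h : Omega -> Y) (S : Y -> bool) :
  (forall y, measurable (h @^-1` [set y])) ->
  measurable [set w | S (h w)] /\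
  P [set w | S (h w)] = (\sum_(y | S y) P (h @^-1` [set y]))%E.
Proof.
move=> mh; rewrite -big_filter.
have -> : [set w | S (h w)] = [set w | h w \in [seq y <- index_enum Y | S y]].
  by apply/seteqP; split => w /=; rewrite mem_filter mem_index_enum andbT.
move: (filter_uniq S (index_enum_uniq Y)).
elim: [seq y <- index_enum Y | S y] => [_|y s IH /= /andP[ys us]].
  have -> : [set w | h w \in [::]] = set0 by apply/seteqP; split.
  by rewrite big_nil measure0.
have [ms Ps] := IH us.
have -> : [set w | h w \in y :: s] = h @^-1` [set y] `|` [set w | h w \in s].
  by apply/seteqP; split => w /=; rewrite inE => /predU1P.
split; first exact: measurableU.
rewrite measureU//; last by rewrite -subset0 => w [/= -> ys']; rewrite ys' in ys.
by rewrite big_cons; congr (_ + _)%E; exact: Ps.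
Qed.

(** Dominated convergence for indicators. *)
Lemma eventually_law (E_ : nat -> set Omega) (E : set Omega) :
  (forall N, measurable (E_ N)) ->
  (forall w, exists N0, forall N, (N0 <= N)%N -> E_ N w <-> E w) ->
  measurable E /\ P (E_ N) @[N --> \oo] --> P E.
Proof.
move=> mE cE.
have EE : E = \bigcup_n \bigcap_(k in [set k | (n <= k)%N]) E_ k.
  apply/seteqP; split => w.
    by have [N0 h] := cE w => Ew; exists N0 => // N /= /h ->.
  have [N0 h] := cE w => -[n _ En]; apply/(h (maxn n N0)).
    exact: leq_maxr.
  by apply: En; exact: leq_maxl.
have mE' : measurable E.
  rewrite EE; apply: bigcup_measurable => n _; apply: bigcap_measurableType => k _.
  exact: mE.
split => //.
have cvgI : (\int[P]_w (\1_(E_ N) w)%:E)%E @[N --> \oo] --> (\int[P]_w (\1_E w)%:E)%E.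
  apply: (@dominated_cvg _ _ _ P setT _ _ _ (cst 1%E)) => //.
  - by move=> N; apply/measurable_EFinP; exact: measurable_indic.
  - move=> w _; have [N0 h] := cE w; apply: cvg_near_cst; exists N0 => // N /= /h EN.
    rewrite !indicE; congr (_%:R%:E); congr nat_of_bool.
    by apply/idP/idP => /set_mem ?; apply/mem_set/EN.
  - exact: finite_measure_integrable_cst.
  - by move=> N w _ /=; rewrite indicE lee_fin; case: (_ \in _); rewrite /= ?normr1 ?normr0.
move: cvgI; rewrite integral_indic// setIT.
by under eq_fun do rewrite integral_indic// setIT.
Qed.

End finite_laws.

Section poisson_laws.
Context {R : realType} {d : nat} {dO : measure_display} {Omega : measurableType dO}.
Variables (P : probability Omega R) (X : Omega -> set 'rV[R]_d).
Hypothesis hX : poisson_process P X.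
Local Notation V := 'rV[R]_d.

Lemma poisson_locfin w : locfin (X w).
Proof. exact: poisson_locally_finite hX w. Qed.

Lemma finite_in_box w a l : finite_set (X w `&` box a l).
Proof.
have [r br] := @box_bounded R d a l.
exact: locfin_bounded (poisson_locfin w) br.
Qed.

Lemma poisson_count_measurable A (B : set nat) : bounded_borel A ->
  measurable [set w | B (npoints (X w) A)].
Proof.
move=> bA; have := poisson_measurable hX bA; move=> /(_ measurableT B).
by rewrite setTI; apply.
Qed.

Lemma poisson_independent_fin (J : finType) (A : J -> set V) (B : J -> set nat) :
  (forall j, bounded_borel (A j)) ->
  (forall i j, A i `&` A j !=set0 -> i = j) ->
  P [set w | forall j, B j (npoints (X w) (A j))] =
  (\prod_j P [set w | B j (npoints (X w) (A j))])%E.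
Proof.
move=> bA dA.
have := @poisson_independent _ _ _ _ _ _ hX #|J| (fun i => A (enum_val i))
  (fun i => bA (enum_val i)) _ (fun i => B (enum_val i)).
rewrite [X in _ -> _ = X](reindex (@enum_val J J)); last exact/onW_bij/enum_val_bij.
move=> <-.
- congr (P _); apply/seteqP; split => w /= wB; first by move=> i _; exact: wB.
  by move=> j; have := wB (enum_rank j) I; rewrite /= enum_rankK.
- by move=> i j _ _ /dA /enum_val_inj.
Qed.

Let emptyp l : R := expR (- l ^+ d).

Lemma box_empty_law a l : 0 <= l ->
  P [set w | npoints (X w) (box a l) = 0%N] = (emptyp l)%:E.
Proof.
move=> l0; rewrite (poisson_law hX (bounded_borel_box a l) 0) lebesgue_box//=.
by rewrite expr0 fact0 divr1 mul1r.
Qed.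

Lemma box_occupied_law a l : 0 <= l ->
  P [set w | npoints (X w) (box a l) <> 0%N] = (1 - emptyp l)%:E.
Proof.
move=> l0; rewrite -[X in P X]/(~` [set w | npoints (X w) (box a l) = 0%N]).
rewrite probability_setC ?box_empty_law// ?EFinB//.
exact: (@poisson_count_measurable _ [set 0%N] (bounded_borel_box a l)).
Qed.

Let q l (b : bool) : R := if b then 1 - emptyp l else emptyp l.
Let bitset (b : bool) : set nat := if b then [set n | n <> 0%N] else [set 0%N].

Lemma bit_law a l b : 0 <= l ->
  P [set w | bitset b (npoints (X w) (box a l))] = (q l b)%:E.
Proof. by move=> l0; case: b; [exact: box_occupied_law|exact: box_empty_law]. Qed.

Lemma npoints_eq0 w a l : npoints (X w) (box a l) = 0%N <-> ~ (X w `&` box a l !=set0).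
Proof.
split=> [/(ncard_eq0 (finite_in_box w a l)) -> [x []//]|e].
suff -> : npoints (X w) (box a l) = ncard (@set0 V) by rewrite ncard0.
by congr ncard; apply/seteqP; split => // x Xx; apply: e; exists x.
Qed.

Lemma occ_eqP w a l N (y : {ffun {ffun 'I_d -> 'I_N.+1} -> bool}) :
  occ (X w) a l N = y <-> forall k, bitset (y k) (npoints (X w) (cell a l k)).
Proof.
split=> [<- k|h]; last apply/ffunP => k; rewrite ffunE.
  case: (pselect (X w `&` cell a l k !=set0)) => e.
    by rewrite (asboolT e) /= npoints_eq0; apply.
  by rewrite (asboolF e) /=; apply/npoints_eq0.
have := h k; rewrite /bitset; case: (y k) => /=; rewrite npoints_eq0.
  by move/contrapT => e; rewrite asboolT.
by move=> e; rewrite asboolF.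
Qed.

Let ql l N (y : {ffun {ffun 'I_d -> 'I_N.+1} -> bool}) : R :=
  \prod_k q (l / N.+1%:R) (y k).

Let side_ge0 l N : 0 < l -> 0 <= l / N.+1%:R :> R.
Proof. by move=> l0; rewrite divr_ge0// ltW. Qed.

Lemma occ_measurable a l N y : measurable [set w | occ (X w) a l N = y].
Proof.
have -> : [set w | occ (X w) a l N = y] =
    \bigcap_(k in setT) [set w | bitset (y k) (npoints (X w) (cell a l k))].
  by apply/seteqP; split => w /=; rewrite occ_eqP => h k; [move=> _|]; apply: h.
apply: fin_bigcap_measurable => [|k _]; first exact: finite_finset.
by apply: poisson_count_measurable; exact: bounded_borel_box.
Qed.

Lemma occ_law a l N y : 0 < l -> P [set w | occ (X w) a l N = y] = (ql l y)%:E.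
Proof.
move=> l0.
have -> : [set w | occ (X w) a l N = y] =
    [set w | forall k, bitset (y k) (npoints (X w) (cell a l k))].
  by apply/seteqP; split => w /=; rewrite occ_eqP.
rewrite (@poisson_independent_fin _ (@cell R d a l N) (fun k => bitset (y k))).
- by under eq_bigr do rewrite bit_law ?side_ge0//; rewrite -prodEFin.
- by move=> k; exact: bounded_borel_box.
- by move=> k k'; exact: cell_disj.
Qed.

Lemma occ2_law a a' l N y y' : 0 < l -> box a l `&` box a' l = set0 ->
  P [set w | occ (X w) a l N = y /\ occ (X w) a' l N = y'] = (ql l y * ql l y')%:E.
Proof.
move=> l0 dis; pose K := {ffun 'I_d -> 'I_N.+1}.
pose A (j : K + K) := match j with inl k => cell a l k | inr k => cell a' l k end.
pose B (j : K + K) := match j with inl k => bitset (y k) | inr k => bitset (y' k) end.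
have -> : [set w | occ (X w) a l N = y /\ occ (X w) a' l N = y'] =
    [set w | forall j, B j (npoints (X w) (A j))].
  apply/seteqP; split => w /=; rewrite !occ_eqP; first by move=> [h h'] [k|k]; [exact: h|exact: h'].
  by move=> h; split => k; [exact: (h (inl k))|exact: (h (inr k))].
rewrite poisson_independent_fin.
- rewrite big_sumType/= EFinM; congr (_ * _)%E.
    by under eq_bigr do rewrite bit_law ?side_ge0//; rewrite -prodEFin.
  by under eq_bigr do rewrite bit_law ?side_ge0//; rewrite -prodEFin.
- by move=> [k|k]; exact: bounded_borel_box.
- have disj (k k' : K) x : cell a l k x -> cell a' l k' x -> False.
    move=> /(cell_box l0) xa /(cell_box l0) xa'.
    by have : (box a l `&` box a' l) x by []; rewrite dis.
  move=> [k|k] [k'|k'] /= [x [xk xk']].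
  + by rewrite (cell_disj l0 (ex_intro _ x (conj xk xk'))).
  + by case: (disj k k' x xk xk').
  + by case: (disj k' k x xk' xk).
  + by rewrite (cell_disj l0 (ex_intro _ x (conj xk xk'))).
Qed.

Let pl l N (S : {ffun {ffun 'I_d -> 'I_N.+1} -> bool} -> bool) : R :=
  \sum_(y | S y) ql l y.

Let occS_law a l N (S : {ffun {ffun 'I_d -> 'I_N.+1} -> bool} -> bool) : 0 < l ->
  measurable [set w | S (occ (X w) a l N)] /\
  P [set w | S (occ (X w) a l N)] = (pl l S)%:E.
Proof.
move=> l0; have [m ->] := @finite_law _ _ _ P _ (fun w => occ (X w) a l N) S
  (fun y => occ_measurable a l y).
split => //; under eq_bigr do rewrite occ_law//.
by rewrite sumEFin.
Qed.

Let occS2_law a a' l N (S S' : {ffun {ffun 'I_d -> 'I_N.+1} -> bool} -> bool) :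
  0 < l -> box a l `&` box a' l = set0 ->
  P [set w | S (occ (X w) a l N) /\ S' (occ (X w) a' l N)] = (pl l S * pl l S')%:E.
Proof.
move=> l0 dis.
have m2 (p : _ * _) : measurable ((fun w => (occ (X w) a l N, occ (X w) a' l N)) @^-1` [set p]).
  case: p => y y'.
  have -> : (fun w => (occ (X w) a l N, occ (X w) a' l N)) @^-1` [set (y, y')] =
      [set w | occ (X w) a l N = y] `&` [set w | occ (X w) a' l N = y'].
    by apply/seteqP; split => w /= [-> ->].
  by apply: measurableI; exact: occ_measurable.
have [_ h] := @finite_law _ _ _ P _ _ (fun p => S p.1 && S' p.2) m2.
rewrite (_ : [set w | _] = [set w | S (occ (X w) a l N) && S' (occ (X w) a' l N)]).
  rewrite h /pl big_distrlr /= pair_big/= -sumEFin; apply: eq_bigr => -[y y'] _.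
  rewrite -(occ2_law y y' l0 dis) /=; congr (P _).
  by apply/seteqP; split => w /= [-> ->].
by apply/seteqP; split => w /andP.
Qed.

Let decided a l (F : set V -> Prop) (S : forall N, {ffun {ffun 'I_d -> 'I_N.+1} -> bool} -> bool) :
  0 < l ->
  (forall Z, finite_set Z -> Z `<=` box 0 l ->
      exists N0, forall N, (N0 <= N)%N -> S N (occ Z 0 l N) <-> F Z) ->
  forall w, exists N0, forall N, (N0 <= N)%N ->
    S N (occ (X w) a l N) <-> F (local_config a l (X w)).
Proof.
move=> l0 h w; have [||N0 hN] := h (local_config a l (X w)).
- by apply: finite_image; exact: finite_in_box.
- exact: local_config_box.
by exists N0 => N /hN <-; rewrite occ_local.
Qed.

Lemma approximable_measurable a l F : 0 < l -> approximable l F ->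
  measurable [set w | F (local_config a l (X w))].
Proof.
move=> l0 [S h].
by have [] := eventually_law P (fun N => (occS_law a (S N) l0).1) (decided a l0 h).
Qed.

(** The law of the set of occupied cells depends only on the side of the box. *)
Lemma approximable_law a a' l F : 0 < l -> approximable l F ->
  P [set w | F (local_config a l (X w))] = P [set w | F (local_config a' l (X w))].
Proof.
move=> l0 [S h].
have lim b : (pl l (S N))%:E @[N --> \oo] --> P [set w | F (local_config b l (X w))].
  have [_] := eventually_law P (fun N => (occS_law b (S N) l0).1) (decided b l0 h).
  by under eq_fun do rewrite (occS_law b _ l0).2.
exact: cvg_unique (lim a) (lim a').
Qed.

(** The cells of disjoint boxes are disjoint, so that the sets of occupied cells
    are independent at each stage of the approximation. *)
Lemma approximable_indep a a' l F F' : 0 < l -> approximable l F ->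
  approximable l F' -> box a l `&` box a' l = set0 ->
  P [set w | F (local_config a l (X w)) /\ F' (local_config a' l (X w))] =
  (P [set w | F (local_config a l (X w))] * P [set w | F' (local_config a' l (X w))])%E.
Proof.
move=> l0 [S h] [S' h'] dis.
have [_] := eventually_law P (fun N => (occS_law a (S N) l0).1) (decided a l0 h).
under eq_fun do rewrite (occS_law a _ l0).2.
move=> c1.
have [_] := eventually_law P (fun N => (occS_law a' (S' N) l0).1) (decided a' l0 h').
under eq_fun do rewrite (occS_law a' _ l0).2.
move=> c2.
have [w|_] := @eventually_law _ _ _ P (fun N => [set w | S N (occ (X w) a l N) /\ S' N (occ (X w) a' l N)])
  [set w | F (local_config a l (X w)) /\ F' (local_config a' l (X w))]
  (fun N => measurableI _ _ (occS_law a (S N) l0).1 (occS_law a' (S' N) l0).1).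
  have [N0 h0] := decided a l0 h w; have [N1 h1] := decided a' l0 h' w.
  exists (maxn N0 N1) => N /=; rewrite geq_max => /andP[/h0 -> /h1 ->].
  by [].
under eq_fun do rewrite occS2_law// EFinM.
move=> c3; apply: (cvg_unique _ c3) => //.
apply: cvgeM c1 c2.
by apply: mule_def_fin; apply: fin_num_measure; apply: approximable_measurable => //; [exists S|exists S'].
Qed.

End poisson_laws.

Section poisson_mean.
Context {R : realType} {d : nat} {dO : measure_display} {Omega : measurableType dO}.
Variables (P : probability Omega R) (X : Omega -> set 'rV[R]_d).
Hypothesis hX : poisson_process P X.

Definition mean_bound (l : R) : R := expR (((2 * l) ^+ d) - l ^+ d).

Let sum_law a l : 0 <= l ->
  (\sum_(0 <= k <oo) P [set w | npoints (X w) (box a l) = k])%E = 1%E.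
Proof.
move=> l0; rewrite -(@probability_setT _ _ _ P).
have -> : [set: Omega] = \bigcup_k [set w | npoints (X w) (box a l) = k].
  by apply/seteqP; split => w // _; exists (npoints (X w) (box a l)).
rewrite measure_bigcup//.
- by apply: eq_eseriesl => k; rewrite in_setT.
- by move=> k _; exact: (poisson_count_measurable hX [set k] (bounded_borel_box a l)).
- by move=> i j _ _ [w [/= <- <-]].
Qed.

Lemma measurable_npoints A : bounded_borel A ->
  measurable_fun setT (fun w => (npoints (X w) A)%:R%:E : \bar R).
Proof.
move=> bA; apply/measurable_EFinP.
apply: (@measurableT_comp _ _ _ Omega nat R (fun n : nat => n%:R : R) setT
  (fun w => npoints (X w) A)) => //.
exact: poisson_measurable hX _ bA.
Qed.

(** Doubling the side of a box multiplies the Poisson weight of k by at least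
    2 ^ k, up to a constant, which bounds the mean by a total probability. *)
Lemma mean_npoints a l : (0 < d)%N -> 0 < l ->
  (\int[P]_w (npoints (X w) (box a l))%:R%:E <= (mean_bound l)%:E)%E.
Proof.
move=> d0 l0; have l0' := ltW l0.
have lin (k : nat) w : (0 <= (k%:R * \1_[set w | npoints (X w) (box a l) = k] w)%:E :> \bar R)%E.
  by rewrite lee_fin mulr_ge0.
have mk (k : nat) : measurable [set w | npoints (X w) (box a l) = k].
  exact: (poisson_count_measurable hX [set k] (bounded_borel_box a l)).
rewrite (eq_integral (fun w => (\sum_(0 <= k <oo)
    (k%:R * \1_[set w | npoints (X w) (box a l) = k] w)%:E)%E)); last first.
  move=> w _; rewrite (@nneseriesD1 _ _ (npoints (X w) (box a l)) xpredT)//.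
  rewrite indicE mem_set//= mulr1 eseries0 ?adde0// => k _ /= kn.
  by rewrite indicE memNset ?mulr0//= => e; rewrite e eqxx in kn.
rewrite integral_nneseries//; last first.
  by move=> k; apply/measurable_EFinP; apply: measurable_funM => //; exact: measurable_indic.
rewrite -[leRHS]mule1 -(sum_law a (mulr_ge0 (ler0n _ 2) l0')) -nneseriesZl//.
apply: lee_nneseries => k _; first by move=> _; apply: integral_ge0.
under eq_integral do rewrite EFinM.
rewrite ge0_integralZl//; try by [apply/measurable_EFinP; exact: measurable_indic|rewrite lee_fin].
rewrite integral_indic// setIT.
rewrite -[X in (_ * X <= _)%E]/(P [set w | npoints (X w) (box a l) = k]).
rewrite (poisson_law hX (bounded_borel_box a l)).
rewrite (poisson_law hX (bounded_borel_box a (2 * l))) !lebesgue_box ?mulr_ge0//=.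
rewrite -!EFinM lee_fin /mean_bound.
rewrite [leRHS](_ : _ = ((2 * l) ^+ d) ^+ k / k`!%:R * expR (- l ^+ d)); last first.
  have -> : expR (- l ^+ d) = expR ((2 * l) ^+ d - l ^+ d) * expR (- (2 * l) ^+ d).
    by rewrite -expRD; congr expR; ring.
  by ring.
rewrite mulrA ler_wpM2r ?expR_ge0// mulrA ler_wpM2r ?invr_ge0//.
rewrite exprMn exprMn ler_wpM2r ?exprn_ge0// -exprM -natrX ler_nat.
apply: (@leq_trans (2 ^ k)); first exact/ltnW/ltn_expl.
by rewrite leq_pexp2l// leq_pmull.
Qed.

End poisson_mean.

(** * Decomposition of space into blocks *)

Lemma ncard_bigcup_le (T : choiceType) (I : eqType) (s : seq I) (F : I -> set T) :
  (forall i, i \in s -> finite_set (F i)) ->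
  (ncard (\bigcup_(i in [set` s]) F i) <= \sum_(i <- s) ncard (F i))%N.
Proof.
elim: s => [|i s IH] fF.
  by rewrite set_nil bigcup_set0 ncard0.
have -> : [set` i :: s] = i |` [set` s].
  by apply/seteqP; split => j /=; rewrite inE => /predU1P.
have fF' j : j \in s -> finite_set (F j) by move=> js; apply: fF; rewrite inE js orbT.
rewrite bigcup_setU1 big_cons; apply: leq_trans (ncardU_le _ _) _.
- by apply: fF; rewrite mem_head.
- by apply: bigcup_finite => // j; exact: fF'.
- by rewrite leq_add2l; exact: IH.
Qed.

Section blocks.
Context {R : realType} {d : nat}.
Local Notation V := 'rV[R]_d.
Local Notation lat := {ffun 'I_d -> int}.

Definition lv (k : lat) : V := \row_i (k i)%:~R.
Definition org (L : nat) (z : lat) : V := \row_i (L%:R * (z i)%:~R).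
Definition block L z : set V := box (org L z) L%:R.
(** The margin h separates the clusters of different cores as soon as
    2 * alpha <= h. *)
Definition core (L h : nat) (z : lat) : set V :=
  [set x | forall i, org L z 0 i + h%:R < x 0 i < org L z 0 i + L%:R - h%:R].

Lemma core_block L h z : core L h z `<=` block L z.
Proof.
move=> x xc i; have /andP[x1 x2] := xc i.
have h0 : (0 : R) <= h%:R by [].
apply/andP; split; lra.
Qed.

Lemma meet_coord (alpha : R) (p q : V) i :
  eball p alpha `&` eball q alpha !=set0 -> `|p 0 i - q 0 i| <= 2 * alpha.
Proof.
move=> [x [px qx]]; apply: le_trans (coord_le_edist p q i) _.
apply: le_trans (edistD p x q) _; rewrite mulr_natl mulr2n lerD//.
by rewrite edistC.
Qed.

Lemma core_near (alpha : R) L h z p q : 2 * alpha <= h%:R -> core L h z p ->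
  eball p alpha `&` eball q alpha !=set0 -> block L z q.
Proof.
move=> ah pz pq i; have := meet_coord i pq; have /andP[p1 p2] := pz i.
rewrite ler_norml => /andP[n1 n2]; apply/andP; split; lra.
Qed.

Lemma core_sep (alpha : R) L h z z' p q : 0 <= alpha -> 2 * alpha <= h%:R ->
  core L h z p -> core L h z' q -> eball p alpha `&` eball q alpha !=set0 -> z = z'.
Proof.
move=> a0 ah pz qz pq; apply/ffunP => i.
have := meet_coord i pq; have := pz i; have := qz i; rewrite !mxE.
rewrite ler_norml => /andP[q1 q2] /andP[p1 p2] /andP[n1 n2].
have cmp (x y : int) : x < y -> L%:R * x%:~R + L%:R <= L%:R * y%:~R :> R.
  move=> xy; have xy1 : x + 1 <= y by lia.
  by rewrite -[X in _ + X]mulr1 -mulrDr ler_wpM2l// -[X in _ + X]/(1%:~R) -intrD ler_int.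
have h0 : (0 : R) <= h%:R by [].
have hh : 2 * alpha <= 2 * h%:R by lra.
case: (ltgtP (z i) (z' i)) => // /cmp c; exfalso; lra.
Qed.

Section decomposition.
Variables (X : set V) (alpha : R) (L h : nat) (G : set V) (J : {fset lat}).
Hypothesis fXG : finite_set (X `&` G).
Hypothesis a0 : 0 <= alpha.
Hypothesis ah : 2 * alpha <= h%:R.
Hypothesis JG : forall z, z \in J -> core L h z `<=` G.

(** The clusters and the points for which no core accounts. *)
Definition badcl (A : set (gclass R d)) : set (set V) :=
  goodcl X alpha G A `\` \bigcup_(z in [set` J]) goodcl X alpha (core L h z) A.

Definition badpts : set V :=
  (X `&` G) `\` \bigcup_(z in [set` J]) core L h z.

Let fgood A : finite_set (goodcl X alpha G A).
Proof. exact: goodcl_finite. Qed.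

Let fcore z A : z \in J -> finite_set (goodcl X alpha (core L h z) A).
Proof.
move=> zJ; apply: goodcl_finite; apply: sub_finite_set fXG.
by apply: setIS; exact: JG.
Qed.

Let core_good z A : z \in J -> goodcl X alpha (core L h z) A `<=` goodcl X alpha G A.
Proof. by move=> zJ C [CX CG CA]; split => // p /CG; exact: JG. Qed.

Let cluster_in_core C : pclusters X alpha C ->
  C `<=` \bigcup_(z in [set` J]) core L h z -> exists2 z, z \in J & C `<=` core L h z.
Proof.
move=> CX CJ; have [p Cp] := clusters_neq0 CX.
have [z /= zJ pz] := CJ p Cp; exists z => //.
rewrite (clustersE CX Cp) => q pq.
suff [] : C q /\ core L h z q by [].
apply: (pq (fun q => _ /\ _)); first by [].
move=> a b [Ca az] Xb ab; have Cb := clusters_step CX Ca Xb ab; split => //.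
have [z' /= z'J bz'] := CJ b Cb.
by rewrite (core_sep a0 ah az bz' ab).
Qed.

(** Such a cluster contains a point outside of the cores, since two linked points
    of cores are in the same core; and clusters are disjoint. *)
Lemma badcl_points A : (ncard (badcl A) <= ncard badpts)%N.
Proof.
have fb : finite_set badpts by apply: sub_finite_set fXG; exact: subDsetl.
apply: leq_trans (ncard_image_le (cluster_of (fun p => eball p alpha) X) fb).
apply: ncard_le; last exact: finite_image.
move=> C [[CX CG CA] nC].
have [p Cp np] : exists2 p, C p & ~ (\bigcup_(z in [set` J]) core L h z) p.
  apply: contrapT => nex; apply: nC.
  have [|z zJ Cz] := cluster_in_core CX.
    by move=> p Cp; apply: contrapT => np; apply: nex; exists p.
  by exists z.
exists p; last by rewrite (clustersE CX Cp).
by split => //; split; [exact: (clusters_sub CX)|exact: CG].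
Qed.

Lemma ncl_blocks A :
  ncl X alpha G A = (ncard (badcl A) + \sum_(z <- J) ncl X alpha (core L h z) A)%N.
Proof.
have sub : \bigcup_(z in [set` J]) goodcl X alpha (core L h z) A `<=` goodcl X alpha G A.
  by move=> C [z /= zJ]; exact: core_good.
rewrite /ncl -ncard_bigcup//.
- rewrite -ncardU.
  + by rewrite /badcl setUC setDUK.
  + by apply: sub_finite_set (fgood A); exact: subDsetl.
  + exact: sub_finite_set sub (fgood A).
  + by rewrite /badcl setDE -setIA [X in _ `&` X]setIC setICr setI0.
- by move=> z zJ; exact: fcore.
- move=> z z' zJ z'J [C [[CX Cz _] [_ Cz' _]]].
  have [p Cp] := clusters_neq0 CX.
  apply: (core_sep a0 ah (Cz _ Cp) (Cz' _ Cp)).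
  by exists p; split; rewrite /eball /= edistxx.
Qed.

Lemma badcl_types (A_ : nat -> set (gclass R d)) K :
  (forall i j, A_ i `&` A_ j !=set0 -> i = j) ->
  (\sum_(k < K) ncard (badcl (A_ k)) <= ncard badpts)%N.
Proof.
move=> dA; rewrite -(big_mkord xpredT (fun k => ncard (badcl (A_ k)))).
rewrite -ncard_bigcup.
- apply: leq_trans (badcl_points setT); apply: ncard_le.
    move=> C [k /= _ [[CX CG CA] nC]]; split => // -[z zJ [_ Cz _]]; apply: nC.
    by exists z.
  by apply: sub_finite_set (fgood setT); exact: subDsetl.
- exact: iota_uniq.
- by move=> k _; apply: sub_finite_set (fgood (A_ k)); exact: subDsetl.
- by move=> i j _ _ [C [[[_ _ Ai] _] [[_ _ Aj] _]]]; apply: dA; exists (htype R d (ball_union C alpha)).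
Qed.

End decomposition.

(** Points outside of the window are not linked to points of G, and translations
    preserve the nerve. *)
Lemma ncl_window (X : set V) (alpha : R) a l (G : set V) A :
  finite_set (X `&` box a l) -> 0 <= alpha ->
  (forall p q, G p -> eball p alpha `&` eball q alpha !=set0 -> box a l q) ->
  ncl X alpha G A = ncl (local_config a l X) alpha [set x | G (x + a)] A.
Proof.
move=> fX a0 Gl; rewrite /ncl -(@goodcl_restrict _ _ X (box a l)); last 2 first.
- move=> p [_ Gp]; apply: (Gl p p Gp); exists p.
  by split; rewrite /eball /= edistxx.
- by move=> p q [_ Gp] _; exact: Gl.
rewrite -[LHS]/(ncl (X `&` box a l) alpha G A); symmetry; apply: ncl_pattern.
- exact: fX.
- by move=> x y _ _; exact: addIr.
- apply/seteqP; split => S [S0 SD [x xS]]; split => //.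
    exists (x + a) => v vS; have := xS v vS; rewrite /eball /=.
    by rewrite -(edist_shift _ _ a) subrK.
  exists (x - a) => v vS; have := xS v vS; rewrite /eball /=.
  by rewrite edist_shift.
- by move=> p _ /=; rewrite subrK.
Qed.

Lemma ncl_core (X : set V) (alpha : R) L h z A : (forall a l, finite_set (X `&` box a l)) ->
  0 <= alpha -> 2 * alpha <= h%:R ->
  ncl X alpha (core L h z) A = ncl (local_config (org L z) L%:R X) alpha (core L h 0) A.
Proof.
move=> fX a0 ah; rewrite (@ncl_window X alpha (org L z) L%:R)//; last first.
  by move=> p q; exact: core_near.
congr ncl; apply/seteqP; split => x xc i; have := xc i; rewrite !mxE ffunE mulr0; lra.
Qed.

Lemma open_core L h z : open (core L h z).
Proof.
rewrite openE => x xc.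
exists (fun _ j => [set t | org L z 0 j + h%:R < t < org L z 0 j + L%:R - h%:R]).
  move=> i j; apply: open_nbhs_nbhs; split; last by rewrite [i]ord1; exact: xc.
  rewrite (_ : [set t | _] = `]org L z 0 j + h%:R, org L z 0 j + L%:R - h%:R[%classic).
    exact: itv_open.
  by apply/seteqP; split => t; rewrite /= in_itv.
by move=> y yP i; exact: yP.
Qed.

End blocks.

(** * A law of large numbers in mean for pairwise independent counts *)

Section lln.
Context {R : realType} {dO : measure_display} {Omega : measurableType dO}.
Variable P : probability Omega R.
Implicit Types f g : Omega -> R.

Definition mean (f : Omega -> R) : \bar R := (\int[P]_w (f w)%:E)%E.

Lemma mean_cst (r : R) : mean (cst r) = r%:E.
Proof.
rewrite /mean (@integral_cst _ _ _ P _ measurableT r%:E) -[RHS]mule1; congr (_ * _)%E.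
exact: probability_setT.
Qed.

Lemma mean_indic A : measurable A -> mean \1_A = P A.
Proof. by move=> mA; rewrite /mean integral_indic// setIT. Qed.

Lemma mean_ge0 f : (forall w, 0 <= f w) -> (0 <= mean f)%E.
Proof. by move=> f0; apply: integral_ge0 => w _; rewrite lee_fin. Qed.

Lemma meanD f g : measurable_fun setT f -> measurable_fun setT g ->
  (forall w, 0 <= f w) -> (forall w, 0 <= g w) ->
  mean (fun w => f w + g w) = (mean f + mean g)%E.
Proof.
move=> mf mg f0 g0; rewrite /mean; under eq_integral do rewrite EFinD.
by rewrite ge0_integralD//; try by [move=> w _; rewrite lee_fin|exact/measurable_EFinP].
Qed.

Lemma meanZ (c : R) f : 0 <= c -> measurable_fun setT f -> (forall w, 0 <= f w) ->
  mean (fun w => c * f w) = (c%:E * mean f)%E.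
Proof.
move=> c0 mf f0; rewrite /mean; under eq_integral do rewrite EFinM.
by rewrite ge0_integralZl//; try by [move=> w _; rewrite lee_fin|exact/measurable_EFinP].
Qed.

Lemma mean_sum (I : eqType) (s : seq I) (f : I -> Omega -> R) :
  (forall i, i \in s -> measurable_fun setT (f i)) ->
  (forall i w, i \in s -> 0 <= f i w) ->
  mean (fun w => \sum_(i <- s) f i w) = (\sum_(i <- s) mean (f i))%E /\
  measurable_fun setT (fun w => \sum_(i <- s) f i w).
Proof.
elim: s => [|i s IH] mf f0.
  rewrite big_nil (_ : (fun w => _) = cst 0); first by rewrite mean_cst.
  by apply/funext => w; rewrite big_nil.
have [||es ms] := IH.
- by move=> j js; apply: mf; rewrite inE js orbT.
- by move=> j w js; apply: f0; rewrite inE js orbT.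
have mi : measurable_fun setT (f i) by apply: mf; rewrite mem_head.
have -> : (fun w => \sum_(j <- i :: s) f j w) = (fun w => f i w + \sum_(j <- s) f j w).
  by apply/funext => w; rewrite big_cons.
split; last exact: measurable_funD.
rewrite meanD//.
- by rewrite es big_cons.
- by move=> w; apply: f0; rewrite mem_head.
- by move=> w; rewrite big_seq sumr_ge0// => j js; apply: f0; rewrite inE js orbT.
Qed.

Lemma mean_le f g : measurable_fun setT f -> measurable_fun setT g ->
  (forall w, 0 <= f w <= g w) -> (mean f <= mean g)%E.
Proof.
move=> mf mg fg; apply: ge0_le_integral => //; try exact/measurable_EFinP.
- by move=> w _; rewrite lee_fin; have /andP[] := fg w.
- by move=> w _; rewrite lee_fin; have /andP[] := fg w.
Qed.

Lemma mean_fin_le f (r : R) : (forall w, 0 <= f w) -> (mean f <= r%:E)%E ->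
  mean f = (fine (mean f))%:E.
Proof.
move=> f0 fr; rewrite fineK// ge0_fin_numE; last exact: mean_ge0.
exact: le_lt_trans fr (ltry r).
Qed.

Lemma integral_sum_indic (I : eqType) (s : seq I) (B : I -> set Omega) (c : I -> R) :
  (forall i, i \in s -> measurable (B i)) ->
  (forall i, i \in s -> P (B i) = (c i)%:E) ->
  (\int[P]_w (\sum_(i <- s) \1_(B i) w)%:E)%E = (\sum_(i <- s) c i)%:E /\
  measurable_fun setT (fun w => \sum_(i <- s) (\1_(B i) w : R)).
Proof.
elim: s => [|i s IH] mB cB.
  rewrite big_nil; split.
    by under eq_integral do rewrite big_nil; rewrite integral0.
  by rewrite (_ : (fun w => _) = cst 0)//; apply/funext => w; rewrite big_nil.
have [||es ms] := IH.
- by move=> j js; apply: mB; rewrite inE js orbT.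
- by move=> j js; apply: cB; rewrite inE js orbT.
have mi : measurable (B i) by apply: mB; rewrite mem_head.
split; last first.
  rewrite (_ : (fun w => _) = (fun w => \1_(B i) w + \sum_(j <- s) \1_(B j) w)).
    by apply: measurable_funD => //; exact: measurable_indic.
  by apply/funext => w; rewrite big_cons.
under eq_integral do rewrite big_cons EFinD.
rewrite ge0_integralD//.
- rewrite integral_indic// setIT big_cons EFinD es; congr (_ + _)%E.
  by apply: cB; rewrite mem_head.
- by apply/measurable_EFinP; exact: measurable_indic.
- by move=> w _; rewrite lee_fin sumr_ge0.
- exact/measurable_EFinP.
Qed.

(** From the second moment, by the inequality 2 |y| <= y ^ 2 / c + c for c = sqrt n. *)
Lemma mean_dev_indic (I : eqType) (s : seq I) (B : I -> set Omega) (p : R) : uniq s ->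
  (forall i, i \in s -> measurable (B i)) ->
  (forall i, i \in s -> P (B i) = p%:E) ->
  (forall i j, i \in s -> j \in s -> i != j -> P (B i `&` B j) = (p * p)%:E) ->
  (\int[P]_w `|\sum_(i <- s) \1_(B i) w - (size s)%:R * p|%:E
    <= (Num.sqrt (size s)%:R)%:E)%E.
Proof.
move=> us mB pB pBB; pose n : R := (size s)%:R.
pose S w : R := \sum_(i <- s) \1_(B i) w.
have [iS mS] := integral_sum_indic mB pB.
have sum_cst (c : R) : \sum_(i <- s) c = n * c.
  by rewrite big_const_seq count_predT iter_addr_0 mulr_natl.
rewrite sum_cst in iS.
have S0 w : 0 <= S w by rewrite /S sumr_ge0.
pose c (q : I * I) : R := if q.1 == q.2 then p else p * p.
have [||iS2 mS2] := @integral_sum_indic _ [seq (i, j) | i <- s, j <- s]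
    (fun q => B q.1 `&` B q.2) c.
- by move=> _ /allpairsP[[i j] [/= is_ js ->]]; apply: measurableI; exact: mB.
- move=> _ /allpairsP[[i j] [/= is_ js ->]]; rewrite /c /=.
  by case: eqVneq => [->|ij]; [rewrite setIid pB|rewrite pBB].
have eS2 w : S w ^+ 2 = \sum_(q <- [seq (i, j) | i <- s, j <- s]) \1_(B q.1 `&` B q.2) w.
  rewrite big_allpairs expr2 /S mulr_suml; apply: eq_bigr => i _.
  rewrite mulr_sumr; apply: eq_bigr => j _ /=.
  by rewrite !indicE in_setI -natrM mulnb.
have sumc : \sum_(q <- [seq (i, j) | i <- s, j <- s]) c q = n * p + n * (n - 1) * (p * p).
  rewrite big_allpairs.
  have -> : n * p + n * (n - 1) * (p * p) = n * (p + (n - 1) * (p * p)) by ring.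
  rewrite -sum_cst [LHS]big_seq [RHS]big_seq; apply: eq_bigr => i is_.
  rewrite (bigD1_seq i)//= /c eqxx; congr (_ + _).
  rewrite (eq_bigr (fun=> p * p)); last by move=> j /= /negbTE; rewrite eq_sym => ->.
  rewrite -big_filter big_const_seq count_predT iter_addr_0 -mulr_natl; congr (_ * _).
  rewrite size_filter /n -(count_predC (pred1 i) s) count_uniq_mem// is_ natrD.
  by rewrite addrAC subrr add0r; congr _%:R; apply: eq_count => j.
rewrite sumc in iS2.
have [s0|s0] := posnP (size s).
  rewrite s0 sqrtr0 (_ : s = [::]); last exact: size0nil.
  by under eq_integral do rewrite big_nil mul0r subr0 normr0; rewrite integral0.
have n0 : 0 < n by rewrite ltr0n.
have p0 : 0 <= p.
  have [i is_] : exists i, i \in s by case: (s) s0 => // i ? _; exists i; rewrite mem_head.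
  by rewrite -lee_fin -(pB i is_).
pose Y w := S w - n * p.
have mY : measurable_fun setT Y by apply: measurable_funB.
have mY2 : measurable_fun setT (fun w => Y w ^+ 2) by exact: measurable_funX.
have iY : (\int[P]_w (Y w ^+ 2)%:E = (n * p - n * (p * p))%:E)%E.
  have e : (\int[P]_w (Y w ^+ 2 + 2 * (n * p) * S w)%:E =
      \int[P]_w (S w ^+ 2 + (n * p) ^+ 2)%:E)%E.
    by apply: eq_integral => w _; congr _%:E; rewrite /Y; ring.
  have l : (\int[P]_w (Y w ^+ 2 + 2 * (n * p) * S w)%:E =
      \int[P]_w (Y w ^+ 2)%:E + (2 * (n * p) * (n * p))%:E)%E.
    under eq_integral do rewrite EFinD.
    rewrite ge0_integralD//.
    - congr (_ + _)%E; under eq_integral do rewrite EFinM.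
      rewrite ge0_integralZl//.
      + by rewrite iS EFinM.
      + exact/measurable_EFinP.
      + by move=> w _; rewrite lee_fin S0.
      + by rewrite lee_fin !mulr_ge0// ltW.
    - by move=> w _; rewrite lee_fin sqr_ge0.
    - exact/measurable_EFinP.
    - by move=> w _; rewrite lee_fin !mulr_ge0// ltW.
    - by apply/measurable_EFinP; exact: measurable_funM.
  have r : (\int[P]_w (S w ^+ 2 + (n * p) ^+ 2)%:E =
      (n * p + n * (n - 1) * (p * p) + (n * p) ^+ 2)%:E)%E.
    under eq_integral do rewrite EFinD.
    rewrite ge0_integralD//.
    - rewrite -/(mean (cst ((n * p) ^+ 2))) mean_cst EFinD; congr (_ + _)%E.
      by rewrite -iS2; apply: eq_integral => w _; rewrite eS2.
    - by move=> w _; rewrite lee_fin sqr_ge0.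
    - by apply/measurable_EFinP; exact: measurable_funX.
    - by move=> w _; rewrite lee_fin sqr_ge0.
  move: e; rewrite l r => e.
  have := congr1 (fun x => x - (2 * (n * p) * (n * p))%:E)%E e.
  by rewrite addeK// -EFinB => ->; congr _%:E; ring.
pose c0 : R := Num.sqrt n.
have c00 : 0 < c0 by rewrite sqrtr_gt0.
have c2 : c0 ^+ 2 = n by rewrite sqr_sqrtr// ltW.
have bound w : `|Y w| <= (2 * c0)^-1 * Y w ^+ 2 + c0 / 2.
  have h := sqr_ge0 (`|Y w| - c0).
  have e : (2 * c0)^-1 * Y w ^+ 2 + c0 / 2 - `|Y w| = (2 * c0)^-1 * (`|Y w| - c0) ^+ 2.
    by rewrite -(real_normK (num_real (Y w))); field; rewrite gt_eqF.
  by rewrite -subr_ge0 e mulr_ge0// invr_ge0 mulr_ge0// ltW.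
have c2i : 0 <= (2 * c0)^-1 by rewrite invr_ge0 mulr_ge0// ltW.
apply: (@le_trans _ _ (mean (fun w => (2 * c0)^-1 * Y w ^+ 2 + c0 / 2))).
  apply: mean_le => [||w]; last by rewrite normr_ge0; exact: bound.
    exact: measurableT_comp.
  by apply: measurable_funD => //; exact: measurable_funM.
rewrite meanD//; last 3 first.
- exact: measurable_funM.
- by move=> w; rewrite mulr_ge0// sqr_ge0.
- by move=> w; rewrite divr_ge0// ltW.
have iY' : mean (fun w => Y w ^+ 2) = (n * p - n * (p * p))%:E := iY.
rewrite (mean_cst (c0 / 2)) (meanZ c2i mY2 (fun w => sqr_ge0 (Y w))) iY'.
rewrite -EFinM -EFinD lee_fin -/n -/c0.
have c0n : c0 != 0 by rewrite gt_eqF.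
have h1 : (2 * c0)^-1 * (n * p - n * (p * p)) <= (2 * c0)^-1 * n.
  rewrite ler_wpM2l ?invr_ge0 ?mulr_ge0 ?(ltW c00)//.
  have -> : n * p - n * (p * p) = n * (p - p * p) by ring.
  rewrite -[leRHS]mulr1 ler_wpM2l ?(ltW n0)//; nra.
apply: le_trans (lerD h1 (lexx _)) _.
by rewrite -c2 le_eqVlt; apply/orP; left; apply/eqP; field.
Qed.

Section counts.
Variable T : Omega -> nat.
Hypothesis mT : forall l, measurable [set w | (l < T w)%N].

Lemma measurable_count : measurable_fun setT (fun w => (T w)%:R : R).
Proof.
have lim w : \sum_(l < n) (\1_[set w | (l < T w)%N] w : R) @[n --> \oo] --> ((T w)%:R : R).
  apply: cvg_near_cst; exists (T w) => // n /= Tn.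
  have -> : n = (T w + (n - T w))%N by rewrite subnKC.
  rewrite big_split_ord/= [X in _ + X]big1 ?addr0.
    rewrite (eq_bigr (fun=> 1)) ?sumr_const ?card_ord// => i _.
    by rewrite indicE mem_set//=.
  by move=> i _; rewrite indicE memNset//= ltnNge leq_addr.
apply: (measurable_fun_cvg (h := fun n w => \sum_(l < n) (\1_[set w | (l < T w)%N] w : R))) => //.
  move=> n; apply: measurable_sum => l; exact: measurable_indic.
Qed.

Lemma layer_sum n w : \sum_(l < n) (\1_[set w | (l < T w)%N] w : R) = (minn n (T w))%:R.
Proof.
elim: n => [|n IH]; first by rewrite big_ord0 min0n.
rewrite big_ord_recr /= IH indicE; case: (ltnP n (T w)) => h.
  by rewrite mem_set//= (minn_idPl h) natr1.
by rewrite memNset/= ?addr0 ?(minn_idPr (leqW h))// ltnNge h.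
Qed.

Lemma mean_layers : mean (fun w => (T w)%:R) = (\sum_(0 <= l <oo) P [set w | (l < T w)%N])%E.
Proof.
rewrite /mean.
have -> : (\int[P]_w (T w)%:R%:E)%E =
    (\int[P]_w \sum_(0 <= l <oo) (\1_[set w | (l < T w)%N] w)%:E)%E.
  apply: eq_integral => w _; apply/esym/cvg_lim => //.
  apply: cvg_near_cst; exists (T w) => // n /= Tn.
  by rewrite big_mkord sumEFin layer_sum (minn_idPr Tn).
rewrite integral_nneseries//; last by move=> l; apply/measurable_EFinP; exact: measurable_indic.
by apply: eq_eseriesr => l _; rewrite -[LHS]/(mean _) mean_indic.
Qed.

End counts.

(** A count is the sum of the indicators of its layers, the events l < T.  The
    first K layers are treated one by one, and the others contribute at most
    twice their mean. *)
Lemma mean_dev_count (I : eqType) (s : seq I) (T : I -> Omega -> nat) (p : nat -> R)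
    (m : R) (K : nat) : uniq s ->
  (forall i l, i \in s -> measurable [set w | (l < T i w)%N]) ->
  (forall i l, i \in s -> P [set w | (l < T i w)%N] = (p l)%:E) ->
  (forall i j l, i \in s -> j \in s -> i != j ->
    P ([set w | (l < T i w)%N] `&` [set w | (l < T j w)%N]) = (p l * p l)%:E) ->
  (forall i, i \in s -> mean (fun w => (T i w)%:R) = m%:E) ->
  (mean (fun w => `|\sum_(i <- s) (T i w)%:R - (size s)%:R * m|%R) <=
    (K%:R * Num.sqrt (size s)%:R + 2 * (size s)%:R * (m - \sum_(l < K) p l))%:E)%E.
Proof.
move=> us mT pT ppT iT; pose n : R := (size s)%:R.
pose B l i := [set w | (l < T i w)%N].
pose dev l w : R := `|\sum_(i <- s) \1_(B l i) w - n * p l|.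
pose rest i w : R := (T i w)%:R - \sum_(l < K) \1_(B l i) w.
have mTi i : i \in s -> measurable_fun setT (fun w => (T i w)%:R : R).
  by move=> is_; apply: measurable_count => l; exact: mT.
have mlay i : i \in s -> measurable_fun setT (fun w => \sum_(l < K) (\1_(B l i) w : R)).
  by move=> is_; apply: measurable_sum => l; apply: measurable_indic; exact: mT.
have rest0 i w : 0 <= rest i w by rewrite /rest subr_ge0 layer_sum ler_nat geq_minr.
have mrest i : i \in s -> measurable_fun setT (rest i).
  by move=> is_; apply: measurable_funB; [exact: mTi|exact: mlay].
have Elay i : i \in s -> mean (fun w => \sum_(l < K) (\1_(B l i) w : R)) = (\sum_(l < K) p l)%:E.
  move=> is_; have [|//|-> _] := mean_sum (s := index_enum 'I_K) (f := fun l w => \1_(B l i) w).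
    by move=> l _; apply: measurable_indic; exact: mT.
  rewrite -sumEFin; apply: eq_bigr => l _; rewrite mean_indic ?pT//; exact: mT.
have Erest i : i \in s -> mean (rest i) = (m - \sum_(l < K) p l)%:E.
  move=> is_.
  have e : mean (fun w => (T i w)%:R : R) = (mean (fun w => \sum_(l < K) (\1_(B l i) w : R))%R + mean (rest i))%E.
    rewrite -meanD//; [|exact: mlay|exact: mrest|by move=> w; rewrite sumr_ge0].
    by congr mean; apply/funext => w; rewrite /rest addrC subrK.
  move: e; rewrite iT// Elay// addeC => e.
  have := congr1 (fun x => x - (\sum_(l < K) p l)%:E)%E e.
  by rewrite addeK// -EFinB => ->.
have [s0|s0] := posnP (size s).
  rewrite s0 sqrtr0 (_ : s = [::]); last exact: size0nil.
  rewrite (_ : (fun w => _) = cst 0); first by rewrite mean_cst mulr0 mulr0 mul0r addr0.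
  by apply/funext => w; rewrite big_nil mul0r subr0 normr0.
have [i0 i0s] : exists i, i \in s by case: (s) s0 => // i ? _; exists i; rewrite mem_head.
have tail0 : 0 <= m - \sum_(l < K) p l.
  by rewrite -lee_fin -(Erest i0 i0s); exact: mean_ge0.
have mS l : measurable_fun setT (fun w => \sum_(i <- s) (\1_(B l i) w : R)).
  have [||//] := @integral_sum_indic _ s (B l) (fun=> p l) => i is_; [exact: mT|exact: pT].
have mdev l : measurable_fun setT (dev l).
  by apply: measurableT_comp => //; exact: measurable_funB.
have Edev l : (mean (dev l) <= (Num.sqrt n)%:E)%E.
  apply: mean_dev_indic => // [i|i|i j] is_; [exact: mT|exact: pT|exact: ppT].
pose t := m - \sum_(l < K) p l.
have ptw w : `|\sum_(i <- s) (T i w)%:R - n * m| <=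
    \sum_(l < K) dev l w + (\sum_(i <- s) rest i w + n * t).
  have -> : \sum_(i <- s) (T i w)%:R - n * m =
      \sum_(l < K) (\sum_(i <- s) \1_(B l i) w - n * p l) + (\sum_(i <- s) rest i w - n * t).
    rewrite /rest !sumrB -mulr_sumr [X in _ = X - _ + _]exchange_big/= /t; ring.
  apply: le_trans (ler_normD _ _) _; apply: lerD; first exact: ler_norm_sum.
  apply: le_trans (ler_normB _ _) _; apply: lerD.
    by rewrite ger0_norm// sumr_ge0.
  by rewrite ger0_norm// mulr_ge0.
have [||Esum msum] := @mean_sum _ s rest.
- exact: mrest.
- by move=> i w _.
have [||Esumd msumd] := @mean_sum _ (index_enum 'I_K) (fun l w => dev l w).
- by move=> l _; exact: mdev.
- by move=> l w _; exact: normr_ge0.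
apply: (@le_trans _ _ (mean (fun w => \sum_(l < K) dev l w + (\sum_(i <- s) rest i w + n * t)))).
  apply: mean_le => [||w]; last by rewrite normr_ge0; exact: ptw.
    apply: measurableT_comp => //; apply: measurable_funB => //.
    by have [|//|_ ?] := @mean_sum _ s (fun i w => (T i w)%:R : R); first exact: mTi.
  by apply: measurable_funD => //; exact: measurable_funD.
rewrite meanD//; last 3 first.
- exact: measurable_funD.
- by move=> w; apply: sumr_ge0 => l _; exact: normr_ge0.
- by move=> w; rewrite addr_ge0 ?sumr_ge0 ?mulr_ge0.
rewrite meanD//; last 2 first.
- by move=> w; rewrite sumr_ge0.
- by move=> w; rewrite mulr_ge0.
rewrite (mean_cst (n * t)) Esum Esumd [X in (_ + (X + _))%E](_ : _ = (n * t)%:E); last first.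
  rewrite big_seq (eq_bigr (fun=> t%:E)) => [|i is_]; last exact: Erest.
  by rewrite -big_seq sumEFin big_const_seq count_predT iter_addr_0 mulr_natl.
apply: (@le_trans _ _ (\sum_(l < K) (Num.sqrt n)%:E + ((n * t)%:E + (n * t)%:E))%E).
  by apply: leeD => //; apply: lee_sum => l _; exact: Edev.
rewrite sumEFin sumr_const card_ord -!EFinD lee_fin -[_ *+ K]mulr_natl /t -/n.
by rewrite le_eqVlt; apply/orP; left; apply/eqP; ring.
Qed.

Lemma tail_small (m : nat -> R) (M : R) : (forall k, 0 <= m k) ->
  (forall K, \sum_(k < K) m k <= M) -> forall e : R, 0 < e ->
  exists K0, forall K, \sum_(k < K) (if (k < K0)%N then 0 else m k) <= e.
Proof.
move=> m0 mM e e0; pose S K := \sum_(k < K) m k.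
have hs : has_sup (range S).
  by split; [exists (S 0%N), 0%N|exists M => _ [K _ <-]; exact: mM].
have [_ [K0 _ <-] hK0] := sup_adherent e0 hs; exists K0 => K.
apply: (@le_trans _ _ (\sum_(k < K0 + K) (if (k < K0)%N then 0 else m k))).
  rewrite -(big_mkord xpredT (fun k => if (k < K0)%N then 0 else m k)).
  rewrite -[leRHS](big_mkord xpredT (fun k => if (k < K0)%N then 0 else m k)).
  rewrite [leRHS](@big_cat_nat _ _ _ K)//= ?leq_addl// lerDl sumr_ge0// => k _.
  by case: ifP.
have SE : S (K0 + K)%N = S K0 + \sum_(j < K) m (K0 + j)%N by rewrite /S big_split_ord.
rewrite big_split_ord/= big1 ?add0r => [|i _]; last by rewrite ltn_ord.
rewrite (eq_bigr (fun j : 'I_K => m (K0 + j)%N)) => [|j _]; last by rewrite ltnNge leq_addr.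
rewrite -(lerD2l (S K0)) -SE.
have : S (K0 + K)%N <= sup (range S) by apply: sup_upper_bound => //; exists (K0 + K)%N.
by move: hK0; lra.
Qed.

Lemma mean_dev_single (I : eqType) (T : I -> Omega -> nat) (p : nat -> R) (m : R) :
  (forall i l, measurable [set w | (l < T i w)%N]) ->
  (forall i l, P [set w | (l < T i w)%N] = (p l)%:E) ->
  (forall i j l, i != j ->
    P ([set w | (l < T i w)%N] `&` [set w | (l < T j w)%N]) = (p l * p l)%:E) ->
  (forall i, mean (fun w => (T i w)%:R) = m%:E) -> I ->
  forall c : R, 0 < c -> exists n0, forall s : seq I, (n0 <= size s)%N -> uniq s ->
    (mean (fun w => `|\sum_(i <- s) (T i w)%:R - (size s)%:R * m|%R) <=
      (c * (size s)%:R)%:E)%E.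
Proof.
move=> mT pT ppT iT i0 c c0.
have p0 l : 0 <= p l by rewrite -lee_fin -(pT i0).
have mp : \sum_(l < n) p l @[n --> \oo] --> m.
  have h : (\sum_(0 <= l < n) (p l)%:E)%E @[n --> \oo] --> m%:E.
    rewrite -(iT i0) mean_layers; last exact: mT.
    rewrite (eq_eseriesr (g := fun l => (p l)%:E)); last by move=> l _; exact: pT.
    by apply: is_cvg_nneseries => l _ _; rewrite lee_fin.
  rewrite (_ : (fun n => _) = fine \o (fun n => (\sum_(0 <= l < n) (p l)%:E)%E)).
    exact: ((fine_cvgP _ _).1 h).2.
  by apply/funext => j /=; rewrite sumEFin big_mkord.
have [N _ hN] : \forall n \near \oo, `|m - \sum_(l < n) p l| < c / 4.
  by move/cvgrPdist_lt : mp => /(_ _ (divr_gt0 c0 (ltr0n R 4))).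
have {hN} tailN : m - \sum_(l < N) p l <= c / 4.
  by apply: le_trans (ler_norm _) _; apply/ltW/hN => /=.
exists (Num.trunc ((2 * N%:R / c) ^+ 2)).+1 => s sn us.
apply: le_trans (mean_dev_count (p := p) (m := m) N us _ _ _ _) _.
- by move=> i l _; exact: mT.
- by move=> i l _; exact: pT.
- by move=> i j l _ _; exact: ppT.
- by move=> i _; exact: iT.
have n0 : 0 <= (size s)%:R :> R by [].
have hn : (2 * N%:R / c) ^+ 2 <= (size s)%:R.
  by apply/ltW/(lt_le_trans (truncnS_gt _)); rewrite ler_nat.
move: (size s)%:R n0 hn => n n0 hn; rewrite lee_fin.
have qn : Num.sqrt n * Num.sqrt n = n by rewrite -expr2 sqr_sqrtr.
have Nq : 2 * N%:R <= c * Num.sqrt n.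
  rewrite [leRHS]mulrC -ler_pdivrMr// -(@ler_pXn2r _ 2)// ?nnegrE//.
    by rewrite sqr_sqrtr.
  by rewrite divr_ge0 ?mulr_ge0// ltW.
have h1 : 2 * N%:R * Num.sqrt n <= c * n.
  by rewrite -{2}qn mulrA ler_wpM2r// sqrtr_ge0.
have h2 : 2 * n * (m - \sum_(l < N) p l) <= 2 * n * (c / 4).
  by rewrite ler_wpM2l// mulr_ge0.
move: h1 h2; move: (2 * n * (m - _)) (Num.sqrt n) (N%:R : R) => x y z; clear; lra.
Qed.

(** Used for the types k in the tail of a family of counts, where m is small. *)
Lemma mean_dev_crude (I : eqType) (T : I -> Omega -> nat) (m : R) (s : seq I) :
  (forall i l, measurable [set w | (l < T i w)%N]) ->
  (forall i, mean (fun w => (T i w)%:R) = m%:E) -> 0 <= m ->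
  (mean (fun w => `|\sum_(i <- s) (T i w)%:R - (size s)%:R * m|%R) <=
    (2 * (size s)%:R * m)%:E)%E.
Proof.
move=> mT iT m0.
have mTi i : measurable_fun setT (fun w => (T i w)%:R : R).
  by apply: measurable_count => l; exact: mT.
have [|//|ET mS] := @mean_sum _ s (fun i w => (T i w)%:R : R); first by move=> i _.
have nm0 : 0 <= (size s)%:R * m by rewrite mulr_ge0.
apply: (@le_trans _ _ (mean (fun w => \sum_(i <- s) (T i w)%:R + (size s)%:R * m))).
  apply: mean_le => [||w].
  - by apply: measurableT_comp => //; exact: measurable_funB.
  - exact: measurable_funD.
  - rewrite normr_ge0 (le_trans (ler_normB _ _))// [X in _ + X]ger0_norm// ger0_norm//.
    by rewrite sumr_ge0.
rewrite meanD//; last by move=> w; rewrite sumr_ge0.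
rewrite (mean_cst ((size s)%:R * m)) ET (eq_bigr (fun=> m%:E)) => [|i _]; last exact: iT.
rewrite sumEFin -EFinD lee_fin big_const_seq count_predT iter_addr_0 -[m *+ _]mulr_natl.
by rewrite le_eqVlt; apply/orP; left; apply/eqP; ring.
Qed.

Lemma uniform_rank (Q : nat -> nat -> Prop) :
  (forall k, exists n0, forall n, (n0 <= n)%N -> Q k n) ->
  forall K, exists n0, forall n, (n0 <= n)%N -> forall k, (k < K)%N -> Q k n.
Proof.
move=> h; elim=> [|K [n1 h1]]; first by exists 0%N.
have [n2 h2] := h K; exists (maxn n1 n2) => n; rewrite geq_max => /andP[n1n n2n] k.
by rewrite ltnS leq_eqVlt => /predU1P[->|kK]; [exact: h2|exact: h1].
Qed.

(** Tannery's argument: the means m k are summable, so finitely many k matter,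
    and for each of these finitely many layers matter. *)
Lemma mean_dev_family (I : eqType) (T : nat -> I -> Omega -> nat) (p : nat -> nat -> R)
    (m : nat -> R) (M : R) :
  (forall k i l, measurable [set w | (l < T k i w)%N]) ->
  (forall k i l, P [set w | (l < T k i w)%N] = (p k l)%:E) ->
  (forall k i j l, i != j ->
    P ([set w | (l < T k i w)%N] `&` [set w | (l < T k j w)%N]) = (p k l * p k l)%:E) ->
  (forall k i, mean (fun w => (T k i w)%:R) = (m k)%:E) ->
  (forall K, \sum_(k < K) m k <= M) -> I ->
  forall e : R, 0 < e -> exists n0, forall (s : seq I) K, (n0 <= size s)%N -> uniq s ->
    (\sum_(k < K) mean (fun w => `|\sum_(i <- s) (T k i w)%:R - (size s)%:R * m k|%R) <=
      (e * (size s)%:R)%:E)%E.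
Proof.
move=> mT pT ppT iT mM i0 e e0.
have m0 k : 0 <= m k by rewrite -lee_fin -(iT k i0); apply: mean_ge0.
have [K0 tailK] := tail_small m0 mM (divr_gt0 e0 (ltr0n R 4)).
have [c [c0 cK]] : exists c : R, 0 < c /\ K0%:R * c <= e / 2.
  exists (e / 2 / K0.+1%:R); split; first by rewrite !divr_gt0.
  by rewrite mulrA ler_pdivrMr// mulrC ler_wpM2l ?ler_nat// divr_ge0// ltW.
have [n1 hn1] := uniform_rank (Q := fun k n => forall s : seq I, size s = n -> uniq s ->
    (mean (fun w => `|\sum_(i <- s) (T k i w)%:R - (size s)%:R * m k|%R) <=
      (c * (size s)%:R)%:E)%E) (fun k => let: ex_intro n0 h0 :=
      mean_dev_single (mT k) (pT k) (ppT k) (iT k) i0 c0 in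
      ex_intro _ n0 (fun n nn s sn us => h0 s (eq_ind_r (fun x => n0 <= x)%N nn sn) us)) K0.
exists n1 => s K sn us.
pose n : R := (size s)%:R; have n0 : 0 <= n by [].
pose g k : R := (if (k < K0)%N then c * n else 0) + 2 * n * (if (k < K0)%N then 0 else m k).
apply: (@le_trans _ _ (\sum_(k < K) (g k)%:E)%E).
  apply: lee_sum => k _; rewrite /g; case: ltnP => kK.
    by rewrite mulr0 addr0; exact: (hn1 _ sn _ kK).
  by rewrite add0r; exact: mean_dev_crude.
rewrite sumEFin lee_fin big_split/= -mulr_sumr -/n.
have h1 : \sum_(k < K) (if (k < K0)%N then c * n else 0) <= K0%:R * c * n.
  have a0 : 0 <= c * n by rewrite mulr_ge0// ltW.
  have -> : \sum_(k < K) (if (k < K0)%N then c * n else 0) = (minn K K0)%:R * (c * n).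
    move: (K) => J; elim: J => [|j IH]; first by rewrite big_ord0 min0n mul0r.
    rewrite big_ord_recr/= IH; case: ltnP => jK.
      by rewrite (minn_idPl jK) -natr1 mulrDl mul1r.
    by rewrite (minn_idPr (leqW jK)) addr0.
  by rewrite -mulrA ler_wpM2r// ler_nat geq_minr.
have h2 : 2 * n * (\sum_(k < K) (if (k < K0)%N then 0 else m k)) <= 2 * n * (e / 4).
  by rewrite ler_wpM2l// mulr_ge0.
have h3 : K0%:R * c * n <= e / 2 * n by rewrite ler_wpM2r.
apply: le_trans (lerD (le_trans h1 h3) h2) _.
by rewrite le_eqVlt; apply/orP; left; apply/eqP; field.
Qed.

End lln.

(** * Counting lattice points in large balls *)

Lemma ncard_setT (T : finType) : ncard [set: T] = #|T|.
Proof.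
rewrite cardE; apply/perm_size/uniq_perm; [exact: fset_uniq|exact: enum_uniq|].
move=> x; rewrite mem_enum; have -> // : x \in fset_set [set: T].
rewrite in_fset_set ?in_setT//.
exact: finite_finset.
Qed.

Section lattice.
Context {R : realType} {d : nat}.
Local Notation V := 'rV[R]_d.
Local Notation lat := {ffun 'I_d -> int}.
Definition latball (rho : R) : set lat := [set k | edist 0 (lv k : V) <= rho].
Definition latc rho : nat := ncard (latball rho).

Lemma latball_coord rho k i : latball rho k -> `|(k i)%:~R| <= rho.
Proof.
by apply: le_trans; have := coord_le_edist 0 (lv k : V) i; rewrite !mxE sub0r normrN.
Qed.

Lemma latball_finite rho : finite_set (latball rho).
Proof.
pose N := (Num.trunc rho).+1.
apply: (@sub_finite_set _ _ ((fun e : {ffun 'I_d -> 'I_(N + N).+1} =>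
    [ffun i => (e i)%:Z - N%:Z] : lat) @` setT)); last by apply: finite_image.
move=> k kr; exists [ffun i => inord (absz (k i + N%:Z))] => //.
apply/ffunP => i; rewrite !ffunE.
have kN : (`|k i| < N)%N.
  rewrite -(ltr_nat R) natr_absz intr_norm; apply: le_lt_trans (latball_coord i kr) _.
  exact: truncnS_gt.
clearbody N; have h : (absz (k i + N%:Z)%R < (N + N).+1)%N by lia.
by rewrite inordK// gez0_abs ?addrK//; lia.
Qed.

Lemma latc_le rho rho' : rho <= rho' -> (latc rho <= latc rho')%N.
Proof. by move=> h; apply: ncard_le (latball_finite _) => k kr; exact: le_trans kr h. Qed.

Definition sqn (k : lat) : R := \sum_i (k i)%:~R ^+ 2.

Lemma latballE rho k : 0 <= rho -> latball rho k <-> sqn k <= rho ^+ 2.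
Proof.
move=> r0; rewrite /latball /= /edist.
have -> : \sum_(i < d) ((0 : V) 0 i - (lv k : V) 0 i) ^+ 2 = sqn k.
  by apply: eq_bigr => i _; rewrite !mxE sub0r sqrrN.
rewrite -(@ler_pXn2r _ 2)// ?nnegrE ?sqrtr_ge0// sqr_sqrtr// /sqn.
by apply: sumr_ge0 => i _; exact: sqr_ge0.
Qed.

Definition reduce (i : 'I_d) (t : nat) (k : lat) : lat :=
  [ffun j => if j == i then k i - sgz (k i) * t%:Z else k j].

Lemma reduce_int (x y : int) (t u : nat) : (t < `|x|)%N -> (u < `|y|)%N ->
  x - sgz x * t%:Z = y - sgz y * u%:Z -> (`|x| + u = `|y| + t)%N /\ sgz x = sgz y.
Proof. by case: (sgzP x) => hx; case: (sgzP y) => hy; lia. Qed.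

Lemma reduce_eq i t u (k k' : lat) : (t < `|k i|)%N -> (u < `|k' i|)%N ->
  reduce i t k = reduce i u k' ->
  [/\ (`|k i| + u = `|k' i| + t)%N, sgz (k i) = sgz (k' i) & forall j, j != i -> k j = k' j].
Proof.
move=> tk uk /ffunP e; have := e i; rewrite !ffunE eqxx => /(reduce_int tk uk)[e1 e2].
by split => // j ji; have := e j; rewrite !ffunE (negbTE ji).
Qed.

Lemma sqn_reduce i t (k : lat) : (t <= `|k i|)%N ->
  sqn (reduce i t k) = sqn k - `|k i|%N%:R ^+ 2 + (`|k i|%N%:R - t%:R) ^+ 2.
Proof.
move=> tk; rewrite /sqn (bigD1 i)//= [in RHS](bigD1 i)//= ffunE eqxx.
rewrite (eq_bigr (fun j => (k j)%:~R ^+ 2)) => [|j ji]; last by rewrite ffunE (negbTE ji).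
have -> : (k i - sgz (k i) * t%:Z)%:~R ^+ 2 = (`|k i|%N%:R - t%:R : R) ^+ 2.
  have -> : `|k i|%N%:R - t%:R = (absz (k i - sgz (k i) * t%:Z)%R)%:R :> R.
    rewrite -natrB//; congr _%:R.
    by case: (sgzP (k i)) tk; lia.
  by rewrite natr_absz intr_norm real_normK ?num_real.
have -> : (k i)%:~R ^+ 2 = (`|k i|%N%:R : R) ^+ 2.
  by rewrite natr_absz intr_norm real_normK ?num_real.
ring.
Qed.

Lemma sqn_diff i (k k' : lat) : (forall j, j != i -> k j = k' j) ->
  sqn k' - sqn k = `|k' i|%N%:R ^+ 2 - `|k i|%N%:R ^+ 2.
Proof.
move=> e; rewrite /sqn (bigD1 i)//= [in X in _ - X](bigD1 i)//=.
rewrite (eq_bigr (fun j => (k j)%:~R ^+ 2)) => [|j ji]; last by rewrite e.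
rewrite !natr_absz !intr_norm !real_normK ?num_real//; ring.
Qed.

Lemma latc_gt0 rho : 0 <= rho -> (0 < latc rho)%N.
Proof.
move=> r0; rewrite lt0n; apply/eqP => /(ncard_eq0 (latball_finite rho)) e.
suff : latball rho [ffun=> 0] by rewrite e.
by rewrite /latball /= (_ : lv _ = 0) ?edistxx//; apply/rowP => i; rewrite !mxE ffunE.
Qed.

Hypothesis d0 : (0 < d)%N.

(** A lattice point of the shell has a coordinate of size at least rho / d;
    pushing this coordinate towards 0 by m, 2 m, ..., J m gives J points of the
    ball, and all these points are distinct because the shell is thin. *)
Lemma shell_small (c : R) (J : nat) : 0 <= c -> exists rho0, forall rho, rho0 <= rho ->
  (J * latc (rho + c) <= (J + d) * latc rho)%N.
Proof.
move=> c0; pose m := (Num.trunc (d%:R * (2 * c + c ^+ 2))).+1.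
have dR : 0 < d%:R :> R by rewrite ltr0n.
have mc : d%:R * (2 * c + c ^+ 2) <= m%:R by apply/ltW; exact: truncnS_gt.
exists (1 + d%:R * (J * m).+1%:R) => rho hrho.
have r1 : 1 <= rho by apply: le_trans hrho; rewrite lerDl mulr_ge0.
have rJ : (J * m).+1%:R <= rho / d%:R.
  by rewrite ler_pdivlMr// mulrC; apply: le_trans hrho; rewrite lerDr.
pose a := rho / d%:R.
have a0 : 0 < a by rewrite divr_gt0//; lra.
have thin : (rho + c) ^+ 2 <= rho ^+ 2 + m%:R * a.
  have -> : (rho + c) ^+ 2 = rho ^+ 2 + (2 * c * rho + c ^+ 2) by ring.
  rewrite lerD2l; apply: (@le_trans _ _ ((2 * c + c ^+ 2) * rho)).
    by rewrite [leRHS]mulrDl lerD2l ler_peMr// sqr_ge0.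
  by rewrite /a mulrA ler_pdivlMr// -mulrA [rho * _]mulrC mulrA ler_wpM2r ?(le_trans ler01)// mulrC.
pose An i : set lat := [set k | [/\ sqn k <= (rho + c) ^+ 2, rho ^+ 2 < sqn k &
  a <= `|k i|%N%:R]].
have rc0 : 0 <= rho + c by lra.
have r0 : 0 <= rho by lra.
have fAn i : finite_set (An i).
  by apply: sub_finite_set (latball_finite (rho + c)) => k [kr _ _]; apply/latballE.
have big i k t : An i k -> (t <= J * m)%N -> (t < `|k i|)%N.
  move=> [_ _ ak] tJ; apply: leq_ltn_trans tJ _; rewrite -(ler_nat R).
  exact: le_trans ak.
have count i : (J * ncard (An i) <= latc rho)%N.
  pose F j := reduce i (m * j.+1) @` An i.
  have tle j : j \in iota 0 J -> (m * j.+1 <= J * m)%N.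
    by rewrite mem_iota add0n => /andP[_ jJ]; rewrite mulnC leq_mul2r jJ orbT.
  have far j j' k k' : j \in iota 0 J -> j' \in iota 0 J -> (j < j')%N ->
      An i k -> An i k' -> reduce i (m * j.+1) k <> reduce i (m * j'.+1) k'.
    move=> js j's jj kA k'A e.
    have [e1 _ e2] := reduce_eq (big _ _ _ kA (tle _ js)) (big _ _ _ k'A (tle _ j's)) e.
    have h : (`|k i| + m <= `|k' i|)%N.
      rewrite -(leq_add2r (m * j.+1)) -e1 -addnA leq_add2l addnC -mulnSr leq_mul2l.
      by rewrite ltnS jj orbT.
    case: kA k'A => _ k2 k3 [k'1 _ _].
    have := sqn_diff e2; rewrite subr_sqr => e3.
    have m0 : 0 < m%:R :> R by [].
    have h1 : m%:R <= `|k' i|%N%:R - `|k i|%N%:R :> R.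
      by rewrite lerBrDl -natrD ler_nat.
    have h2 : m%:R * (a + a) <= (`|k' i|%N%:R - `|k i|%N%:R) * (`|k' i|%N%:R + `|k i|%N%:R).
      apply: ler_pM; rewrite ?addr_ge0 ?(ltW a0) ?(ltW m0)//; apply: lerD => //.
      by apply: le_trans k3 _; rewrite ler_nat (leq_trans _ h)// leq_addr.
    have ma : 0 < m%:R * a by rewrite mulr_gt0.
    lra.
  have -> : (J * ncard (An i) = \sum_(j <- iota 0 J) ncard (F j))%N.
    rewrite big_seq (eq_bigr (fun=> ncard (An i))) => [|j js].
      by rewrite -big_seq big_const_seq count_predT size_iota iter_addn_0 mulnC.
    apply: ncard_image => // k k' /set_mem kA /set_mem k'A e.
    have [e1 e2 e3] := reduce_eq (big _ _ _ kA (tle _ js)) (big _ _ _ k'A (tle _ js)) e.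
    apply/ffunP => j'; have [->|/e3//] := eqVneq j' i.
    by rewrite (intEsg (k i)) (intEsg (k' i)) e2 (addIn e1).
  rewrite -ncard_bigcup ?iota_uniq//.
  - apply: ncard_le (latball_finite _) => _ [j /= js [k kA <-]].
    apply/latballE => //; rewrite sqn_reduce; last exact/ltnW/(big _ _ _ kA)/tle.
    have tk := ltnW (big _ _ _ kA (tle _ js)); case: kA => k1 _ k3.
    have t1 : (m * j.+1)%:R <= `|k i|%N%:R :> R by rewrite ler_nat.
    have t2 : m%:R <= (m * j.+1)%:R :> R by rewrite ler_nat leq_pmulr.
    have h1 : m%:R * a <= (m * j.+1)%:R * `|k i|%N%:R.
      by apply: ler_pM => //; exact: ltW.
    have h2 : (m * j.+1)%:R * (m * j.+1)%:R <= (m * j.+1)%:R * `|k i|%N%:R :> R.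
      by rewrite ler_wpM2l.
    move: h1 h2 k1 thin; clear; move: ((m * j.+1)%:R : R) => t; rewrite !expr2; lra.
  - by move=> j _; exact: finite_image.
  - move=> j j' js j's [_ [[k kA <-] [k' k'A e]]].
    case: (ltngtP j j') => // jj; exfalso.
      exact: (far _ _ _ _ js j's jj kA k'A (esym e)).
    exact: (far _ _ _ _ j's js jj k'A kA e).
have cover : latball (rho + c) `<=` latball rho `|` \bigcup_(i in [set` index_enum 'I_d]) An i.
  move=> k kr; have [ks|ks] := leP (sqn k) (rho ^+ 2); first by left; apply/latballE.
  right; have [[i ki]|nk] := pselect (exists i, a <= `|k i|%N%:R).
    by exists i; rewrite /= ?mem_index_enum//; split => //; apply/latballE.
  exfalso; move: ks; rewrite ltNge => /negP; apply; apply/latballE => //.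
  rewrite /latball /= (_ : rho = d%:R * a); last by rewrite /a mulrC divfK// gt_eqF.
  apply: edist_le_coord => i; rewrite !mxE sub0r normrN -intr_norm -natr_absz.
  by rewrite leNgt; apply/negP => h; apply: nk; exists i; exact: ltW.
have fU : finite_set (\bigcup_(i in [set` index_enum 'I_d]) An i).
  by apply: bigcup_finite => // i _; exact: fAn.
have h1 : (latc (rho + c) <= latc rho + \sum_(i <- index_enum 'I_d) ncard (An i))%N.
  apply: leq_trans (ncard_le cover _) _.
    by rewrite finite_setU; split => //; exact: latball_finite.
  apply: leq_trans (ncardU_le (latball_finite _) fU) _.
  by rewrite leq_add2l; exact: ncard_bigcup_le.
have h2 : (\sum_(i <- index_enum 'I_d) J * ncard (An i) <= d * latc rho)%N.
  apply: leq_trans (leq_sum _ (fun i _ => count i)) _.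
  by rewrite sum_nat_const card_ord.
rewrite mulnDl; apply: leq_trans (leq_mul (leqnn J) h1) _.
by rewrite mulnDr leq_add2l big_distrr.
Qed.

Lemma shell_ratio (c e : R) : 0 <= c -> 0 < e -> exists rho0, forall rho, rho0 <= rho ->
  (1 - e) * (latc (rho + c))%:R <= (latc rho)%:R.
Proof.
move=> c0 e0; pose J := (Num.trunc (d%:R / e)).+1.
have [rho0 h] := shell_small J c0; exists rho0 => rho /h.
rewrite -(ler_nat R) !natrM natrD => hJ.
have J0 : 0 < J%:R :> R by [].
have de : d%:R <= J%:R * e by rewrite -ler_pdivrMr//; apply/ltW; exact: truncnS_gt.
have l0 : 0 <= (latc rho)%:R :> R by [].
have h1 : J%:R * (latc (rho + c))%:R <= J%:R * ((1 + e) * (latc rho)%:R).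
  apply: le_trans hJ _; rewrite mulrA mulrDr mulr1 ler_wpM2r// lerD2l//.
rewrite (ler_pM2l J0) in h1.
have [e1|e1] := leP 1 e.
  by apply: le_trans l0; rewrite mulr_le0_ge0// subr_le0.
apply: le_trans (_ : (1 - e) * ((1 + e) * (latc rho)%:R) <= _).
  by rewrite ler_wpM2l// subr_ge0 ltW.
rewrite mulrA -[leRHS]mul1r ler_wpM2r//; nra.
Qed.

End lattice.

(** * Proportion of a large ball covered by blocks *)

Section grid.
Context {R : realType} {d : nat}.
Local Notation V := 'rV[R]_d.
Local Notation lat := {ffun 'I_d -> int}.
Local Notation latc := (@latc R d).
Definition subgrid (L o M : nat) (z : lat) : set lat :=
  [set k | forall i, L%:Z * z i + o%:Z <= k i < L%:Z * z i + o%:Z + M%:Z].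

Lemma subgrid_card L o M z :
  finite_set (subgrid L o M z) /\ ncard (subgrid L o M z) = (M ^ d)%N.
Proof.
pose f (e : {ffun 'I_d -> 'I_M}) : lat := [ffun i => L%:Z * z i + o%:Z + (e i)%:Z].
have -> : subgrid L o M z = f @` setT.
  apply/seteqP; split => [k kz|_ [e _ <-] i]; last by rewrite ffunE; have := ltn_ord (e i); lia.
  have kM i : (absz (k i - (L%:Z * z i + o%:Z))%R < M)%N by have := kz i; lia.
  exists [ffun i => Ordinal (kM i)] => //; apply/ffunP => i; rewrite !ffunE /=.
  by rewrite gez0_abs ?[_ + (_ - _)]addrC ?subrK//; have := kz i; lia.
have fT : finite_set [set: {ffun 'I_d -> 'I_M}] by exact: finite_finset.
split; first exact: finite_image.
rewrite ncard_image//; first by rewrite ncard_setT card_ffun !card_ord.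
move=> e e' _ _ /ffunP ee; apply/ffunP => i; apply: val_inj.
by have := ee i; rewrite !ffunE /=; lia.
Qed.

Lemma subgrid_disj L o M z z' : (o + M <= L)%N ->
  subgrid L o M z `&` subgrid L o M z' !=set0 -> z = z'.
Proof.
move=> oL [k [kz kz']]; apply/ffunP => i; have := kz i; have := kz' i.
move: (z i) (z' i) (k i) => x y t.
case: (ltgtP x y) => // xy.
  have : L%:Z * (x + 1) <= L%:Z * y by rewrite ler_wpM2l//; lia.
  by rewrite mulrDr mulr1; lia.
have : L%:Z * (y + 1) <= L%:Z * x by rewrite ler_wpM2l//; lia.
by rewrite mulrDr mulr1; lia.
Qed.

Lemma grid_card (J : {fset lat}) L o M : (o + M <= L)%N ->
  ncard (\bigcup_(z in [set` J]) subgrid L o M z) = (#|` J| * M ^ d)%N.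
Proof.
move=> oL; rewrite ncard_bigcup.
- rewrite (eq_bigr (fun=> M ^ d)%N) => [|z _]; last by have [_ ->] := subgrid_card L o M z.
  by rewrite big_const_seq count_predT iter_addn_0 mulnC.
- exact: fset_uniq.
- by move=> z _; have [] := subgrid_card L o M z.
- by move=> z z' _ _; exact: subgrid_disj.
Qed.

Lemma edist_box (a x : V) (l : R) : box a l x -> edist a x <= d%:R * l.
Proof.
by move=> xa; apply: edist_le_coord => i; have := xa i; rewrite ler_norml; lra.
Qed.

Lemma subgrid_near L z k : subgrid L 0 L z k -> edist (org L z) (lv k : V) <= d%:R * L%:R.
Proof.
move=> kz; apply: edist_box => i; rewrite !mxE; have := kz i; rewrite addr0 => /andP[k1 k2].
rewrite -[L%:R]/(L%:Z%:~R : R) -intrM -intrD ler_int ltr_int; lia.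
Qed.

Definition blocks_in L (rho : R) : {fset lat} :=
  fset_set [set z | edist 0 (org L z : V) <= rho].

Lemma blocks_inP L rho z : (0 < L)%N -> z \in blocks_in L rho <-> edist 0 (org L z : V) <= rho.
Proof.
move=> L0; rewrite in_fset_set; last first.
  apply: sub_finite_set (@latball_finite R d rho) => k /=; apply: le_trans.
  have -> : org L k = L%:R *: (lv k : V) by apply/rowP => i; rewrite !mxE.
  rewrite -[X in _ <= edist X _](scaler0 _ (L%:R : R)) edistZ ger0_norm// ler_peMl ?edist_ge0//.
  by rewrite ler1n.
by split => [/set_mem|/mem_set].
Qed.

Lemma block_cells L rho : (0 < L)%N ->
  (latc (rho - d%:R * L%:R) <= #|` blocks_in L rho| * L ^ d <= latc (rho + d%:R * L%:R))%N.
Proof.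
move=> L0; rewrite -(@grid_card _ L 0)//.
have fin : finite_set (\bigcup_(z in [set` blocks_in L rho]) subgrid L 0 L z).
  by apply: bigcup_finite => // z _; have [] := subgrid_card L 0 L z.
apply/andP; split; apply: ncard_le => //; last 2 first.
- move=> k [z /= /(blocks_inP _ _ L0) zr kz]; rewrite /latball /=.
  by apply: le_trans (edistD _ (org L z) _) _; apply: lerD => //; exact: subgrid_near.
- exact: latball_finite.
move=> k kr; pose z : lat := [ffun i => (k i %/ L%:Z)%Z].
have kz : subgrid L 0 L z k.
  move=> i; rewrite ffunE; have := divz_eq (k i) L%:Z.
  have L0' : L%:Z != 0 by lia.
  have := modz_ge0 (k i) L0'; have := ltz_mod (k i) L0'.
  move: (k i) => t; move: (t %/ L%:Z)%Z (t %% L%:Z)%Z => q m; rewrite [q * _]mulrC; lia.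
exists z => //=; apply/blocks_inP => //.
apply: le_trans (edistD _ (lv k) _) _.
have := subgrid_near kz; rewrite edistC; move: kr; rewrite /latball /=; lra.
Qed.

Lemma inner_of_near (alpha r : R) (x : V) : edist 0 x + alpha < r -> inner alpha r x.
Proof.
move=> xr y /= xy; apply: (filterS (P := [set u : V | edist 0 u < r])).
  by move=> u /= /ltW.
apply: open_nbhs_nbhs; split; last first.
  by apply: le_lt_trans xr; apply: le_trans (edistD _ x _) _; rewrite lerD2l.
have -> : [set u : V | edist 0 u < r] = (edist (0 : V)) @^-1` [set t | t < r] by [].
apply: open_comp; last exact: open_lt.
by move=> u _; exact: continuous_edistr.
Qed.

(** A unit cell is inside the core of a block, which is open, when its corner is in
    this subgrid: hence the offset h.+1 and the length L - h.*2.+1. *)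
Definition badcells L h (J : {fset lat}) (rho : R) : set lat :=
  latball rho `\` \bigcup_(z in [set` J]) subgrid L h.+1 (L - h.*2.+1) z.

Lemma badcells_finite L h J rho : finite_set (badcells L h J rho).
Proof. by apply: sub_finite_set (@latball_finite R d rho); exact: subDsetl. Qed.

Lemma badpts_cells (X G : set V) L h (J : {fset lat}) r :
  (h.*2.+1 <= L)%N -> (forall a l, finite_set (X `&` box a l)) -> G `<=` eball 0 r ->
  (ncard (badpts X L h G J) <=
    \sum_(k <- fset_set (badcells L h J (r + d%:R))) npoints X (box (lv k) 1))%N.
Proof.
move=> hL fX Gr; pose s := fset_set (badcells L h J (r + d%:R)).
apply: (@leq_trans (ncard (\bigcup_(k in [set` s]) (X `&` box (lv k) 1)))); last first.
  by apply: ncard_bigcup_le.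
apply: ncard_le; last by apply: bigcup_finite => // k _; exact: fX.
move=> p [[Xp Gp] np]; pose k : lat := [ffun i => Num.floor (p 0 i)].
have pk : box (lv k) 1 p.
  by move=> i; rewrite mxE ffunE -[X in _ + X]/(1%:~R) -intrD ge_floor floorD1_gt.
exists k => //=; rewrite /s in_fset_set; last exact: badcells_finite.
apply/mem_set; split.
  rewrite /latball /=; apply: le_trans (edistD _ p _) _.
  by apply: lerD; [exact: Gr|rewrite edistC -[leRHS]mulr1; exact: edist_box].
move=> [z /= zJ kz]; apply: np; exists z => // i; rewrite mxE.
have := pk i; rewrite mxE => /andP[p1 p2]; have /andP[k1 k2] := kz i.
have [l1 l2] : L%:Z * z i + h%:Z + 1 <= k i /\ k i + 1 <= L%:Z * z i + L%:Z - h%:Z.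
  have /andP[] := kz i; move: (k i) (z i) => u v; move: (L%:Z * v) => t; split; lia.
move: l1 l2; rewrite -2!(ler_int R) intrB !intrD intrM => l1 l2.
by apply/andP; split; [move: l1 p1|move: l2 p2]; clear; lra.
Qed.

Hypothesis d0 : (0 < d)%N.

(** Blocks that are too close to the boundary of the ball are discarded; by
    shell_ratio their cells are a small proportion of all cells. *)
Lemma blocks_density L h (alpha e : R) : (h.*2.+1 <= L)%N -> 0 <= alpha -> 0 < e ->
  exists r0, forall r, r0 <= r -> exists J : {fset lat},
  [/\ forall z, z \in J -> core L h z `<=` (inner alpha r : set V),
      (1 - e) * (latc (r + d%:R))%:R <= (#|` J| * L ^ d)%:R,
      (#|` J| * L ^ d <= latc (r + d%:R))%N &
      (ncard (badcells L h J (r + d%:R)) + #|` J| * (L - h.*2.+1) ^ d =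
        latc (r + d%:R))%N].
Proof.
move=> hL a0 e0; have L0 : (0 < L)%N by apply: leq_trans hL.
have [c cE] : exists c : R, d%:R * L%:R = c by exists (d%:R * L%:R).
have c0 : 0 <= c by rewrite -cE mulr_ge0.
have [|rho0 hr] := shell_ratio d0 (c := 2 * c + alpha + 1 + d%:R) _ e0.
  by rewrite !addr_ge0// mulr_ge0.
exists (rho0 + 2 * c + alpha + 1) => r rr.
have d1 : (0 : R) <= d%:R by [].
exists (blocks_in L (r - c - alpha - 1)).
have /andP[B1 B2] := block_cells (r - c - alpha - 1) L0.
have B2' : (#|` blocks_in L (r - c - alpha - 1)| * L ^ d <= latc (r + d%:R))%N.
  apply: leq_trans B2 _; apply: latc_le; rewrite cE; lra.
split => //.
- move=> z /(blocks_inP _ _ L0) zr x /core_block xz; apply: inner_of_near.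
  have := edistD 0 (org L z) x; have := edist_box xz; rewrite cE; lra.
- have := hr (r - c - alpha - 1 - c).
  rewrite (_ : r - c - alpha - 1 - c + (2 * c + alpha + 1 + d%:R) = r + d%:R); last by ring.
  move=> h1; apply: le_trans (h1 _) _; first by lra.
  by move: B1; rewrite cE ler_nat.
- set J := blocks_in _ _; pose I := \bigcup_(z in [set` J]) subgrid L h.+1 (L - h.*2.+1) z.
  have IJ : I `<=` latball (r + d%:R).
    move=> k [z /= /(blocks_inP _ _ L0) zr kz]; rewrite /latball /=.
    have kz' : subgrid L 0 L z k by move=> i; have := kz i; lia.
    apply: le_trans (edistD _ (org L z) _) _.
    by apply: le_trans (lerD zr (subgrid_near kz')) _; rewrite cE; lra.
  rewrite -(@grid_card J L h.+1); last by lia.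
  rewrite -/I -ncardU; first by rewrite /badcells setUC setDUK.
  + exact: badcells_finite.
  + exact: sub_finite_set IJ (@latball_finite R d _).
  + by rewrite /badcells setDE -setIA [X in _ `&` X]setIC setICr setI0.
Qed.

End grid.

(** * Counting the clusters of each type *)

(** The ball of radius alpha around p reaches distance edist 0 p + alpha from
    the origin. *)
Lemma innerE (R : realType) (d : nat) (alpha r : R) (p : 'rV[R]_d) : (0 < d)%N ->
  0 <= alpha -> inner alpha r p <-> edist 0 p + alpha < r.
Proof.
case: d p => // d p _ a0; split; last exact: inner_of_near.
move=> pin; have [u [u1 pu]] : exists u : 'rV[R]_d.+1, edist 0 u = 1 /\ p = edist 0 p *: u.
  have [p0|p0] := eqVneq (edist 0 p) 0.
    exists (delta_mx 0 0); rewrite p0 scale0r; split.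
      rewrite /edist (bigD1 ord0)//= big1 => [|i i0].
        by rewrite !mxE eqxx sub0r sqrrN expr1n addr0 sqrtr1.
      by rewrite !mxE (negbTE i0) andbF subr0 expr0n.
    apply/rowP => i; rewrite !mxE; apply/eqP; rewrite -normr_le0.
    by have := coord_le_edist 0 p i; rewrite p0 mxE sub0r normrN.
  exists ((edist 0 p)^-1 *: p); rewrite scalerA mulfV// scale1r; split => //.
  rewrite -[X in edist X _](scaler0 _ (edist 0 p)^-1) edistZ ger0_norm ?invr_ge0 ?edist_ge0//.
  by rewrite mulVf.
pose t0 := edist 0 p + alpha.
have : (eball 0 r)^° (t0 *: u).
  have e : t0 *: u - p = alpha *: u by rewrite /t0 scalerDl -pu addrC addKr.
  apply: pin; rewrite /eball /= -(edist_shift _ _ (- p)) subrr e.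
  by rewrite -[X in edist X _](scaler0 _ alpha) edistZ u1 mulr1 ger0_norm.
move=> /(@scalel_continuous R _ u t0) [e /= e0 he].
have := he (t0 + e / 2); rewrite /= opprD addrA subrr sub0r normrN gtr0_norm ?divr_gt0//.
have e2 : e / 2 < e by rewrite ltr_pdivrMr// mulr_natr mulr2n ltrDl.
move=> /(_ e2); rewrite /eball /= -[X in edist X _](scaler0 _ (t0 + e / 2)) edistZ u1 mulr1.
have t00 : 0 <= t0 by rewrite addr_ge0// edist_ge0.
rewrite ger0_norm; last by rewrite addr_ge0// divr_ge0// ltW.
by apply: lt_le_trans; rewrite ltrDl divr_gt0.
Qed.

Lemma block_disj (R : realType) (d L : nat) (z z' : {ffun 'I_d -> int}) :
  z != z' -> block L z `&` block L z' = set0 :> set 'rV[R]_d.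
Proof.
move=> zz'; apply/seteqP; split => // x [xz xz']; apply: (negP zz'); apply/eqP/ffunP => i.
have := xz i; have := xz' i; rewrite !mxE => /andP[n1 n2] /andP[n3 n4].
have cmp (u v : int) : u < v -> L%:R * u%:~R + L%:R <= L%:R * v%:~R :> R.
  move=> uv; have uv1 : u + 1 <= v by lia.
  by rewrite -[X in _ + X]mulr1 -mulrDr ler_wpM2l// -[X in _ + X]/(1%:~R) -intrD ler_int.
case: (ltgtP (z i) (z' i)) => // /cmp c; exfalso; lra.
Qed.

Section typed_counts.
Context {R : realType} {d : nat} {dO : measure_display} {Omega : measurableType dO}.
Variables (P : probability Omega R) (X : Omega -> set 'rV[R]_d).
Hypothesis hX : poisson_process P X.
Local Notation V := 'rV[R]_d.
Local Notation lat := {ffun 'I_d -> int}.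
Local Notation mean := (mean P).
Hypothesis d0 : (0 < d)%N.
Variable alpha : R.
Hypothesis a0 : 0 <= alpha.
Variable code : gclass R d -> nat.

Definition typed k : set (gclass R d) := [set g | code g = k].

(** A box that contains all points linked to points of the inner region turns the
    counts into an approximable property of the configuration in that box. *)
Lemma window_measurable r (Psi : (set (gclass R d) -> nat) -> Prop) :
  measurable [set w | Psi (ncl (X w) alpha (inner alpha r))].
Proof.
pose c : R := `|r| + 2 * alpha + 1.
have c0 : 0 < c by rewrite ltr_wpDl// addr_ge0// mulr_ge0.
pose a : V := \row__ (- c).
have c20 : 0 < 2 * c by rewrite mulr_gt0.
have oG : open [set x : V | inner alpha r (x + a)].
  have -> : [set x : V | inner alpha r (x + a)] =
      (edist (- a)) @^-1` [set t | t < r - alpha].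
    apply/seteqP; split => x /=; rewrite ltrBrDr -(edist_shift _ _ a) addNr;
      by move=> /(innerE _ _ d0 a0).
  apply: open_comp; last exact: open_lt.
  by move=> u _; exact: continuous_edistr.
have -> : [set w | Psi (ncl (X w) alpha (inner alpha r))] =
    [set w | Psi (ncl (local_config a (2 * c) (X w)) alpha [set x | inner alpha r (x + a)])].
  apply/funext => w /=; congr Psi; apply/funext => A; apply: ncl_window => //.
    exact: (finite_in_box hX).
  move=> p q /(inner_bounded a0) pr pq i; have := meet_coord i pq.
  have := coord_le_edist 0 p i; rewrite !mxE sub0r normrN => pi.
  have {pr}pi : `|p 0 i| <= `|r| by apply: le_trans pi (le_trans pr (ler_norm _)).
  move: pi; rewrite !ler_norml /c; lra.
exact: (approximable_measurable hX a c20 (approximable_ncl alpha Psi c20 oG)).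
Qed.

Lemma sum_typed (Y G : set V) K : finite_set (Y `&` G) ->
  (\sum_(k < K) ncl Y alpha G (typed k) <= ncard (Y `&` G))%N.
Proof.
move=> fY.
pose h := (Num.trunc (2 * alpha)).+1.
have ah : 2 * alpha <= h%:R by apply/ltW; exact: truncnS_gt.
have -> : (\sum_(k < K) ncl Y alpha G (typed k) =
    \sum_(k < K) ncard (badcl Y alpha 0 h G fset0 (typed k)))%N.
  by apply: eq_bigr => k _; rewrite /badcl set_fset0 bigcup_set0 setD0.
have bd := @badcl_types R d Y alpha 0 h G fset0 fY a0 ah typed K.
apply: leq_trans (bd _) _ => //.
- by move=> i j [g []]; rewrite /typed /= => <- <-.
- by apply: ncard_le => // x [].
Qed.

Section block_counts.
Variables (L h : nat).
Hypothesis L0 : (0 < L)%N.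
Hypothesis ah : 2 * alpha <= h%:R.

Definition block_count k (z : lat) w : nat := ncl (X w) alpha (core L h z) (typed k).

Let F k l (Z : set V) := (l < ncl Z alpha (core L h 0%R) (typed k))%N.

Let LR : 0 < L%:R :> R. Proof. by rewrite ltr0n. Qed.

Let Fapprox k l : approximable L%:R (F k l).
Proof.
exact: (@approximable_ncl R d L%:R alpha _ (fun c => (l < c (typed k))%N) LR (@open_core R d L h 0%R)).
Qed.

Let FE k l z : [set w | (l < block_count k z w)%N] = [set w | F k l (local_config (org L z) L%:R (X w))].
Proof.
apply/funext => w /=; rewrite /block_count ncl_core// => a l'; exact: (finite_in_box hX).
Qed.

Lemma block_count_measurable k z l : measurable [set w | (l < block_count k z w)%N].
Proof. by rewrite FE; exact: (approximable_measurable hX (org L z) LR (Fapprox k l)). Qed.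

Lemma block_count_law k z z' l :
  P [set w | (l < block_count k z w)%N] = P [set w | (l < block_count k z' w)%N].
Proof. by rewrite !FE; exact: (approximable_law hX (org L z) (org L z') LR (Fapprox k l)). Qed.

Lemma block_count_indep k z z' l : z != z' ->
  P ([set w | (l < block_count k z w)%N] `&` [set w | (l < block_count k z' w)%N]) =
  (P [set w | (l < block_count k z w)%N] * P [set w | (l < block_count k z' w)%N])%E.
Proof.
move=> zz'; rewrite !FE; apply: (approximable_indep hX LR (Fapprox k l) (Fapprox k l)).
exact: block_disj.
Qed.

Definition block_mean k : R := fine (mean (fun w => (block_count k 0 w)%:R)).

Lemma mean_block_sum z K : (\sum_(k < K) mean (fun w => (block_count k z w)%:R) <=
  (@mean_bound R d L%:R)%:E)%E.
Proof.
have mT k : measurable_fun setT (fun w => (block_count k z w)%:R : R).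
  by apply: measurable_count => l; exact: block_count_measurable.
have [|//|<- mS] := @mean_sum _ _ _ P _ (index_enum 'I_K) (fun k w => (block_count k z w)%:R : R).
  by move=> k _.
apply: le_trans (mean_npoints hX (org L z) d0 LR); apply: mean_le => //.
  apply/measurable_EFinP; exact: (measurable_npoints hX (bounded_borel_box _ _)).
move=> w; rewrite sumr_ge0//= -natr_sum ler_nat.
apply: leq_trans (sum_typed _ _) _.
  by apply: sub_finite_set (finite_in_box hX w (org L z) L%:R) => x [? /core_block].
by apply: ncard_le; [move=> x [? /core_block]|exact: (finite_in_box hX)].
Qed.

Lemma block_meanE k z : mean (fun w => (block_count k z w)%:R) = (block_mean k)%:E.
Proof.
have -> : mean (fun w => (block_count k z w)%:R) = mean (fun w => (block_count k 0 w)%:R).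
  rewrite !mean_layers; try by [move=> l; exact: block_count_measurable].
  by apply: eq_eseriesr => l _; exact: block_count_law.
apply: (mean_fin_le (r := @mean_bound R d L%:R)) => //.
apply: le_trans (mean_block_sum 0 k.+1); rewrite big_ord_recr/= leeDr//.
by apply: sume_ge0 => j _; exact: mean_ge0.
Qed.

Lemma block_mean_ge0 k : 0 <= block_mean k.
Proof. by rewrite -lee_fin -(block_meanE k 0); exact: mean_ge0. Qed.

Lemma block_mean_sum K : \sum_(k < K) block_mean k <= @mean_bound R d L%:R.
Proof.
rewrite -lee_fin -sumEFin; apply: le_trans (mean_block_sum 0 K).
by apply: lee_sum => k _; rewrite block_meanE.
Qed.

Lemma block_lln (e : R) : 0 < e -> exists n0, forall (s : seq lat) K,
  (n0 <= size s)%N -> uniq s ->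
  (\sum_(k < K) mean (fun w => `|\sum_(z <- s) (block_count k z w)%:R - (size s)%:R * block_mean k|%R)
    <= (e * (size s)%:R)%:E)%E.
Proof.
pose p k l := fine (P [set w | (l < block_count k 0%R w)%N]).
have pE k z l : P [set w | (l < block_count k z w)%N] = (p k l)%:E.
  by rewrite (block_count_law _ _ (0 : lat)) /p fineK// fin_num_measure//; exact: block_count_measurable.
apply: (mean_dev_family (p := p) (M := @mean_bound R d L%:R)).
- exact: block_count_measurable.
- exact: pE.
- by move=> k z z' l zz'; rewrite block_count_indep// !pE.
- exact: block_meanE.
- exact: block_mean_sum.
- exact: 0.
Qed.

End block_counts.

End typed_counts.

(** * Limits of the densities of the types *)

Section l1_limit.
Context {R : realType} {dO : measure_display} {Omega : measurableType dO}.
Variable P : probability Omega R.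
Local Notation mean := (mean P).
Variable f : nat -> R -> Omega -> R.
Implicit Types (D : nat -> R) (e : R).
Hypothesis mf : forall k r, measurable_fun setT (f k r).

Definition dist (D : nat -> R) K r w : R := \sum_(k < K) `|f k r w - D k|.

Lemma dist_ge0 D K r w : 0 <= dist D K r w.
Proof. by rewrite sumr_ge0. Qed.

Lemma measurable_dist D K r : measurable_fun setT (dist D K r).
Proof.
by apply: measurable_sum => k; apply: measurableT_comp => //; exact: measurable_funB.
Qed.

(** A bound that is uniform in K stands for the infinite sum over all k. *)
Definition l1_close (D : nat -> R) (e : R) : Prop :=
  exists r0, forall r, r0 <= r -> forall K, (mean (dist D K r) <= e%:E)%E.

Lemma l1_close_near (D D' : nat -> R) (e e' : R) K : l1_close D e -> l1_close D' e' ->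
  \sum_(k < K) `|D k - D' k| <= e + e'.
Proof.
move=> [r hr] [r' hr']; pose s := Num.max r r'.
rewrite -lee_fin EFinD -(mean_cst P).
apply: le_trans (leeD (hr s _ K) (hr' s _ K)); try by rewrite le_max lexx ?orbT.
rewrite -meanD; try by [exact: measurable_dist|move=> w; exact: dist_ge0].
apply: mean_le => [||w]; first exact: measurable_cst.
  by apply: measurable_funD; exact: measurable_dist.
rewrite sumr_ge0//= /dist -big_split/= ler_sum// => k _.
by rewrite (distrC (f k s w) (D k)); exact: ler_distD.
Qed.

Lemma l1_close_trans (D D' : nat -> R) (e e' : R) : l1_close D e ->
  (forall K, \sum_(k < K) `|D k - D' k| <= e') -> l1_close D' (e + e').
Proof.
move=> [r0 hr] h; exists r0 => r rr K.
have e'0 : 0 <= e' by have := h 0%N; rewrite big_ord0.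
apply: (@le_trans _ _ (mean (fun w => dist D K r w + cst e' w))).
  apply: mean_le => [||w]; first exact: measurable_dist.
    by apply: measurable_funD => //; exact: measurable_dist.
  rewrite dist_ge0/=; apply: le_trans (lerD (lexx _) (h K)).
  by rewrite /dist -big_split/= ler_sum// => k _; exact: ler_distD.
rewrite meanD//; try by [exact: measurable_dist|move=> w; exact: dist_ge0].
by rewrite mean_cst EFinD leeD//; exact: hr.
Qed.

Lemma cauchy_limit (u v : nat -> R) : (forall n m, `|u n - u m| <= v n + v m) ->
  (forall e : R, 0 < e -> exists N, forall n, (N <= n)%N -> v n <= e) ->
  exists l : R, forall e, 0 < e -> exists N, forall n, (N <= n)%N -> `|u n - l| <= e.
Proof.
move=> uv v0; have : cvg (u @ \oo).
  apply/cauchy_cvgP/cauchy_ballP => e e0.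
  have [N hN] := v0 (e / 4) (divr_gt0 e0 (ltr0n R 4)).
  exists (u @` [set n | (N <= n)%N], u @` [set n | (N <= n)%N]).
    by split; exists N => // n /= Nn; exists n.
  move=> [x y] [/= [n Nn <-] [m Nm <-]]; rewrite /ball /=.
  apply: le_lt_trans (uv n m) _; have := hN n Nn; have := hN m Nm; lra.
move=> cu; exists (lim (u @ \oo)) => e e0.
have [N _ hN] : \forall n \near \oo, `|lim (u @ \oo) - u n| < e.
  by move/cvgrPdist_lt : cu; apply.
by exists N => n Nn; rewrite distrC; apply/ltW/hN.
Qed.

(** Two sequences that are close to the same random frequencies are close to each
    other, so the approximations form a Cauchy sequence in l1. *)
Lemma l1_limit :
  (forall e, 0 < e -> exists D : nat -> R, [/\ forall k, 0 <= D k,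
    exists B, forall K, \sum_(k < K) D k <= B & l1_close D e]) ->
  exists D : nat -> R, [/\ forall k, 0 <= D k, exists B, forall K, \sum_(k < K) D k <= B &
    forall e, 0 < e -> l1_close D e].
Proof.
move=> H; have in0 (n : nat) : 0 < n.+1%:R^-1 :> R by rewrite invr_gt0.
have [D_ hD] := choice (fun n : nat => H n.+1%:R^-1 (in0 n)).
have v0 (e : R) : 0 < e -> exists N, forall n, (N <= n)%N -> n.+1%:R^-1 <= e.
  move=> e0; exists (Num.trunc e^-1) => n Nn.
  rewrite -[leRHS]invrK lef_pV2 ?posrE ?invr_gt0//.
  by apply/ltW/(lt_le_trans (truncnS_gt _)); rewrite ler_nat.
have [D DE] : exists D, forall k e, 0 < e -> exists N, forall n, (N <= n)%N -> `|D_ n k - D k| <= e.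
  suff /choice[D DE] : forall k, exists l, forall e, 0 < e ->
      exists N, forall n, (N <= n)%N -> `|D_ n k - l| <= e by exists D.
  move=> k.
  apply: (cauchy_limit (v := fun n => n.+1%:R^-1)) => // n m.
  have [_ _ cn] := hD n; have [_ _ cm] := hD m.
  apply: le_trans (l1_close_near k.+1 cn cm).
  by rewrite big_ord_recr/= lerDr sumr_ge0.
have close n K : \sum_(k < K) `|D_ n k - D k| <= 3 * n.+1%:R^-1.
  have c0 : 0 < n.+1%:R^-1 / K.+1%:R :> R by rewrite divr_gt0// invr_gt0.
  have [N hN] := uniform_rank (fun k => DE k _ c0) K.
  pose j := maxn N n; have [_ _ cn] := hD n; have [_ _ cj] := hD j.
  have h1 := l1_close_near K cn cj.
  have h2 : \sum_(k < K) `|D_ j k - D k| <= n.+1%:R^-1.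
    apply: (@le_trans _ _ (\sum_(k < K) n.+1%:R^-1 / K.+1%:R)).
      by apply: ler_sum => k _; apply: hN => //; rewrite leq_maxl.
    rewrite sumr_const card_ord -[_ *+ K]mulr_natr -mulrA ler_piMr ?invr_ge0//.
    by rewrite mulrC ler_pdivrMr// mul1r ler_nat.
  have h3 : j.+1%:R^-1 <= n.+1%:R^-1 :> R.
    by rewrite lef_pV2 ?posrE// ler_nat ltnS leq_maxr.
  have : \sum_(k < K) `|D_ n k - D k| <=
      \sum_(k < K) `|D_ n k - D_ j k| + \sum_(k < K) `|D_ j k - D k|.
    by rewrite -big_split/= ler_sum// => k _; exact: ler_distD.
  by move: h1 h2 h3; move: (n.+1%:R^-1) (j.+1%:R^-1) => y z; lra.
exists D; split.
- move=> k; apply/ler_addgt0Pr => e e0; have [N hN] := DE k e e0.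
  have [D0 _ _] := hD N; have := hN N (leqnn N); have := D0 k.
  by rewrite ler_norml => ? /andP[? ?]; lra.
- have [D0 [B hB] _] := hD 0%N; exists (B + 3 * 1%:R^-1) => K.
  apply: le_trans (lerD (hB K) (close 0%N K)); rewrite -big_split/= ler_sum// => k _.
  by rewrite -lerBlDl distrC; apply: ler_norm.
- move=> e e0; have [N hN] := v0 (e / 4) (divr_gt0 e0 (ltr0n R 4)).
  have [_ _ cN] := hD N; have [r0 hr] := l1_close_trans cN (close N).
  exists r0 => r rr K; apply: le_trans (hr r rr K) _.
  by rewrite lee_fin; have := hN N (leqnn N); move: (N.+1%:R^-1) => y; lra.
Qed.

End l1_limit.

Lemma bernoulli_le (R : realDomainType) (x : R) n : 0 <= x <= 1 -> 1 - x ^+ n <= n%:R * (1 - x).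
Proof.
move=> /andP[x0 x1]; elim: n => [|n IH]; first by rewrite expr0 subrr mul0r.
have xn : x ^+ n <= 1 by exact: exprn_ile1.
have y0 : 0 <= x ^+ n by exact: exprn_ge0.
rewrite exprS -natr1; nra.
Qed.

Lemma latc_large (R : realType) d (n : nat) : (0 < d)%N -> exists rho0 : R,
  forall rho, rho0 <= rho -> (n <= @latc R d rho)%N.
Proof.
move=> d0; exists (d%:R * n%:R) => rho hr.
pose c (i : nat) : {ffun 'I_d -> int} := [ffun=> i%:Z].
have {1}-> : n = ncard (c @` `I_n).
  rewrite ncard_image//; first by rewrite /ncard (card_fset_set (n := n)).
  by move=> i j _ _ /ffunP /(_ (Ordinal d0)); rewrite !ffunE => -[].
apply: ncard_le (@latball_finite R d _) => _ [i /= ii <-]; rewrite /latball /=.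
apply: le_trans hr; apply: edist_le_coord => j; rewrite !mxE ffunE sub0r normrN.
by rewrite -[_%:~R]/(i%:R : R) ger0_norm// ler_nat ltnW.
Qed.

Section convergence.
Context {R : realType} {d : nat} {dO : measure_display} {Omega : measurableType dO}.
Variables (P : probability Omega R) (X : Omega -> set 'rV[R]_d).
Hypothesis hX : poisson_process P X.
Local Notation V := 'rV[R]_d.
Local Notation lat := {ffun 'I_d -> int}.
Local Notation mean := (mean P).
Hypothesis d0 : (0 < d)%N.
Variable alpha : R.
Hypothesis a0 : 0 <= alpha.
Variable code : gclass R d -> nat.
Local Notation block_count := (block_count X alpha code).
Local Notation block_mean := (block_mean P X alpha code).

Definition ccount k (r : R) w : nat := ncl (X w) alpha (inner alpha r) (typed code k).
Definition cells_in (r : R) : R := (@latc R d (r + d%:R))%:R.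
Definition freq k r w : R := (ccount k r w)%:R / cells_in r.

Lemma measurable_freq k r : measurable_fun setT (freq k r).
Proof.
apply: measurable_funM => //; apply: measurable_count => l.
exact: (window_measurable hX d0 a0 r (fun c => (l < c (typed code k))%N)).
Qed.

(** The clusters of the ball are those of the cores of the blocks, up to at most
    one cluster per point outside of these cores. *)
Lemma freq_blocks L h (J : {fset lat}) r w K (m : nat -> R) :
  2 * alpha <= h%:R -> (h.*2.+1 <= L)%N ->
  (forall z, z \in J -> core L h z `<=` (inner alpha r : set V)) -> (forall k, 0 <= m k) ->
  dist freq (fun k => m k / L%:R ^+ d) K r w <=
    (cells_in r)^-1 * (\sum_(c <- fset_set (badcells L h J (r + d%:R)))
       npoints (X w) (box (lv c) 1))%:R +
    (cells_in r)^-1 * (\sum_(k < K)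
       `|\sum_(z <- J) (block_count L h k z w)%:R - (#|` J|)%:R * m k|) +
    `|(#|` J|)%:R / cells_in r - (L%:R ^+ d)^-1| * \sum_(k < K) m k.
Proof.
move=> ah hL JG m0; set U := cells_in r.
have U0 : 0 <= U^-1 by rewrite invr_ge0 /U /cells_in.
have fG : finite_set (X w `&` inner alpha r).
  exact: (locfin_bounded (poisson_locfin hX w) (inner_bounded a0)).
pose bad k := ncard (badcl (X w) alpha L h (inner alpha r) J (typed code k)).
have bads : (\sum_(k < K) bad k <= \sum_(c <- fset_set (badcells L h J (r + d%:R)))
       npoints (X w) (box (lv c) 1))%N.
  have bd := @badcl_types R d (X w) alpha L h (inner alpha r) J fG a0 ah (typed code) K.
  apply: leq_trans (bd _) _.
    by move=> i j [g []]; rewrite /typed /= => <- <-.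
  apply: badpts_cells => //; last exact: inner_bounded.
  by move=> a l; exact: (finite_in_box hX).
apply: (@le_trans _ _ (\sum_(k < K) (U^-1 * (bad k)%:R +
    U^-1 * `|\sum_(z <- J) (block_count L h k z w)%:R - (#|` J|)%:R * m k| +
    `|(#|` J|)%:R / U - (L%:R ^+ d)^-1| * m k))); last first.
  rewrite !big_split/= -!mulr_sumr !lerD2r ler_wpM2l// -natr_sum ler_nat//.
apply: ler_sum => k _; rewrite /freq /ccount (ncl_blocks fG a0 ah JG) natrD natr_sum.
rewrite -/(bad k) -/U.
set S := \sum_(z <- J) _; set n := (#|` J|)%:R.
have -> : ((bad k)%:R + S) / U - m k / L%:R ^+ d =
   U^-1 * (bad k)%:R + U^-1 * (S - n * m k) + (n / U - (L%:R ^+ d)^-1) * m k by ring.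
apply: le_trans (ler_normD _ _) _; rewrite (normrM (_ - _) (m k)) (ger0_norm (m0 k)).
rewrite lerD2r; apply: le_trans (ler_normD _ _) _.
by rewrite !normrM !(ger0_norm U0) (ger0_norm (ler0n _ _)).
Qed.

Lemma mean_cells (s : seq lat) :
  (mean (fun w => (\sum_(c <- s) npoints (X w) (box (lv c) 1))%:R) <=
    ((size s)%:R * @mean_bound R d 1)%:E)%E /\
  measurable_fun setT (fun w => (\sum_(c <- s) npoints (X w) (box (lv c) 1))%:R : R).
Proof.
have mN c : measurable_fun setT (fun w => (npoints (X w) (box (lv c) 1))%:R : R).
  apply/measurable_EFinP; exact: (measurable_npoints hX (bounded_borel_box _ _)).
have [||ms mS] := @mean_sum _ _ _ P _ s (fun c w => (npoints (X w) (box (lv c) 1))%:R).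
- by move=> c _; exact: mN.
- by move=> c w _.
have -> : (fun w => (\sum_(c <- s) npoints (X w) (box (lv c) 1))%:R) =
    (fun w => \sum_(c <- s) (npoints (X w) (box (lv c) 1))%:R : R).
  by apply/funext => w; rewrite natr_sum.
split => //; rewrite ms.
apply: (@le_trans _ _ (\sum_(c <- s) (@mean_bound R d 1)%:E)%E).
  by apply: lee_sum => c _; exact: (mean_npoints hX).
by rewrite sumEFin big_const_seq count_predT iter_addr_0 mulr_natl.
Qed.

(** For blocks of side L the proportion of unit cells outside of the cores is
    about d (2 h + 1) / L. *)
Lemma freq_close (e : R) : 0 < e -> exists D : nat -> R,
  [/\ forall k, 0 <= D k, exists B, forall K, \sum_(k < K) D k <= B & l1_close P freq D e].
Proof.
move=> e0; pose kap := @mean_bound R d 1.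
have kap0 : 0 < kap by exact: expR_gt0.
pose h := (Num.trunc (2 * alpha)).+1.
have ah : 2 * alpha <= h%:R by apply/ltW; exact: truncnS_gt.
pose t : R := d%:R * (h.*2.+1)%:R * kap * 4 / e.
pose L := (h.*2.+1 + (Num.trunc t).+1)%N.
have hL : (h.*2.+1 <= L)%N by rewrite leq_addr.
have L0 : (0 < L)%N by rewrite (leq_trans _ hL).
have LR : 0 < L%:R :> R by rewrite ltr0n.
have tL : t <= L%:R.
  by apply/ltW/(lt_le_trans (truncnS_gt _)); rewrite ler_nat leq_addl.
pose M := @mean_bound R d L%:R; have M0 : 0 < M by exact: expR_gt0.
pose m := block_mean L h.
have m0 k : 0 <= m k by exact: (block_mean_ge0 hX d0 a0 code L0 ah).
have mM K : \sum_(k < K) m k <= M by exact: (block_mean_sum hX d0 a0 code L0 ah).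
have Ld0 : 0 < L%:R ^+ d :> R by rewrite exprn_gt0.
have Ld1 : 1 <= L%:R ^+ d :> R by rewrite exprn_ege1// ler1n.
have Li : (L%:R ^+ d)^-1 <= 1 :> R by rewrite invf_le1.
exists (fun k => m k / L%:R ^+ d); split.
- by move=> k; rewrite divr_ge0// ltW.
- exists M => K; apply: le_trans (mM K); apply: ler_sum => k _.
  by rewrite ler_piMr.
have e4 : 0 < e / 4 by rewrite divr_gt0.
pose e1 := Num.min (2^-1) (e / 4 / (kap + M)).
have kM : 0 < kap + M by rewrite addr_gt0.
have e10 : 0 < e1 by rewrite lt_min invr_gt0 ltr0n/= divr_gt0.
have e12 : e1 <= 2^-1 by rewrite ge_min lexx.
have e1k : e1 * (kap + M) <= e / 4 by rewrite -ler_pdivlMr// ge_min lexx orbT.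
have [n0 hn0] := block_lln hX d0 a0 code L0 ah e4.
have [r1 hr1] := blocks_density d0 hL a0 e10.
have [r2 hr2] := latc_large R (2 * n0 * L ^ d).+1 d0.
exists (Num.max r1 r2) => r; rewrite ge_max => /andP[rr1 rr2] K.
have [J [JG J1 J2 J3]] := hr1 r rr1.
have Ur : (2 * n0 * L ^ d < @latc R d (r + d%:R))%N.
  by apply: hr2; apply: le_trans rr2 _; rewrite lerDl.
pose U := cells_in r; have U0 : 0 < U by rewrite ltr0n (leq_ltn_trans _ Ur).
pose n : R := (#|` J|)%:R.
have nU : n * L%:R ^+ d <= U by rewrite -natrX -natrM ler_nat.
have Un : (1 - e1) * U <= n * L%:R ^+ d by rewrite -natrX -natrM.
have n0J : (n0 <= #|` J|)%N.
  rewrite -(ler_nat R) -/n -(ler_pM2r Ld0); apply: le_trans Un.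
  have : (2 * n0 * L ^ d)%:R <= U by rewrite ler_nat ltnW.
  have : 2^-1 * U <= (1 - e1) * U by rewrite ler_wpM2r ?(ltW U0)//; lra.
  rewrite !natrM natrX -mulrA; move: (n0%:R * _) => x; lra.
have nU1 : n / U <= 1.
  rewrite ler_pdivrMr// mul1r; apply: le_trans nU; rewrite ler_peMr//.
pose b : R := (ncard (badcells L h J (r + d%:R)))%:R.
have bU : b / U * kap <= e / 4 + e1 * kap.
  have q : b + n * (L - h.*2.+1)%:R ^+ d = U by rewrite -natrX -natrM -natrD J3.
  pose x : R := (L - h.*2.+1)%:R / L%:R.
  have x01 : 0 <= x <= 1.
    by rewrite divr_ge0//= ler_pdivrMr// mul1r ler_nat leq_subr.
  have xd : n * (L - h.*2.+1)%:R ^+ d = n * L%:R ^+ d * x ^+ d.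
    by rewrite -mulrA -exprMn /x [L%:R * _]mulrC divfK// gt_eqF.
  have B := bernoulli_le d x01.
  have y0 : 0 <= x ^+ d by rewrite exprn_ge0//; case/andP: x01.
  have y1 : x ^+ d <= 1 by rewrite exprn_ile1//; case/andP: x01.
  have xx : 1 - x = (h.*2.+1)%:R / L%:R.
    by rewrite /x natrB// mulrBl mulfV ?gt_eqF//; ring.
  have tk : d%:R * (1 - x) * kap <= e / 4.
    rewrite xx mulrA -mulrA [_^-1 * _]mulrC mulrA ler_pdivrMr//.
    rewrite -ler_pdivrMl//; apply: le_trans tL; rewrite /t le_eqVlt; apply/orP; left.
    by apply/eqP; field; rewrite gt_eqF.
  have bE : b <= U * (e1 + d%:R * (1 - x)).
    have h1 : (1 - e1) * U * x ^+ d <= n * L%:R ^+ d * x ^+ d by rewrite ler_wpM2r.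
    have h2 : U * (1 - x ^+ d) <= U * (d%:R * (1 - x)) by rewrite ler_wpM2l// ltW.
    have h3 : e1 * U * x ^+ d <= e1 * U by rewrite ler_piMr// mulr_ge0// ltW.
    move: q; rewrite xd => q; move: h1 h2 h3 q; clear; move: (x ^+ d) => y.
    by move: (n * _ * y) (d%:R * (1 - x)) => u v; nra.
  have : b / U <= e1 + d%:R * (1 - x) by rewrite ler_pdivrMr// mulrC.
  move=> /(ler_wpM2r (ltW kap0)) /le_trans; apply; rewrite mulrDl addrC lerD2r//.
pose f1 w : R := (\sum_(c <- fset_set (badcells L h J (r + d%:R)))
  npoints (X w) (box (lv c) 1))%:R.
pose f2 w : R := \sum_(k < K) `|\sum_(z <- J) (block_count L h k z w)%:R - n * m k|.
pose c3 := `|n / U - (L%:R ^+ d)^-1| * \sum_(k < K) m k.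
have [Ef1 mf1] := mean_cells (fset_set (badcells L h J (r + d%:R))).
have mdev k : measurable_fun setT (fun w => `|\sum_(z <- J) (block_count L h k z w)%:R - n * m k|).
  apply: measurableT_comp => //; apply: measurable_funB => //; apply: measurable_sum => z.
  by apply: measurable_count => l; exact: (block_count_measurable hX a0 code L0 ah).
have [||Ef2 mf2] := @mean_sum _ _ _ P _ (index_enum 'I_K) (fun k w =>
    `|\sum_(z <- J) (block_count L h k z w)%:R - n * m k|).
- by move=> k _; exact: mdev.
- by move=> k w _.
have U1 : 0 <= U^-1 by rewrite invr_ge0 ltW.
have c30 : 0 <= c3 by rewrite mulr_ge0// sumr_ge0.
have f10 w : 0 <= f1 w by [].
have f20 w : 0 <= f2 w by rewrite sumr_ge0.
apply: (@le_trans _ _ (mean (fun w => (U^-1 * f1 w + U^-1 * f2 w) + cst c3 w))).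
  apply: mean_le => [||w].
  - exact: (measurable_dist measurable_freq).
  - by apply: measurable_funD => //; apply: measurable_funD; exact: measurable_funM.
  - by rewrite dist_ge0/=; exact: freq_blocks.
rewrite meanD//; last 2 first.
- by apply: measurable_funD; exact: measurable_funM.
- by move=> w; rewrite addr_ge0// mulr_ge0.
rewrite meanD//; try by [exact: measurable_funM|move=> w; rewrite mulr_ge0].
rewrite mean_cst (meanZ P U1 mf1 f10) (meanZ P U1 mf2 f20).
have h1 : (U^-1%:E * mean f1 <= (e / 4 + e1 * kap)%:E)%E.
  apply: le_trans (lee_wpmul2l _ Ef1) _; rewrite ?lee_fin// -/kap.
  by rewrite mulrA [_^-1 * _]mulrC; exact: bU.
have h2 : (U^-1%:E * mean f2 <= (e / 4)%:E)%E.
  have := hn0 J K n0J (fset_uniq _); rewrite -Ef2 -/n -/(f2 _) => hh.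
  apply: le_trans (lee_wpmul2l _ hh) _; rewrite ?lee_fin//.
  have -> : U^-1 * (e / 4 * n) = e / 4 * (n / U) by ring.
  by rewrite ler_piMr// ltW.
have h3 : c3 <= e1 * M.
  have g0 : 0 <= \sum_(k < K) m k by rewrite sumr_ge0.
  apply: ler_pM => //; apply: (@le_trans _ _ (e1 * (L%:R ^+ d)^-1)); last first.
    by rewrite ler_piMr// ltW.
  have -> : n / U - (L%:R ^+ d)^-1 = (n * L%:R ^+ d / U - 1) * (L%:R ^+ d)^-1.
    by field; rewrite !gt_eqF.
  rewrite normrM (gtr0_norm (x := (L%:R ^+ d)^-1)) ?invr_gt0// ler_wpM2r ?invr_ge0 ?(ltW Ld0)//.
  have a1 : 1 - e1 <= n * L%:R ^+ d / U by rewrite ler_pdivlMr.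
  have a2 : n * L%:R ^+ d / U <= 1 by rewrite ler_pdivrMr// mul1r.
  by rewrite ler_norml; lra.
apply: le_trans (leeD (leeD h1 h2) (_ : (c3%:E <= (e1 * M)%:E)%E)) _; first by rewrite lee_fin.
rewrite -!EFinD lee_fin; move: e1k; rewrite mulrDr; lra.
Qed.

Theorem freq_limit : exists D : nat -> R,
  [/\ forall k, 0 <= D k, exists B, forall K, \sum_(k < K) D k <= B &
      forall e, 0 < e -> l1_close P freq D e].
Proof. by apply: l1_limit; [exact: measurable_freq|exact: freq_close]. Qed.

End convergence.

(** * Every type has positive density *)

(** Every point of A is joined within A to a point of the image of B. *)
Lemma homotopy_equiv_connected (R : realType) (T U : topologicalType) (A : set T) (B : set U) :
  homotopy_equiv (R := R) A B -> connected B -> connected A.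
Proof.
move=> [f [g [[cf cg] fA gB [H [cH HA H0 H1]] _]]] cB.
have [[a Aa]|nA] := pselect (exists a, A a); last first.
  by rewrite (_ : A = set0); [exact: connected0|apply/seteqP; split => // a Aa; apply: nA; exists a].
pose path x := (fun t : R => H (t, x)) @` `[0, 1]%classic.
have cS : connected (g @` B) by exact: connected_continuous_connected.
have Bf x : A x -> B (f x) by move=> Ax; apply: fA; exists x.
have i01 (t : R) : `[0, 1]%classic t -> t \in `[0, 1] by [].
have zero : `[0, 1]%classic (0 : R) by rewrite /= in_itv/= lexx ler01.
have one : `[0, 1]%classic (1 : R) by rewrite /= in_itv/= lexx ler01.
have -> : A = \bigcup_(x in A) (g @` B `|` path x).
  apply/seteqP; split => [x Ax|y [x Ax [[b Bb <-]|[t t01 <-]]]].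
  - by exists x => //; right; exists 1 => //; exact: H1.
  - by apply: gB; exists b.
  - exact: HA.
apply: bigcup_connected.
  by exists (g (f a)) => x _; left; exists (f a) => //; exact: Bf.
move=> x Ax; apply: connectedU => //.
  exists (g (f x)); split; first by exists (f x) => //; exact: Bf.
  by exists 0 => //; exact: H0.
apply: connected_continuous_connected; first exact: segment_connected.
have cx : {within `[0, 1]%classic, continuous (fun t : R => (t, x))}.
  by apply: continuous_at_within => t _; apply: continuous_at_pair; [exact: cvg_id|exact: cvg_cst].
have h := within_comp cx _ cH.
exact: h.
Qed.

Section positivity.
Context {R : realType} {d : nat}.
Local Notation V := 'rV[R]_d.

Lemma bounded_borel_diff_bigcup (I : choiceType) (s : {fset I}) (A : set V) (F : I -> set V) :
  bounded_borel A -> (forall i, bounded_borel (F i)) ->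
  bounded_borel (A `\` \bigcup_(i in [set` s]) F i).
Proof.
move=> [mA [r Ar]] bF; split; last by exists r => x [/Ar].
apply: (@measurableD _ (g_sigma_algebraType [set U : set V | open U])) => //.
apply: (@fin_bigcup_measurable _ (g_sigma_algebraType [set U : set V | open U])) => //.
by move=> i _; have [] := bF i.
Qed.

(** The centres of a complex may coincide, while the points of a configuration are
    distinct: the repetitions are dropped, which does not change the union. *)
Lemma class_model (g : gclass R d) : exists (D : {fset V}) (rho : R),
  [/\ 0 < rho, ncl [set` D] rho setT [set g] <> 0%N & D != fset0].
Proof.
have [K gK] := gclassP g; pose n := gc_size K; pose c : 'I_n.+1 -> V := @gc_center R d K.
pose I : {fset 'I_n.+1} := [fset v | v in 'I_n.+1]%fset.
have IT : [set` I] = setT by apply/seteqP; split => v // _; rewrite /= !inE.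
pose D : {fset V} := [fset c v | v in 'I_n.+1]%fset.
pose rho := gc_radius K; have rho0 : 0 < rho := gc_radius_gt0 K.
have UE : ball_union [set` D] rho = \bigcup_(v in [set` I]) eball (c v) rho.
  apply/seteqP; split => [x [p /= /imfsetP[v _ ->] xp]|x [v _ xv]].
    by exists v => //; rewrite IT.
  by exists (c v) => //=; apply/imfsetP; exists v.
have eq : homotopy_equiv (R := R) (ball_union [set` D] rho) (gc_space K).
  by rewrite UE /gc_space -IT; exact: nerve_eballs.
have cU := homotopy_equiv_connected eq (@gc_connected _ _ K).
have lD : locfin ([set` D] : set V) by apply: finite_locfin; exact: finite_fset.
have Dc : c ord0 \in D by apply/imfsetP; exists ord0.
have xU : ball_union [set` D] rho (c ord0).
  by exists (c ord0) => //; rewrite /eball /= edistxx ltW.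
have : components (ball_union [set` D] rho) (ball_union [set` D] rho).
  exists (c ord0) => //; apply/seteqP; split; first exact: connected_component_sub.
  exact: connected_component_max.
rewrite components_ball_union ?(ltW rho0)// => -[C CD CE].
exists D, rho; split => //; last by apply/fset0Pn; exists (c ord0).
move=> n0; have := ncard_eq0 _ n0; have fD : finite_set ([set` D] `&` [set: V]).
  by rewrite setIT; exact: finite_fset.
move=> /(_ (goodcl_finite _ _ fD)) e.
suff : goodcl [set` D] rho setT [set g] C by rewrite e.
by split => //=; rewrite CE; exact: htype_gc_space gK eq.
Qed.

Lemma separated_boxes (D : {fset V}) (b : V -> V) (k : R) : 0 < k ->
  (forall z z', z \in D -> z' \in D -> edist (b z) (b z') = k * edist z z') ->
  forall e : R, 0 < e -> exists l, [/\ 0 < l, d%:R * l <= e &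
    forall z z', z \in D -> z' \in D -> box (b z) l `&` box (b z') l !=set0 -> z = z'].
Proof.
move=> k0 bk e e0; have d1 : (0 : R) <= d%:R by [].
have dS : 0 < d%:R + 1 :> R by rewrite ltr_wpDl.
have dl (x y : R) : 0 < y -> x <= y / (d%:R + 1) -> d%:R * x <= y.
  move=> y0 xy; have y1 : 0 <= y / (d%:R + 1) by rewrite divr_ge0// ltW.
  apply: le_trans (ler_wpM2l d1 xy) _; rewrite mulrA ler_pdivrMr// mulrC ler_wpM2l ?ltW//.
  by rewrite ltrDl.
have [|f f0 Hf] := @exists_common_gap R _ [seq (z, z') | z <- D, z' <- D]
  (fun q l => box (b q.1) l `&` box (b q.2) l !=set0 -> q.1 = q.2); last first.
  exists (Num.min f (e / (d%:R + 1))); split.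
  - by rewrite lt_min f0 divr_gt0.
  - by apply: dl => //; rewrite ge_min lexx orbT.
  - move=> z z' zD z'D; apply: (Hf (z, z')); last by rewrite ge_min lexx.
    by apply/allpairsP; exists (z, z').
move=> _ /allpairsP[[z z'] [/= zD z'D ->]] /=.
have [->|zz'] := eqVneq z z'; first by exists 1.
have ez : 0 < edist z z'.
  rewrite lt_neqAle edist_ge0 andbT eq_sym; apply: contra zz' => /eqP ez.
  apply/eqP/rowP => i; apply/eqP; rewrite -subr_eq0 -normr_le0 -ez; exact: coord_le_edist.
have kz : 0 < k * edist z z' / 3 by rewrite divr_gt0// mulr_gt0.
exists (k * edist z z' / 3 / (d%:R + 1)); first by rewrite divr_gt0.
move=> l hl [x [xz xz']]; exfalso.
have h1 := edist_box xz; have h2 := edist_box xz'; rewrite edistC in h2.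
have := edistD (b z) x (b z'); rewrite bk// leNgt => /negP; apply.
have := dl _ _ kz hl; lra.
Qed.

Context {dO : measure_display} {Omega : measurableType dO}.
Variables (P : probability Omega R) (X : Omega -> set V).
Hypothesis hX : poisson_process P X.
Local Notation mean := (mean P).
Hypothesis d0 : (0 < d)%N.
Variable alpha : R.
Hypothesis a0 : 0 < alpha.
Variable code : gclass R d -> nat.

Lemma npoints1 w (A : set V) : bounded_borel A -> npoints (X w) A = 1%N ->
  exists p, X w `&` A = [set p].
Proof.
move=> [_ [r Ar]] N1; have fA := locfin_bounded (poisson_locfin hX w) Ar.
have /cardfs1P[p pE] : #|` fset_set (X w `&` A)| == 1%N by apply/eqP; exact: N1.
by exists p; rewrite -(fset_setK fA) pE set_fset1.
Qed.

(** The boxes and the rest of W are disjoint, so E is an intersection of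
    independent events, each of positive probability. *)
Lemma configuration_positive (D : {fset V}) (b : V -> V) l (W : set V) :
  0 < l -> bounded_borel W ->
  (forall z z', z \in D -> z' \in D -> box (b z) l `&` box (b z') l !=set0 -> z = z') ->
  exists E : set Omega, [/\ measurable E, (0 < P E)%E & forall w, E w ->
    (forall z, z \in D -> exists p, X w `&` box (b z) l = [set p]) /\
    X w `&` (W `\` \bigcup_(z in [set` D]) box (b z) l) = set0].
Proof.
move=> l0 bW disj; pose rest := W `\` \bigcup_(z in [set` D]) box (b z) l.
pose A (j : option D) := if j is Some z then box (b (val z)) l else rest.
pose B (j : option D) : set nat := if j is Some _ then [set 1%N] else [set 0%N].
have brest : bounded_borel rest.
  by apply: bounded_borel_diff_bigcup => // z; exact: bounded_borel_box.
have bA j : bounded_borel (A j) by case: j => [z|] //; exact: bounded_borel_box.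
pose E := [set w | forall j, B j (npoints (X w) (A j))].
have mE : measurable E.
  have -> : E = \bigcap_(j in [set: option D]) [set w | B j (npoints (X w) (A j))].
    by apply/seteqP; split => w h j; [move=> _; exact: h|exact: h].
  apply: fin_bigcap_measurable; first exact: finite_finset.
  by move=> j _; exact: (poisson_count_measurable hX).
exists E; split => //.
- rewrite (poisson_independent_fin hX)//; last first.
    move=> [z|] [z'|] [x []] //=.
    + move=> xz xz'; congr Some; apply: val_inj; apply: disj; try exact: valP.
      by exists x.
    + by move=> xz [_ nx]; exfalso; apply: nx; exists (val z) => //; exact: valP.
    + by move=> [_ nx] xz; exfalso; apply: nx; exists (val z') => //; exact: valP.
  apply: (big_ind (fun x : \bar R => (0 < x)%E)); [exact: lte01|exact: mule_gt0|].
  move=> j _.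
  case: j => [z|]; rewrite (poisson_law hX)// lte_fin.
    rewrite lebesgue_box ?(ltW l0)//= expr1 mulr_gt0 ?expR_gt0// ?divr_gt0// exprn_gt0//.
  by rewrite /= expr0 mulr_gt0 ?expR_gt0 ?divr_gt0.
- move=> w Ew; split => [z zD|].
    by apply: npoints1; [exact: bounded_borel_box|exact: (Ew (Some [` zD]%fset))].
  have [_ [r rr]] := brest; apply: ncard_eq0; last exact: (Ew None).
  exact: (locfin_bounded (poisson_locfin hX w) rr).
Qed.

(** A scaled copy of the centres fits into a large block; by stability of nerves
    any configuration with one point close to each of them has the same type. *)
Lemma block_mean_positive (g : gclass R d) : exists L h,
  [/\ (h.*2.+1 <= L)%N, 2 * alpha <= h%:R & 0 < block_mean P X alpha code L h (code g)].
Proof.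
have [D [rho [rho0 nD D0]]] := class_model g.
have [e e0 He] := cech_stable D id rho.
pose r' := rho + e / 2; have r'0 : 0 < r' by rewrite addr_gt0// divr_gt0.
pose lam := alpha / r'; have lam0 : 0 < lam by exact: divr_gt0.
have lamr : lam * r' = alpha by rewrite divfK// gt_eqF.
pose h := (Num.trunc (2 * alpha)).+1.
have ah : 2 * alpha <= h%:R by apply/ltW; exact: truncnS_gt.
pose B := \sum_(z <- D) lam * edist 0 z.
have BD z : z \in D -> lam * edist 0 z <= B.
  move=> zD; rewrite /B (bigD1_seq z)//= lerDl sumr_ge0// => y _.
  by rewrite mulr_ge0 ?edist_ge0// ltW.
pose N := (h + (Num.trunc B).+2)%N; pose L := N.*2.
have NB : h%:R + B + 1 < N%:R.
  have := truncnS_gt B; rewrite /N natrD -!natr1; lra.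
have LN : L%:R = N%:R + N%:R :> R by rewrite /L -addnn natrD.
have hL : (h.*2.+1 <= L)%N by rewrite /L /N; lia.
have L0 : (0 < L)%N by apply: leq_trans hL.
pose S : V := const_mx N%:R; pose b (z : V) := lam *: z + S.
have be z z' : edist (b z) (b z') = lam * edist z z'.
  by rewrite edist_shift edistZ gtr0_norm.
have m0 : 0 < Num.min (lam * (e / 2)) 1 by rewrite lt_min ltr01 mulr_gt0// divr_gt0.
have [l [l0 dl disj]] := @separated_boxes D b lam lam0
  (fun z z' (_ : z \in D) (_ : z' \in D) => be z z') _ m0.
move: dl; rewrite le_min => /andP[dl1 dl2].
have l1 : l <= 1 by apply: le_trans dl2; rewrite ler_peMl ?(ltW l0) ?ler1n.
have [E [mE PE EP]] := configuration_positive l0 (bounded_borel_box (org L 0) L%:R) disj.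
exists L, h; split => //; rewrite -lte_fin.
rewrite -(block_meanE hX d0 (ltW a0) code L0 ah (code g) 0).
apply: (lt_le_trans PE); rewrite -(mean_indic P mE).
have mT k : measurable_fun setT (fun w => (block_count X alpha code L h k 0 w)%:R : R).
  by apply: measurable_count => j; exact: (block_count_measurable hX (ltW a0) code L0 ah).
apply: mean_le => [||w]; [exact: measurable_indic|exact: mT|].
rewrite indicE ler0n/=; have [/set_mem Ew|_] := boolP (w \in E); last by rewrite ler0n.
have [hq hrest] := EP w Ew.
have [q qE] : exists q : V -> V, forall z, z \in D -> X w `&` box (b z) l = [set q z].
  suff /choice[q qE] : forall z, exists p, z \in D -> X w `&` box (b z) l = [set p] by exists q.
  by move=> z; have [zD|zD] := boolP (z \in D); [have [p] := hq z zD; exists p|exists 0].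
have qX z : z \in D -> X w (q z) /\ box (b z) l (q z).
  by move=> zD; have : [set q z] (q z) by []; rewrite -qE.
have qcore z : z \in D -> core L h 0 (q z).
  move=> zD i; have [_ /(_ i)] := qX z zD.
  have /(le_trans (coord_le_edist 0 z i)) : edist 0 z <= B / lam.
    by rewrite ler_pdivlMr// mulrC; exact: BD.
  rewrite !mxE ?ffunE mulr0 sub0r normrN ler_pdivlMr// mulrC => zB.
  have : `|lam * z 0 i| <= B by rewrite normrM gtr0_norm.
  by rewrite ler_norml LN; move: NB l1; clear; lra.
have YE : X w `&` block L 0 = q @` [set` D].
  apply/seteqP; split => [p [Xp pb]|_ [z /= zD <-]]; last first.
    by split; [have [] := qX z zD|exact: core_block (qcore z zD)].
  have [[z /= zD pz]|np] := pselect ((\bigcup_(z in [set` D]) box (b z) l) p).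
    by exists z => //; have : [set q z] p by rewrite -qE.
  by have : set0 p by rewrite -hrest; split.
have qinj : {in [set` D] &, injective q}.
  move=> z z' /set_mem zD /set_mem z'D qq; apply: disj => //; exists (q z).
  by split; [have [] := qX z zD|rewrite qq; have [] := qX z' z'D].
have cq : cech [set` D] q alpha = cech [set` D] id rho.
  pose c' z := lam^-1 *: (q z - S).
  have li : `|lam^-1| = lam^-1 by rewrite gtr0_norm// invr_gt0.
  have sc x y : edist (lam^-1 *: (x - S)) (lam^-1 *: (y - S)) <= r' <-> edist x y <= alpha.
    by rewrite edistZ li edist_shift mulrC ler_pdivrMr// mulrC lamr.
  rewrite -(He c' r').
    apply/seteqP; split => T [T0 TD [x xT]]; split => //.
      by exists (lam^-1 *: (x - S)) => v vT; apply/sc; exact: xT.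
    exists (lam *: x + S) => v vT; apply/sc; rewrite addrK scalerA mulVf ?gt_eqF//.
    by rewrite scale1r; exact: xT.
  move=> z zD; have zq : edist z (c' z) <= e / 2.
    have : edist (b z) (q z) <= lam * (e / 2).
      by apply: le_trans dl1; apply: edist_box; have [] := qX z zD.
    have -> : q z = b (c' z) by rewrite /b /c' scalerA mulfV ?gt_eqF// scale1r subrK.
    by rewrite be ler_pM2l.
  by rewrite /r'; split; lra.
have -> : block_count X alpha code L h (code g) 0 w =
    ncl [set` D] rho setT (typed code (code g)).
  rewrite /block_count /ncl -(@goodcl_restrict _ _ (X w) (block L 0)); last 2 first.
  - by move=> p [_ /core_block].
  - by move=> p p' [_ pc] _; exact: (core_near ah pc).
  rewrite YE -[LHS]/(ncl _ _ _ _); apply: ncl_pattern => //.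
  by move=> z /= zD; split => // _; exact: qcore.
rewrite ler1n; apply: (@leq_trans (ncl [set` D] rho setT [set g])).
  by rewrite lt0n; apply/eqP.
apply: ncard_le; first by apply: goodclS => _ ->.
by apply: goodcl_finite; rewrite setIT; exact: finite_fset.
Qed.

(** The clusters inside the cores of the blocks already have the mean density
    block_mean k / L ^ d, up to the blocks near the boundary. *)
Lemma limit_positive (D : nat -> R) (g : gclass R d) : (forall k, 0 <= D k) ->
  (forall e, 0 < e -> l1_close P (freq X alpha code) D e) -> 0 < D (code g).
Proof.
move=> D0 hD; have [L [h [hL ah m0]]] := block_mean_positive g.
move: (code g) m0 => k m0; pose m := block_mean P X alpha code L h k.
have L0 : (0 < L)%N by apply: leq_trans hL.
have Ld0 : 0 < L%:R ^+ d :> R by rewrite exprn_gt0// ltr0n.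
have e0 : 0 < m / L%:R ^+ d / 4 by rewrite !divr_gt0.
have [r1 hr1] := hD _ e0.
have half0 : 0 < 1 / 2 :> R by rewrite divr_gt0.
have [r2 hr2] := blocks_density d0 hL (ltW a0) half0.
pose r := Num.max (Num.max r1 r2) 0.
have [|J [JG J1 _ _]] := hr2 r; first by rewrite /r !le_max lexx orbT.
have h1 : (mean (dist (freq X alpha code) D k.+1 r) <= (m / L%:R ^+ d / 4)%:E)%E.
  by apply: hr1; rewrite /r !le_max lexx.
pose U : R := @cells_in R d r; pose n : R := (#|` J|)%:R.
have U0 : 0 < U.
  by rewrite ltr0n latc_gt0// addr_ge0// le_max lexx orbT.
have mT z : measurable_fun setT (fun w => (block_count X alpha code L h k z w)%:R : R).
  by apply: measurable_count => j; exact: (block_count_measurable hX (ltW a0) code L0 ah).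
have [|//|ET mS] := @mean_sum _ _ _ P _ (J : seq _) (fun z w => (block_count X alpha code L h k z w)%:R : R).
  by move=> z _.
have lower : ((n / U * m)%:E <= mean (freq X alpha code k r))%E.
  have -> : (n / U * m)%:E = mean (fun w => U^-1 * \sum_(z <- J) (block_count X alpha code L h k z w)%:R).
    rewrite (meanZ P _ mS) ?invr_ge0 ?(ltW U0)//; last by move=> w; rewrite sumr_ge0.
    rewrite ET (eq_bigr (fun=> m%:E)) => [|z _]; last first.
      exact: (block_meanE hX d0 (ltW a0) code L0 ah).
    rewrite sumEFin big_const_seq count_predT iter_addr_0 -mulr_natl -EFinM; congr _%:E.
    by rewrite /n; ring.
  apply: mean_le => [||w]; [exact: measurable_funM|exact: (measurable_freq hX d0 (ltW a0))|].
  rewrite mulr_ge0 ?invr_ge0 ?(ltW U0) ?sumr_ge0//= /freq mulrC ler_wpM2r ?invr_ge0 ?(ltW U0)//.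
  rewrite -natr_sum ler_nat /ccount (ncl_blocks _ (ltW a0) ah JG) ?leq_addl//.
  exact: (locfin_bounded (poisson_locfin hX w) (inner_bounded (ltW a0))).
have upper : (mean (freq X alpha code k r) <= (D k + m / L%:R ^+ d / 4)%:E)%E.
  have mf := measurable_freq hX d0 (ltW a0) code.
  apply: (@le_trans _ _ (mean (fun w => cst (D k) w + dist (freq X alpha code) D k.+1 r w))).
    apply: mean_le => [||w]; first exact: mf.
      by apply: measurable_funD => //; exact: measurable_dist.
    rewrite divr_ge0//= -lerBlDl; apply: le_trans (ler_norm _) _.
    by rewrite /dist big_ord_recr/= lerDr sumr_ge0.
  rewrite meanD//; try by [exact: measurable_dist|move=> w; exact: dist_ge0|move=> w; exact: D0].
  by rewrite mean_cst EFinD leeD.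
have : n / U * m <= D k + m / L%:R ^+ d / 4 by rewrite -lee_fin; exact: le_trans lower upper.
have : 1 / 2 / L%:R ^+ d <= n / U.
  rewrite ler_pdivrMr// mulrAC ler_pdivlMr//; apply: le_trans (_ : (1 - 1 / 2) * U <= _).
    by rewrite le_eqVlt; apply/orP; left; apply/eqP; field.
  by move: J1; rewrite natrM natrX.
move=> /(ler_wpM2r (ltW m0)); rewrite -/m.
have -> : 1 / 2 / L%:R ^+ d * m = m / L%:R ^+ d / 4 * 2 by field; rewrite gt_eqF.
by move: e0; lra.
Qed.

End positivity.

(** * Convergence of the empirical distribution of the types *)

(** A complex is described, up to isomorphism of its nerve, by the number of its
    balls and by the finite set of the simplices of its nerve. *)
Lemma gclass_code (R : realType) d : exists code : gclass R d -> nat, injective code.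
Proof.
pose nerve (K : gcomplex R d) := cech setT (@gc_center R d K) (gc_radius K).
pose simp (K : gcomplex R d) : {set {set 'I_(gc_size K).+1}} :=
  finset (fun S : {set 'I_(gc_size K).+1} => `[< nerve K [fset x | x in S]%fset >]).
have simpP (K K' : gcomplex R d) : gc_size K = gc_size K' -> choice.pickle (simp K) = choice.pickle (simp K') ->
    hclass (gc_space K) = hclass (gc_space K').
  rewrite /simp /nerve; case: K => n c r r0 cc; case: K' => n' c' r' r0' cc' /= nn'.
  case: n' / nn' c' cc' => c' cc' /(pcan_inj choice.pickleK)/setP e.
  suff e' : cech setT c r = cech setT c' r' by rewrite /gc_space /= e'.
  apply/funext => S; apply/propext.
  have SE : S = [fset x | x in finset (fun x => x \in S)]%fset.
    by apply/fsetP => x; rewrite !inE/= ?inE.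
  have := e (finset (fun x => x \in S)); rewrite !inE -SE => /eqP.
  by case: asboolP; case: asboolP.
pose K (g : gclass R d) := sval (cid (gclassP g)).
have KP (g : gclass R d) : gclass_set g = hclass (gc_space (K g)) by rewrite /K; case: cid.
exists (fun g => choice.pickle (gc_size (K g), choice.pickle (simp (K g)))).
move=> g g' /(pcan_inj choice.pickleK)[e1 e2]; apply: gclass_inj; rewrite !KP.
exact: simpP.
Qed.

Lemma discrete_probability (R : realType) (dT : measure_display) (T : measurableType dT)
    (nu : probability T R) (D : nat -> R) (B : R) (dec : nat -> T) :
  (forall k, 0 <= D k) -> (forall K, \sum_(k < K) D k <= B) -> (exists k, 0 < D k) ->
  exists (mu : probability T R) (S : R), 0 < S /\
    forall A, measurable A ->
      \sum_(k < n) D k * (dec k \in A)%:R @[n --> \oo] --> S * fine (mu A).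
Proof.
move=> D0 DB [k0 Dk0].
pose M := mseries (fun k => mscale (NngNum (D0 k)) (dirac (dec k))) 0 : {measure set T -> \bar R}.
pose mass (A : set T) n : R := \sum_(k < n) D k * (dec k \in A)%:R.
have mass_le A n : mass A n <= B.
  apply: le_trans (DB n); apply: ler_sum => k _; rewrite ler_piMr//.
  by case: (_ \in _).
have mass_cvg A : cvgn (mass A).
  apply: nondecreasing_is_cvgn.
    apply/nondecreasing_seqP => n; rewrite /mass big_ord_recr/= lerDl mulr_ge0//.
  by exists B => _ [n _ <-]; exact: mass_le.
have ME A : M A = (limn (mass A))%:E.
  apply/cvg_lim => //.
  have -> : (fun n => (\sum_(0 <= k < n) mscale (NngNum (D0 k)) (dirac (dec k)) A)%E) =
      EFin \o mass A.
    apply/funext => n /=; rewrite /mass -sumEFin big_mkord; apply: eq_bigr => k _.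
    by rewrite /mscale /= diracE EFinM.
  by apply: cvg_EFin; [exact: nearW|exact: mass_cvg].
pose S := limn (mass setT).
have S0 : 0 < S.
  apply: (lt_le_trans Dk0); apply: limr_ge; first exact: mass_cvg.
  exists k0.+1 => // n /= kn; rewrite /mass.
  rewrite (bigD1 (Ordinal kn))//= in_setT mulr1 lerDl sumr_ge0// => k _.
  by rewrite mulr_ge0.
exists (mnormalize M nu : probability T R), S; split => // A mA.
have -> : S * fine (mnormalize M nu A) = limn (mass A); last exact: mass_cvg.
rewrite /mnormalize !ME eqe gt_eqF//= -[X in fine (X * _)%E]/(M A) ME -/S /= [X in S * X]mulrC mulVKf// gt_eqF//.
Qed.

Section empirical.
Context {R : realType} {d : nat}.
Local Notation V := 'rV[R]_d.
Variables (X : set V) (alpha : R) (G : set V).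
Hypothesis fXG : finite_set (X `&` G).
Variables (code : gclass R d -> nat) (dec : nat -> gclass R d).
Hypothesis decK : cancel code dec.

(** Finitely many clusters have finitely many types, hence bounded codes. *)
Lemma ncl_by_code (A : set (gclass R d)) : exists K0, forall K, (K0 <= K)%N ->
  (\sum_(k < K) (dec k \in A) * ncl X alpha G (typed code k) = ncl X alpha G A)%N.
Proof.
have [K0 hK] := @exists_common_rank _ (goodcl X alpha G A)
  (fun C N => (code (htype R d (ball_union C alpha)) < N)%N) (goodcl_finite _ _ fXG)
  (fun C _ => ex_intro _ (code (htype R d (ball_union C alpha))).+1 (fun N h => h)).
exists K0 => K KK; pose F k := if dec k \in A then goodcl X alpha G (typed code k) else set0.
have fF k : finite_set (F k).
  by rewrite /F; case: ifP => // _; exact: goodcl_finite.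
transitivity (\sum_(k <- iota 0 K) ncard (F k))%N.
  have -> : iota 0 K = index_iota 0 K by rewrite /index_iota subn0.
  rewrite big_mkord; apply: eq_bigr => k _; rewrite /F.
  by case: (dec k \in A); rewrite ?mul1n// mul0n ncard0.
rewrite -ncard_bigcup ?iota_uniq//.
- congr ncard; apply/seteqP; split => [C [k /= _]|C CA].
    rewrite /F; case: ifPn => // /set_mem dA [CX CG]; rewrite /typed /= => ck.
    by split => //; move: dA; rewrite -ck decK.
  have [CX CG CA'] := CA; exists (code (htype R d (ball_union C alpha))).
    by rewrite /= mem_iota add0n /=; exact: hK.
  by rewrite /F decK mem_set.
- move=> i j _ _ [C []]; rewrite /F; case: ifP => // _ [_ _ ci]; case: ifP => // _ [_ _ cj].
  by rewrite -ci -cj.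
Qed.

Variables (D : nat -> R) (S U eta : R) (mu : probability (gclass R d) R).
Hypothesis S0 : 0 < S.
Hypothesis U0 : 0 < U.
Hypothesis muE : forall A : set (gclass R d), \sum_(k < n) D k * (dec k \in A)%:R @[n --> \oo] --> S * fine (mu A).
Hypothesis close : forall K, \sum_(k < K) `|(ncl X alpha G (typed code k))%:R / U - D k| <= eta.

Lemma class_density_close (A : set (gclass R d)) :
  `|(ncl X alpha G A)%:R / U - S * fine (mu A)| <= eta.
Proof.
apply/ler_addgt0Pr => e e0; have [K0 hK] := ncl_by_code A.
have [K1 _ hK1] : \forall n \near \oo,
    `|S * fine (mu A) - \sum_(k < n) D k * (dec k \in A)%:R| < e.
  by move/cvgrPdist_lt : (@muE A); apply.
pose K := maxn K0 K1.
have := hK1 K (leq_maxr _ _); rewrite /= distrC => h1.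
rewrite -(hK K (leq_maxl _ _)).
apply: le_trans (ler_distD (\sum_(k < K) D k * (dec k \in A)%:R) _ _) _.
apply: lerD (ltW h1); apply: le_trans (close K).
rewrite natr_sum mulr_suml -sumrB; apply: le_trans (ler_norm_sum _ _ _) _.
apply: ler_sum => k _; rewrite natrM; case: (dec k \in A).
  by rewrite mul1r mulr1.
by rewrite mul0r mulr0 mul0r subrr normr0.
Qed.

Lemma empirical_close (nu : probability (gclass R d) R) (eps : R) :
  eta < S -> 2 * eta <= eps * S ->
  (dTV (fun A => if ncl X alpha G setT == 0%N then nu A
    else ((ncl X alpha G A)%:R / (ncl X alpha G setT)%:R)%:E) mu <= eps%:E)%E.
Proof.
move=> etaS etae; apply: ub_ereal_sup => _ [A _ <-].
have dA := class_density_close A; have := class_density_close setT.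
have -> : fine (mu setT) = 1 by rewrite probability_setT.
rewrite mulr1; move: dA; set a := (ncl X alpha G A)%:R; set t := (ncl X alpha G setT)%:R => dA dT.
have mA : mu A = (fine (mu A))%:E by rewrite fineK// fin_num_measure.
case: eqP => [n0|n0].
  exfalso; move: dT; rewrite /t n0 mul0r sub0r normrN gtr0_norm// => h.
  by have := le_lt_trans h etaS; rewrite ltxx.
have t0 : 0 < t by rewrite ltr0n lt0n; apply/eqP.
have a0 : 0 <= a by [].
have at_ : a <= t.
  by rewrite ler_nat; apply: ncard_le; [move=> C []|exact: goodcl_finite].
rewrite mA -EFinB abse_EFin lee_fin -(ler_pM2r S0); apply: le_trans etae.
rewrite -[X in _ * X](gtr0_norm S0) -normrM.
have -> : (a / t - fine (mu A)) * S =
    a / t * (S - t / U) + (a / U - S * fine (mu A)).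
  by field; rewrite !gt_eqF.
apply: le_trans (ler_normD _ _) _; rewrite mulr_natl mulr2n; apply: lerD => //.
rewrite normrM distrC ger0_norm ?divr_ge0 ?(ltW t0)//.
have r1 : a / t <= 1 by rewrite ler_pdivrMr// mul1r.
have r0 : 0 <= a / t by rewrite divr_ge0// ltW.
by apply: le_trans dT; rewrite ler_piMl.
Qed.

End empirical.

Section deviation.
Context {R : realType} {dO : measure_display} {Omega : measurableType dO}.
Variable P : probability Omega R.
Variables (f : nat -> R -> Omega -> R) (D : nat -> R).
Hypothesis mf : forall k r, measurable_fun setT (f k r).

Lemma measurable_far K r (eta : R) : measurable [set w | eta < dist f D K r w].
Proof.
rewrite -[X in measurable X]setTI.
have -> : [set w | eta < dist f D K r w] = dist f D K r @^-1` `]eta, +oo[%classic.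
  by apply/seteqP; split => w /=; rewrite in_itv/= andbT.
by apply: (measurable_dist mf) => //; exact: measurable_itv.
Qed.

(** Markov's inequality, and continuity of P along the increasing events. *)
Lemma far_small r (eta e : R) : 0 < eta ->
  (forall K, (mean P (dist f D K r) <= (e * eta)%:E)%E) ->
  (P (\bigcup_K [set w | (eta < dist f D K r w)%R]) <= e%:E)%E.
Proof.
move=> eta0 hm; pose B K := [set w | eta < dist f D K r w].
have mB K : measurable (B K) by exact: measurable_far.
have PB K : (P (B K) <= e%:E)%E.
  have h : (mean P (fun w => (eta * \1_(B K) w)%R) <= mean P (dist f D K r))%E.
    apply: mean_le => [||w].
    - by apply: measurable_funM => //; exact: measurable_indic.
    - exact: measurable_dist.
    - rewrite mulr_ge0 ?(ltW eta0)//= indicE; have [/set_mem Bw|_] := boolP (w \in B K).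
        by rewrite mulr1 ltW.
      by rewrite mulr0 dist_ge0.
  have := le_trans h (hm K).
  have mi : measurable_fun setT (\1_(B K) : Omega -> R) by exact: measurable_indic.
  rewrite (meanZ P (ltW eta0) mi)// mean_indic// EFinM muleC.
  by rewrite lee_pmul2r// lte_fin.
have ndB : nondecreasing_seq B.
  apply/nondecreasing_seqP => K; apply/subsetPset => w; rewrite /B /= => /lt_le_trans; apply.
  by rewrite /dist big_ord_recr/= lerDl.
have mU : measurable (\bigcup_K B K) by exact: bigcup_measurable.
have := nondecreasing_cvg_mu mB mU ndB (mu := P).
move=> /(@cvg_lim _ (@ereal_hausdorff R)) <-.
apply: lime_le; last by apply: nearW => K /=; exact: PB.
apply/cvg_ex; eexists; exact: (nondecreasing_cvg_mu mB mU ndB).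
Qed.

End deviation.

Theorem theorem1p3 (R : realType) (d : nat) (hd : (1 <= d)%N)
    (alpha : R) (halpha : 0 < alpha)
    (dO : measure_display) (Omega : measurableType dO)
    (P : probability Omega R) (X : Omega -> set 'rV[R]_d)
    (hX : poisson_process P X) :
  exists mu : probability (gclass R d) R,
    (forall g : gclass R d, (0 < mu [set g])%E) /\
    forall (nu : probability (gclass R d) R) (eps : R), 0 < eps ->
      (forall r : R, measurable
        [set w | (eps%:E < dTV (mu_in nu (X w) alpha r) mu)%E]) /\
      P [set w | (eps%:E < dTV (mu_in nu (X w) alpha r) mu)%E]
        @[r --> +oo] --> 0%E.
Proof.
have a0 := ltW halpha.
have [code code_inj] := gclass_code R d.
pose dec k : gclass R d := xget point [set g | code g = k].
have decK : cancel code dec.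
  by move=> g; apply: code_inj; exact: (xgetPex point (ex_intro (fun h => code h = code g) g erefl)).
have [D [D0 [B DB] hD]] := freq_limit hX hd a0 code.
have Dpos g : 0 < D (code g) by exact: (limit_positive hX hd halpha g D0 hD).
have [mu [S [S0 muE]]] := discrete_probability (dirac point) dec D0 DB
  (ex_intro _ (code point) (Dpos point)).
have {}muE A := muE A I.
exists mu; split => [g|nu eps eps0].
  have : D (code g) <= S * fine (mu [set g]).
    have := muE [set g]; move=> /(@cvg_lim _ (@Rhausdorff R)) <-.
    apply: limr_ge; first by apply/cvg_ex; eexists; exact: muE.
    exists (code g).+1 => // n /= gn.
    rewrite (bigD1 (Ordinal gn))//= decK mem_set// mulr1 lerDl sumr_ge0// => k _.
    by rewrite mulr_ge0.
  move=> /(lt_le_trans (Dpos g)); rewrite pmulr_rgt0// => h.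
  by rewrite -(@fineK _ (mu [set g])) ?fin_num_measure// lte_fin.
have mE r w : mu_in nu (X w) alpha r = (fun A =>
    if ncl (X w) alpha (inner alpha r) setT == 0%N then nu A else
    ((ncl (X w) alpha (inner alpha r) A)%:R /
     (ncl (X w) alpha (inner alpha r) setT)%:R)%:E).
  by apply/funext => A; exact: (mu_inE r (poisson_locfin hX w) a0).
have mfar r : measurable [set w | (eps%:E < dTV (mu_in nu (X w) alpha r) mu)%E].
  have -> : [set w | (eps%:E < dTV (mu_in nu (X w) alpha r) mu)%E] =
      [set w | (fun c : set (gclass R d) -> nat => (eps%:E < dTV (fun A =>
        if c setT == 0%N then nu A else ((c A)%:R / (c setT)%:R)%:E) mu)%E : Prop)
        (ncl (X w) alpha (inner alpha r))].
    by apply/funext => w /=; rewrite mE.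
  exact: (window_measurable hX hd a0 r (fun c => (eps%:E < dTV (fun A =>
        if c setT == 0%N then nu A else ((c A)%:R / (c setT)%:R)%:E) mu)%E)).
split => //.
(* The bound eta < S makes the number of clusters positive. *)
pose eta := S * Num.min (eps / 2) (1 / 2).
have eta0 : 0 < eta by rewrite mulr_gt0// lt_min !divr_gt0.
have etaS : eta < S.
  rewrite /eta gtr_pMr//; apply: (@le_lt_trans _ _ (1 / 2)); first by rewrite ge_min lexx orbT.
  by rewrite ltr_pdivrMr// mul1r ltr1n.
have etae : 2 * eta <= eps * S.
  have : Num.min (eps / 2) (1 / 2) <= eps / 2 by rewrite ge_min lexx.
  rewrite /eta => h; have := ler_wpM2l (ltW S0) h; lra.
have mfq := measurable_freq hX hd a0 code.
have small e : 0 < e -> exists r0, forall r, r0 <= r ->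
    (P [set w | (eps%:E < dTV (mu_in nu (X w) alpha r) mu)%E] <= e%:E)%E.
  move=> e0; have [r0 hr] := hD _ (mulr_gt0 e0 eta0).
  exists (Num.max r0 0) => r; rewrite ge_max => /andP[rr r00].
  apply: le_trans (far_small (D := D) mfq eta0 (hr r rr)).
  apply: le_measure; rewrite ?inE//.
    by apply: bigcup_measurable => K _; exact: measurable_far.
  move=> w /= dw; apply: contrapT => nw; move: dw; rewrite ltNge => /negP; apply.
  have U0 : 0 < @cells_in R d r by rewrite ltr0n latc_gt0// addr_ge0.
  rewrite mE; apply: (@empirical_close _ _ _ _ _ _ code dec decK D S (@cells_in R d r) eta) => //.
    exact: (locfin_bounded (poisson_locfin hX w) (inner_bounded a0)).
  by move=> K; rewrite leNgt; apply/negP => h; apply: nw; exists K.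
apply/fine_cvgP; split; first by apply: nearW => r; exact: fin_num_measure.
apply/cvgrPdist_le => e e0; have [r0 hr] := small e e0.
exists r0; split; first exact: num_real.
move=> r /ltW rr /=; rewrite sub0r normrN ger0_norm ?fine_ge0//.
by rewrite -lee_fin fineK ?fin_num_measure//; exact: hr.
Qed.
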